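(* Let $\mathcal{H}$ be a complex Hilbert space and let $f:\mathbb{D}\to\mathcal{B}(\mathcal{H})$ be holomorphic with expansion $f(z)=\sum_{n=0}^{\infty}A_nz^n$, $z\in\mathbb{D}$, such that $|f(z)|>I$ for all $z\in\mathbb{D}$. Suppose also that $f(z)$ is normal for each $z\in\mathbb{D}$, that $f(0)=A_0>0$, and that the spectrum $\sigma(f(z))$ does not separate $0$ from $\infty$ for any $z\in\mathbb{D}$. Then $$\lambda\left(\sum_{n=0}^{\infty}\|A_n\|r^n,\ \|A_0\|\right)\le \lambda\left(\|A_0\|,1\right)$$ for all $r\geq 0$ with $$r\le \frac{2\left(\log\|A_0\|/\|\log A_0\|\right)-1}{2\left(\log\|A_0\|/\|\log A_0\|\right)+1}.$$
   Context: $\mathbb{D}=\{z\in\mathbb{C}:|z|<1\}$. $\mathcal{B}(\mathcal{H})$ is the set of bounded linear operators on $\mathcal{H}$, $I$ is the identity operator, $\|\cdot\|$ is the operator norm, $|A|=(A^*A)^{1/2}$ (unique positive square root), and $\sigma(A)$ is the spectrum of $A$. For self-adjoint $A,B\in\mathcal{B}(\mathcal{H})$, $A>B$ means $\langle Ax,x\rangle>\langle Bx,x\rangle$ for all $x\in\mathcal{H}\setminus\{0\}$. A compact set $K\subset\mathbb{C}$ with $0\notin K$ does not separate $0$ from $\infty$ if $0$ lies in the unbounded connected component of $\mathbb{C}\setminus K$. The operator $\log A_0$ is defined by the holomorphic functional calculus using the principal branch of the logarithm on $\mathbb{C}\setminus(-\infty,0]$ (under the hypotheses, $\sigma(A_0)\subset[1,\infty)$).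 The spherical distance $\lambda$ on $\mathbb{C}\cup\{\infty\}$ is given by $\lambda(z_1,z_2)=\dfrac{|z_1-z_2|}{\sqrt{1+|z_1|^2}\sqrt{1+|z_2|^2}}$ for $z_1,z_2\in\mathbb{C}$ and $\lambda(z_1,\infty)=\dfrac{1}{\sqrt{1+|z_1|^2}}$. *)

(* Defs.v *)
From HB Require Import structures.
From mathcomp Require Import all_boot all_order all_algebra.
From mathcomp Require Import complex sesquilinear.
From mathcomp Require Import all_classical all_reals all_analysis.

Set Implicit Arguments.
Unset Strict Implicit.
Unset Printing Implicit Defensive.

Import Order.TTheory GRing.Theory Num.Theory Num.Def.
Import numFieldNormedType.Exports.

Local Open Scope classical_set_scope.
Local Open Scope complex_scope.
Local Open Scope ring_scope.

Definition cabs {R : realType} (z : R[i]) : R := complex.Re `|z|.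

(* The Banach space B(H).  Norms of an [R[i]]-normed module take values in
   [R[i]]; [opnorm] is the operator norm as a real number and the norm of the
   normed-module structure is its image in [R[i]]. *)

Section BoundedOperators.
Context {R : realType} (H : normedModType R[i]).

Let realCD (x y : R) : (x + y)%:C = x%:C + y%:C. Proof. exact: rmorphD. Qed.
Let realCM (x y : R) : (x * y)%:C = x%:C * y%:C. Proof. exact: rmorphM. Qed.
Let ReN (V : normedModType R[i]) (x : V) : (complex.Re `|x|)%:C = `|x|.
Proof. exact: RRe_real. Qed.
Let ReC (a : R[i]) : (complex.Re `|a|)%:C = `|a|.
Proof. by rewrite RRe_real. Qed.

Definition bounded_operator : {pred (H -> H)} := fun A =>
  `[< linear A /\ exists M : R, forall x, `|A x| <= M%:C * `|x| >].

Record bop := Bop { bop_fun :> H -> H; _ : bop_fun \in bounded_operator }.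

HB.instance Definition _ := [isSub for bop_fun].
HB.instance Definition _ := [Choice of bop by <:].

Lemma bounded_operator_submod_closed : submod_closed bounded_operator.
Proof.
split.
  apply/asboolP; split; first by move=> a u v; rewrite /= scaler0 addr0.
  by exists 0 => x; rewrite /= normr0 mul0r.
move=> a A B /asboolP[lA [M AM]] /asboolP[lB [N BN]]; apply/asboolP; split.
  move=> b u v; rewrite !fctE lA lB !scalerDr !scalerA [a * b]mulrC -!addrA.
  by congr (_ + _); rewrite addrCA.
exists (complex.Re `|a| * M + N) => x; rewrite !fctE.
rewrite (le_trans (ler_normD _ _))// normrZ realCD realCM ReC.
rewrite mulrDl; apply: lerD; last exact: BN.
by rewrite -mulrA; apply: ler_wpM2l => //; exact: AM.
Qed.

HB.instance Definition _ :=
  GRing.isSubmodClosed.Build _ _ bounded_operator bounded_operator_submod_closed.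
HB.instance Definition _ := [SubChoice_isSubLmodule of bop by <:].

Lemma bop_linear (A : bop) : linear A.
Proof. by case: A => A /= /asboolP[]. Qed.

Lemma bop0 (A : bop) : A 0 = 0.
Proof.
by have := bop_linear A (-1) 0 0; rewrite scaleN1r oppr0 addr0 scaleN1r addNr.
Qed.

Lemma bop_bounded (A : bop) : exists M : R, forall x, `|A x| <= M%:C * `|x|.
Proof. by case: A => A /= /asboolP[]. Qed.

Definition opnorm (A : bop) : R :=
  sup [set complex.Re `|A x| | x in [set x : H | `|x| <= 1]].

Lemma opnorm_has_sup (A : bop) :
  has_sup [set complex.Re `|A x| | x in [set x : H | `|x| <= 1]].
Proof.
split; first by exists (complex.Re `|A 0|), 0 => //=; rewrite normr0.
have [M AM] := bop_bounded A; exists `|M| => _ [x /= x1 <-].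
rewrite -lecR ReN (le_trans (AM x))//.
rewrite (@le_trans _ _ (`|M|%:C * `|x|))//.
  by rewrite ler_wpM2r// lecR ler_norm.
by rewrite -[leRHS]mulr1 ler_wpM2l// ler0c.
Qed.

Lemma opnorm_ge0 A : 0 <= opnorm A.
Proof.
rewrite (@le_trans _ _ (complex.Re `|A 0|))//; first by rewrite -ler0c ReN.
by apply: sup_upper_bound; [exact: opnorm_has_sup|exists 0 => //=; rewrite normr0].
Qed.

Lemma opnorm_le (A : bop) x : `|A x| <= (opnorm A)%:C * `|x|.
Proof.
have [->|x0] := eqVneq x 0.
  by rewrite bop0 !normr0 mulr0.
have nx0 : `|x| != 0 by rewrite normr_eq0.
rewrite -ler_pdivrMr ?normr_gt0//.
have -> : `|A x| / `|x| = `|A (`|x|^-1 *: x)|.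
  have := bop_linear A `|x|^-1 x 0; rewrite bop0 !addr0 => ->.
  by rewrite normrZ normfV normr_id mulrC.
rewrite -ReN lecR; apply: sup_upper_bound; first exact: opnorm_has_sup.
by exists (`|x|^-1 *: x) => //=; rewrite normrZ ger0_norm ?invr_ge0// mulVf.
Qed.

Lemma opnorm_least (A : bop) (M : R) : 0 <= M ->
  (forall x, `|A x| <= M%:C * `|x|) -> opnorm A <= M.
Proof.
move=> M0 AM; apply: ge_sup; first by have [] := opnorm_has_sup A.
move=> _ [x /= x1 <-]; rewrite -lecR ReN (le_trans (AM x))//.
by rewrite -[leRHS]mulr1 ler_wpM2l// ler0c.
Qed.

Lemma bop_normD A B : (opnorm (A + B))%:C <= (opnorm A)%:C + (opnorm B)%:C.
Proof.
rewrite -realCD lecR; apply: opnorm_least => [|x].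
  by rewrite addr_ge0// opnorm_ge0.
rewrite realCD mulrDl (le_trans (ler_normD _ _))//.
by rewrite lerD// opnorm_le.
Qed.

Lemma bop_normZ (a : R[i]) A : (opnorm (a *: A))%:C = `|a| * (opnorm A)%:C.
Proof.
have le b B : opnorm (b *: B) <= complex.Re `|b| * opnorm B.
  apply: opnorm_least => [|x].
    by rewrite mulr_ge0 ?opnorm_ge0// -ler0c ReC.
  rewrite [X in `|X|](_ : _ = b *: B x)// normrZ realCM ReC -mulrA.
  by rewrite ler_wpM2l// opnorm_le.
apply/eqP; rewrite eq_le; apply/andP; split.
  by rewrite -[X in X * _]ReC -realCM lecR.
have [->|a0] := eqVneq a 0; first by rewrite normr0 mul0r ler0c opnorm_ge0.
have := le a^-1 (a *: A); rewrite scalerA mulVf// scale1r -lecR realCM.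
by rewrite ReC normfV ler_pdivlMl ?normr_gt0.
Qed.

Lemma bop_norm0_eq0 A : (opnorm A)%:C = 0 -> A = 0.
Proof.
move=> A0; apply/val_inj/funext => x; apply/eqP.
by rewrite -normr_le0 (le_trans (opnorm_le A x))// A0 mul0r.
Qed.

HB.instance Definition _ := Lmodule_isNormed.Build R[i] bop
  bop_normD bop_normZ bop_norm0_eq0.

Lemma bop_normE A : `|A| = (opnorm A)%:C.
Proof. by []. Qed.

End BoundedOperators.

(* [is_inner_product ip]: the norm of [H] comes from the inner product [ip],
   linear in its first argument; for [H : completeNormedModType R[i]] this makes
   [H] a complex Hilbert space. *)
Definition is_inner_product {R : realType} {H : normedModType R[i]}
    (ip : {dot H for conjC}) : Prop :=
  forall x : H, `|x| ^+ 2 = ip x x.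

Section OperatorTheory.
Context {R : realType} {H : normedModType R[i]} (ip : {dot H for conjC}).

(* Adjoints and moduli are characterised by their defining relations, which
   determine them uniquely; on a Hilbert space both always exist. *)
Definition is_adjoint (A B : bop H) : Prop :=
  forall x y : H, ip (A x) y = ip x (B y).

Definition normal_operator (A : bop H) : Prop :=
  exists2 B : bop H, is_adjoint A B & A \o B = B \o A.

Definition positive_operator (A : bop H) : Prop := forall x : H, 0 <= ip (A x) x.

Definition is_modulus (A P : bop H) : Prop :=
  positive_operator P /\
  (exists2 B : bop H, is_adjoint A B & P \o P = B \o A).

Definition selfadjoint (A : H -> H) : Prop :=
  forall x y : H, ip (A x) y = ip x (A y).

(* On [R[i]], [<] only compares numbers with the same imaginary part; here both
   sides are real by self-adjointness. *)
Definition operator_lt (A B : H -> H) : Prop :=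
  [/\ selfadjoint A, selfadjoint B &
      forall x : H, x != 0 -> ip (A x) x < ip (B x) x].

Definition is_resolvent (A : bop H) (l : R[i]) (B : bop H) : Prop :=
  (forall x : H, B (l *: x - A x) = x) /\ (forall x : H, l *: B x - A (B x) = x).

Definition spectrum (A : bop H) : set R[i]^o :=
  [set l | ~ exists B : bop H, is_resolvent A l B].

(* Arbitrary when [l] is in the spectrum. *)
Definition resolvent (A : bop H) (l : R[i]) : bop H := get (is_resolvent A l).

End OperatorTheory.

Definition does_not_separate_0_oo {R : realType} (K : set R[i]^o) : Prop :=
  ~ K 0 /\ ~ bounded_set (connected_component (~` K) 0).

Section ContourIntegral.
Context {R : realType}.
Implicit Types (p : R -> R[i]) (c : seq (R -> R[i])) (g : R[i] -> R[i]).

(* The path is the restriction of [p] to [0, 1].  The derivative may vanish, so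
   closed piecewise C^1 paths (in particular polygons) are covered up to
   reparametrization. *)
Definition C1_loop p : Prop :=
  p 0 = p 1 /\
  (forall q : R -> R, q = @complex.Re R \o p \/ q = @complex.Im R \o p ->
    (forall t : R, derivable q t 1) /\ continuous (derive1 q)).

Definition path_derive p (t : R) : R[i] :=
  derive1 (@complex.Re R \o p) t +i* derive1 (@complex.Im R \o p) t.

Definition path_integral p g : R[i] :=
  let h t := g (p t) * path_derive p t in
  (\int[lebesgue_measure]_(t in `[0%R, 1%R]) complex.Re (h t)) +i*
  (\int[lebesgue_measure]_(t in `[0%R, 1%R]) complex.Im (h t)).

Definition cycle_integral c g : R[i] := \sum_(p <- c) path_integral p g.

Definition two_pi_i : R[i] := 0 +i* (2 * pi).

Definition winding_number c (w : R[i]) : R[i] :=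
  two_pi_i^-1 * cycle_integral c (fun z => (z - w)^-1).

(* [c] is a cycle in [D] minus [K] surrounding [K] once in [D]. *)
Definition surrounds c (K D : set R[i]) : Prop :=
  [/\ forall p, p \in c ->
        C1_loop p /\ forall t : R, 0 <= t <= 1 -> D (p t) /\ ~ K (p t),
      forall w, K w -> winding_number c w = 1 &
      forall w, ~ D w -> winding_number c w = 0].

End ContourIntegral.

(* [B] is [g(A)] in the holomorphic functional calculus, for [g] holomorphic on
   the open set [D] containing the spectrum of [A]:
     g(A) = (2 pi i)^-1 \int_c g(z) (z - A)^-1 dz
   for every cycle [c] in [D] surrounding the spectrum (such cycles exist since
   the spectrum is compact, and the integral does not depend on [c]).  The
   operator-valued integral is taken weakly, i.e. tested against [ip _ y]; the
   integrand being norm-continuous, this is also the norm-convergent integral. *)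
Definition is_holomorphic_calculus {R : realType} {H : normedModType R[i]}
    (ip : {dot H for conjC}) (D : set R[i]) (g : R[i] -> R[i]) (A B : bop H) :
    Prop :=
  spectrum A `<=` D /\
  forall c, surrounds c (spectrum A) D -> forall x y : H,
    ip (B x) y =
      two_pi_i^-1 * cycle_integral c (fun z => g z * ip (resolvent A z x) y).

Section PrincipalLogarithm.
Context {R : realType}.

Definition slit_plane : set R[i] :=
  ~` [set z | complex.Im z = 0 /\ complex.Re z <= 0].

(* Principal argument, with values in ]-pi, pi] for [z != 0]. *)
Definition principal_arg (z : R[i]) : R :=
  let a := acos (complex.Re z / cabs z) in
  if 0 <= complex.Im z then a else - a.

Definition principal_log (z : R[i]) : R[i] := ln (cabs z) +i* principal_arg z.

Definition is_log {H : normedModType R[i]} (ip : {dot H for conjC})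
    (A L : bop H) : Prop :=
  is_holomorphic_calculus ip slit_plane principal_log A L.

End PrincipalLogarithm.

Section SphericalDistance.
Context {R : realType}.

(* [None] is the point at infinity. *)
Definition spherical_distance (z w : one_point_compactification R[i]) : R :=
  match z, w with
  | Some a, Some b =>
      cabs (a - b) / (Num.sqrt (1 + cabs a ^+ 2) * Num.sqrt (1 + cabs b ^+ 2))
  | Some a, None | None, Some a => (Num.sqrt (1 + cabs a ^+ 2))^-1
  | None, None => 0
  end.

Definition sphere_of_ereal (x : \bar R) : one_point_compactification R[i] :=
  if x is s%:E then Some s%:C else None.

End SphericalDistance.

(* Main.v *)
Require Import Defs.
From HB Require Import structures.
From mathcomp Require Import all_boot all_order all_algebra.
From mathcomp Require Import cyclic separable cyclotomic.
From mathcomp Require Import complex sesquilinear.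
From mathcomp Require Import all_classical all_reals all_analysis.
From mathcomp Require Import ring lra zify.

Set Implicit Arguments.
Unset Strict Implicit.
Unset Printing Implicit Defensive.

Import Order.TTheory GRing.Theory Num.Theory Num.Def.
Import numFieldNormedType.Exports.

Local Open Scope classical_set_scope.
Local Open Scope complex_scope.
Local Open Scope ring_scope.

(** Suppose first that [f] is scalar.  As [|f| >= 1] on the disc, [f = exp g] with
    [Re g >= 0] and [g(0) = a], where [a = ln f(0)].  The Caratheodory inequality
    bounds every Taylor coefficient of [g] of positive order by [2 a], so the
    coefficients of [f] are at most those of [exp (a (1 + r) / (1 - r))].  At
    [r = 1 / 3] this majorant takes the value [exp (2 a) = f(0) ^ 2], and the
    spherical distance from [f(0) ^ 2] to [f(0)] is at most the one from [f(0)]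
    to [1] ([spherical_distance_square]).

    Normality reduces operators to scalars.  Comparing coefficients in
    [f(z)^* f(z) = f(z) f(z)^*] shows that each coefficient of [f] commutes with
    the adjoints of all the others ([coefficients_doubly_commute]).  The algebra
    that the coefficients generate then consists of normal operators, in which
    the norm is the spectral radius, and an argument in the spirit of Liouville's
    theorem makes it commutative ([commuting_adjoints_commute]).  Instead of
    characters of this algebra, the proof uses approximate joint eigenvectors:
    for given [n] there are unit vectors on which the first coefficients act
    almost as scalars [a_m], with [|a_n|] close to [|A_n|]
    ([joint_approx_eigvec]).

    As only finitely many coefficients matter at a time, the scalar function is a
    polynomial without zeros in the disc.  It is a finite product over its roots,
    so that its logarithm is an explicit power series and the Caratheodory
    inequality follows from averages over roots of unity
    ([zero_free_coefficients]).  This yields the recursive inequality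
    [coefficient_norm_recursion] between the norms [|A_n|], which [majorant_sum]
    solves: [sum |A_n| 3 ^ -n <= |A_0| ^ 2].

    It remains to see that the prescribed [r] is at most [1 / 3], that is
    [ln |A_0| <= |log A_0|] ([ln_opnorm_le_log]).  The spectrum of [A_0] lies in a
    disc centred at [|A_0|] whose radius is smaller than [|A_0|].  Integrating
    over a slightly larger circle and testing on an approximate eigenvector for
    [|A_0|] turns the functional calculus into the mean value of [ln |z|] over
    that circle, which is [ln |A_0|]. *)

(** * Real-valued norms *)

Section RealNorms.
Context {R : realType}.
Implicit Types (a b : R) (z w : R[i]).

Lemma realCD a b : (a + b)%:C = a%:C + b%:C :> R[i]. Proof. exact: rmorphD. Qed.
Lemma realCB a b : (a - b)%:C = a%:C - b%:C :> R[i]. Proof. exact: rmorphB. Qed.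
Lemma realCN a : (- a)%:C = - a%:C :> R[i]. Proof. exact: rmorphN. Qed.
Lemma realCM a b : (a * b)%:C = a%:C * b%:C :> R[i]. Proof. exact: rmorphM. Qed.
Lemma realCX a n : (a ^+ n)%:C = a%:C ^+ n :> R[i]. Proof. exact: rmorphXn. Qed.
Lemma realCV a : (a^-1)%:C = a%:C^-1 :> R[i]. Proof. exact: fmorphV. Qed.
Lemma cabsC z : (cabs z)%:C = `|z|.
Proof. by rewrite /cabs RRe_real. Qed.

Lemma cabs_ge0 z : 0 <= cabs z.
Proof. by rewrite -ler0c cabsC. Qed.

Lemma cabsM z w : cabs (z * w) = cabs z * cabs w.
Proof. by apply: complexI; rewrite realCM !cabsC normrM. Qed.

Lemma cabsD z w : cabs (z + w) <= cabs z + cabs w.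
Proof. by rewrite -lecR realCD !cabsC ler_normD. Qed.

Lemma cabsN z : cabs (- z) = cabs z.
Proof. by rewrite /cabs normrN. Qed.

Lemma cabs_distC z w : cabs (z - w) = cabs (w - z).
Proof. by rewrite -cabsN opprB. Qed.

Lemma cabs0 : cabs (0 : R[i]) = 0.
Proof. by rewrite /cabs normr0. Qed.

Lemma cabs1 : cabs (1 : R[i]) = 1.
Proof. by rewrite /cabs normr1. Qed.

Lemma cabs_eq0 z : (cabs z == 0) = (z == 0).
Proof. by rewrite -(inj_eq (@complexI R)) cabsC normr_eq0. Qed.

Lemma cabs_gt0 z : (0 < cabs z) = (z != 0).
Proof. by rewrite lt_def cabs_eq0 cabs_ge0 andbT. Qed.

Lemma cabsX z n : cabs (z ^+ n) = cabs z ^+ n.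
Proof. by elim: n => [|n IH]; rewrite ?expr0 ?cabs1// !exprS cabsM IH. Qed.

Lemma cabsV z : cabs z^-1 = (cabs z)^-1.
Proof.
have [->|z0] := eqVneq z 0; first by rewrite invr0 cabs0 invr0.
apply: (mulfI (x := cabs z)); first by rewrite cabs_eq0.
by rewrite -cabsM !mulfV ?cabs1// cabs_eq0.
Qed.

Lemma cabsR a : cabs a%:C = `|a|.
Proof. by apply: complexI; rewrite cabsC normc_def /= expr0n addr0 sqrtr_sqr. Qed.

Lemma cabs_nat n : cabs (n%:R : R[i]) = n%:R.
Proof. by rewrite -(rmorph_nat (real_complex R)) cabsR ger0_norm. Qed.

Lemma cabs_sqr z : cabs z ^+ 2 = complex.Re z ^+ 2 + complex.Im z ^+ 2.
Proof. by rewrite /cabs normc_def /= sqr_sqrtr// addr_ge0// sqr_ge0. Qed.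

Lemma ler_cabs_Re z : `|complex.Re z| <= cabs z.
Proof.
rewrite -ler_sqr ?nnegrE ?cabs_ge0// cabs_sqr real_normK ?num_real//.
by rewrite lerDl sqr_ge0.
Qed.

Lemma ler_cabs_Im z : `|complex.Im z| <= cabs z.
Proof.
rewrite -ler_sqr ?nnegrE ?cabs_ge0// cabs_sqr real_normK ?num_real//.
by rewrite lerDr sqr_ge0.
Qed.

Lemma cabs_sum I (s : seq I) (P : pred I) (F : I -> R[i]) :
  cabs (\sum_(i <- s | P i) F i) <= \sum_(i <- s | P i) cabs (F i).
Proof.
elim/big_rec2: _ => [|i y x _ h]; first by rewrite cabs0.
by rewrite (le_trans (cabsD _ _))// lerD2l.
Qed.

Lemma Re_add z w : complex.Re (z + w) = complex.Re z + complex.Re w.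
Proof. by case: z w => [? ?] [? ?]. Qed.

Lemma Im_add z w : complex.Im (z + w) = complex.Im z + complex.Im w.
Proof. by case: z w => [? ?] [? ?]. Qed.

Lemma Re_scale a z : complex.Re (a%:C * z) = a * complex.Re z.
Proof. by case: z => x y /=; rewrite mul0r subr0. Qed.

Lemma Re_sub (z w : R[i]) : complex.Re (z - w) = complex.Re z - complex.Re w.
Proof. by case: z w => [? ?] [? ?]. Qed.

Lemma Re_opp (z : R[i]) : complex.Re (- z) = - complex.Re z.
Proof. by case: z => [? ?]. Qed.

Lemma Re_mul (z w : R[i]) : complex.Re (z * w) =
  complex.Re z * complex.Re w - complex.Im z * complex.Im w.
Proof. by case: z w => ? ? [? ?]. Qed.

Lemma Im_mul (z w : R[i]) : complex.Im (z * w) =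
  complex.Re z * complex.Im w + complex.Im z * complex.Re w.
Proof. by case: z w => ? ? [? ?]. Qed.

Lemma Im_sub (z w : R[i]) : complex.Im (z - w) = complex.Im z - complex.Im w.
Proof. by case: z w => ? ? [? ?]. Qed.

Lemma Re_sum I (s : seq I) (P : pred I) (F : I -> R[i]) :
  complex.Re (\sum_(i <- s | P i) F i) = \sum_(i <- s | P i) complex.Re (F i).
Proof. by elim/big_rec2: _ => // i y x _ <-; rewrite Re_add. Qed.

Lemma Re_div (z w : R[i]) : complex.Re (z / w) =
  (complex.Re z * complex.Re w + complex.Im z * complex.Im w) / cabs w ^+ 2.
Proof.
rewrite cabs_sqr; case: z w => [a b] [c d] /=.
by rewrite mulrN opprK mulrDl !mulrA.
Qed.

Lemma natrC n : (n%:R : R)%:C = n%:R :> R[i].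
Proof. exact: rmorph_nat. Qed.

Lemma conjCR a : conjC (a%:C) = a%:C :> R[i].
Proof. exact: conjc_real. Qed.

Lemma conjC_i : conjC 'i%C = - 'i%C :> R[i].
Proof. by apply/eqP; rewrite eq_complex /= oppr0 !eqxx. Qed.

Lemma ler_cabs_dist (z w : R[i]) : `|cabs z - cabs w| <= cabs (z - w).
Proof.
rewrite ler_norml lerNl opprB !lerBlDr; apply/andP; split.
  by rewrite cabs_distC -{1}(subrK z w) cabsD.
by rewrite -{1}(subrK w z) cabsD.
Qed.

Lemma cabs_1sub_gt0 (z : R[i]) : cabs z < 1 -> 0 < 1 - cabs z <= cabs (1 - z).
Proof.
move=> z1; rewrite subr_gt0 z1/= lerBlDr -[leLHS]cabs1.
by rewrite -[X in cabs X](subrK z) cabsD.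
Qed.

Lemma geometric_tail (z : R[i]) K : z != 1 ->
  (1 - z)^-1 = \sum_(k < K) z ^+ k + z ^+ K / (1 - z).
Proof.
move=> z1; have z0 : 1 - z != 0 by rewrite subr_eq0 eq_sym.
apply: (mulfI z0); rewrite mulfV// mulrDr.
have -> : (1 - z) * \sum_(k < K) z ^+ k = 1 - z ^+ K.
  by rewrite -opprB mulNr -subrX1 opprB.
by rewrite mulrCA mulfV// mulr1 subrK.
Qed.

Lemma geometric_sum_le (t : R) n : 0 <= t < 1 -> \sum_(k < n) t ^+ k <= (1 - t)^-1.
Proof.
move=> /andP[t0 t1]; rewrite -[leRHS]mul1r ler_pdivlMr ?subr_gt0// mulrC.
by rewrite -opprB mulNr -subrX1 opprB gerBl exprn_ge0.
Qed.

Context {V : normedModType R[i]}.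
Implicit Types x y : V.

Definition rnorm x : R := complex.Re `|x|.

Lemma rnormC x : (rnorm x)%:C = `|x|.
Proof. by rewrite /rnorm RRe_real. Qed.

Lemma rnorm_ge0 x : 0 <= rnorm x.
Proof. by rewrite -ler0c rnormC. Qed.

Lemma rnormD x y : rnorm (x + y) <= rnorm x + rnorm y.
Proof. by rewrite -lecR realCD !rnormC ler_normD. Qed.

Lemma rnormN x : rnorm (- x) = rnorm x.
Proof. by rewrite /rnorm normrN. Qed.

Lemma rnorm_distC x y : rnorm (x - y) = rnorm (y - x).
Proof. by rewrite -rnormN opprB. Qed.

Lemma rnormB x y : rnorm x - rnorm y <= rnorm (x - y).
Proof. by rewrite lerBlDr (le_trans _ (rnormD _ _))// subrK. Qed.

Lemma rnorm0 : rnorm (0 : V) = 0.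
Proof. by rewrite /rnorm normr0. Qed.

Lemma rnormZ z x : rnorm (z *: x) = cabs z * rnorm x.
Proof. by apply: complexI; rewrite realCM !rnormC cabsC normrZ. Qed.

Lemma rnorm_eq0 x : (rnorm x == 0) = (x == 0).
Proof. by rewrite -(inj_eq (@complexI R)) rnormC normr_eq0. Qed.

Lemma rnorm_gt0 x : (0 < rnorm x) = (x != 0).
Proof. by rewrite lt_def rnorm_eq0 rnorm_ge0 andbT. Qed.

Lemma rnorm_sum I (s : seq I) (P : pred I) (F : I -> V) :
  rnorm (\sum_(i <- s | P i) F i) <= \sum_(i <- s | P i) rnorm (F i).
Proof.
elim/big_rec2: _ => [|i y x _ h]; first by rewrite rnorm0.
by rewrite (le_trans (rnormD _ _))// lerD2l.
Qed.

End RealNorms.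

(** * The algebra of bounded operators *)

Section OperatorAlgebra.
Context {R : realType} {H : normedModType R[i]}.
Implicit Types (A B C T : bop H) (x y : H).

Lemma bop_ext A B : (forall x, A x = B x) -> A = B.
Proof. by move=> AB; apply/val_inj/funext. Qed.

Lemma bopD A x y : A (x + y) = A x + A y.
Proof. by have := bop_linear A 1 x y; rewrite !scale1r. Qed.

Lemma bopZ A c x : A (c *: x) = c *: A x.
Proof. by have := bop_linear A c x 0; rewrite bop0 !addr0. Qed.

Lemma bopN A x : A (- x) = - A x.
Proof. by rewrite -scaleN1r bopZ scaleN1r. Qed.

Lemma bopB A x y : A (x - y) = A x - A y.
Proof. by rewrite bopD bopN. Qed.

Lemma bop_addE A B x : (A + B) x = A x + B x. Proof. by []. Qed.
Lemma bop_oppE A x : (- A) x = - A x. Proof. by []. Qed.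
Lemma bop_scaleE c A x : (c *: A) x = c *: A x. Proof. by []. Qed.
Lemma bop_zeroE x : (0 : bop H) x = 0. Proof. by []. Qed.

Lemma bop_sumE I (s : seq I) (P : pred I) (F : I -> bop H) x :
  (\sum_(i <- s | P i) F i) x = \sum_(i <- s | P i) F i x.
Proof. by elim/big_rec2: _ => // i u v _ <-. Qed.

Lemma rnorm_bop A x : rnorm (A x) <= opnorm A * rnorm x.
Proof. by rewrite -lecR realCM !rnormC opnorm_le. Qed.

Lemma opnorm_least_real A (M : R) : 0 <= M ->
  (forall x, rnorm (A x) <= M * rnorm x) -> opnorm A <= M.
Proof.
move=> M0 h; apply: opnorm_least => // x.
by rewrite -!rnormC -rmorphM lecR.
Qed.

Lemma mkbop_subproof (f : H -> H) (M : R) :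
  linear f -> (forall x, rnorm (f x) <= M * rnorm x) -> f \in @bounded_operator R H.
Proof.
move=> lf fM; apply/asboolP; split => //; exists M => x.
by rewrite -!rnormC -rmorphM lecR.
Qed.

Definition mkbop f M lf fM : bop H := Bop (@mkbop_subproof f M lf fM).

Lemma idbop_linear : linear (@idfun H). Proof. by []. Qed.
Lemma idbop_bound (x : H) : rnorm (idfun x) <= 1 * rnorm x.
Proof. by rewrite mul1r. Qed.
Definition idbop : bop H := mkbop idbop_linear idbop_bound.

Lemma compbop_linear A B : linear (A \o B).
Proof. by move=> a u v; rewrite /= !bop_linear. Qed.
Lemma compbop_bound A B x : rnorm ((A \o B) x) <= opnorm A * opnorm B * rnorm x.
Proof.
by rewrite (le_trans (rnorm_bop _ _))// -mulrA ler_wpM2l ?opnorm_ge0 ?rnorm_bop.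
Qed.
Definition compbop A B : bop H := mkbop (compbop_linear A B) (compbop_bound A B).

Fact compbopA : associative compbop. Proof. by move=> A B C; apply: bop_ext. Qed.
Fact comp1bop : left_id idbop compbop. Proof. by move=> A; apply: bop_ext. Qed.
Fact compbop1 : right_id idbop compbop. Proof. by move=> A; apply: bop_ext. Qed.
Fact compbopDl : left_distributive compbop +%R.
Proof. by move=> A B C; apply: bop_ext. Qed.
Fact compbopDr : right_distributive compbop +%R.
Proof. by move=> A B C; apply: bop_ext => x; exact: bopD. Qed.

HB.instance Definition _ := GRing.Zmodule_isPzRing.Build (bop H)
  compbopA comp1bop compbop1 compbopDl compbopDr.

Lemma scalebopAl c A B : c *: (A * B) = (c *: A) * B.
Proof. exact: bop_ext. Qed.
Lemma scalebopAr c A B : c *: (A * B) = A * (c *: B).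
Proof. by apply: bop_ext => x; rewrite bop_scaleE -[RHS]/(A (c *: B x)) bopZ. Qed.

Lemma bop_mulE A B x : (A * B) x = A (B x). Proof. by []. Qed.
Lemma bop_oneE x : (1 : bop H) x = x. Proof. by []. Qed.

Lemma opnormM A B : opnorm (A * B) <= opnorm A * opnorm B.
Proof.
by apply: opnorm_least_real => [|x]; [rewrite mulr_ge0 ?opnorm_ge0|exact: compbop_bound].
Qed.

Lemma opnormE A : opnorm A = rnorm A. Proof. by []. Qed.

Lemma opnormD A B : opnorm (A + B) <= opnorm A + opnorm B.
Proof. by rewrite !opnormE rnormD. Qed.

Lemma opnormN A : opnorm (- A) = opnorm A.
Proof. by rewrite !opnormE rnormN. Qed.

Lemma opnormZ c A : opnorm (c *: A) = cabs c * opnorm A.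
Proof. by rewrite !opnormE rnormZ. Qed.

Lemma opnorm0 : opnorm (0 : bop H) = 0.
Proof. by rewrite !opnormE rnorm0. Qed.

Lemma opnorm_eq0 A : (opnorm A == 0) = (A == 0).
Proof. by rewrite !opnormE rnorm_eq0. Qed.

Lemma opnorm1_le : opnorm (1 : bop H) <= 1.
Proof. by apply: opnorm_least_real => // x; rewrite mul1r. Qed.

Lemma opnormX_le A n : opnorm (A ^+ n) <= opnorm A ^+ n.
Proof.
elim: n => [|n IH]; first exact: opnorm1_le.
by rewrite !exprS (le_trans (opnormM _ _))// ler_wpM2l ?opnorm_ge0.
Qed.

End OperatorAlgebra.

(** * Inner products and adjoints *)

Section InnerProduct.
Context {R : realType} {H : normedModType R[i]} (ip : {dot H for conjC}).
Hypothesis hip : is_inner_product ip.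
Implicit Types (A B C T : bop H) (x y z : H) (a b : R[i]).

Lemma ipDl x y z : ip (x + y) z = ip x z + ip y z.
Proof. by rewrite linearDl. Qed.

Lemma ipBl x y z : ip (x - y) z = ip x z - ip y z.
Proof. by rewrite linearBl. Qed.

Lemma ipZl a x y : ip (a *: x) y = a * ip x y.
Proof. by rewrite linearZl_LR. Qed.

Lemma ipC x y : ip x y = (ip y x)^*%R.
Proof. by rewrite hermC expr0 mul1r. Qed.

Lemma ipDr x y z : ip z (x + y) = ip z x + ip z y.
Proof. by rewrite linearDr. Qed.

Lemma ipBr x y z : ip z (x - y) = ip z x - ip z y.
Proof. by rewrite linearBr. Qed.

Lemma ipZr a x y : ip x (a *: y) = a^*%R * ip x y.
Proof. by rewrite linearZr_LR. Qed.

Lemma ip0l y : ip 0 y = 0. Proof. by rewrite linear0l. Qed.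
Lemma ip0r y : ip y 0 = 0. Proof. by rewrite linear0r. Qed.

Lemma ip_self x : ip x x = (rnorm x ^+ 2)%:C.
Proof. by rewrite -hip realCX rnormC. Qed.

(** Expand the squared norm of [<y,y> x - <x,y> y]. *)
Lemma cauchy_schwarz x y : cabs (ip x y) <= rnorm x * rnorm y.
Proof.
have [->|y0] := eqVneq y 0; first by rewrite ip0r cabs0 rnorm0 mulr0.
rewrite -ler_sqr ?nnegrE ?cabs_ge0 ?mulr_ge0 ?rnorm_ge0//.
rewrite -lecR exprMn [leRHS]realCM -!(ip_self) realCX cabsC normCK.
have y2 : 0 < ip y y by rewrite ip_self ltcR exprn_gt0 ?rnorm_gt0.
have : 0 <= ip (ip y y *: x - ip x y *: y) (ip y y *: x - ip x y *: y).
  by rewrite ip_self lecR exprn_ge0 ?rnorm_ge0.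
rewrite !ipBl !ipBr !ipZl !ipZr -(ipC y y) -(ipC y x) [ip y x]ipC.
rewrite [X in 0 <= X](_ : _ = ip y y * (ip x x * ip y y - ip x y * (ip x y)^*%R)).
  by rewrite pmulr_rge0// subr_ge0.
ring.
Qed.

Lemma adjoint_sym A B : is_adjoint ip A B -> is_adjoint ip B A.
Proof. by move=> h x y; rewrite ipC -h -ipC. Qed.

Lemma adjointD A A' B B' : is_adjoint ip A A' -> is_adjoint ip B B' ->
  is_adjoint ip (A + B) (A' + B').
Proof. by move=> hA hB x y; rewrite !bop_addE ipDl ipDr hA hB. Qed.

Lemma adjointZ a A A' : is_adjoint ip A A' -> is_adjoint ip (a *: A) (a^*%R *: A').
Proof. by move=> hA x y; rewrite !bop_scaleE ipZl ipZr conjCK hA. Qed.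

Lemma adjointB A A' B B' : is_adjoint ip A A' -> is_adjoint ip B B' ->
  is_adjoint ip (A - B) (A' - B').
Proof. by move=> hA hB x y; rewrite !bop_addE !bop_oppE ipBl ipBr hA hB. Qed.

Lemma adjointM A A' B B' : is_adjoint ip A A' -> is_adjoint ip B B' ->
  is_adjoint ip (A * B) (B' * A').
Proof. by move=> hA hB x y; rewrite !bop_mulE hA hB. Qed.

Lemma adjoint1 : is_adjoint ip 1 1. Proof. by []. Qed.

Lemma adjoint0 : is_adjoint ip 0 0.
Proof. by move=> x y; rewrite !bop_zeroE ip0l ip0r. Qed.

Lemma adjoint_sum I (s : seq I) (P : pred I) (F G : I -> bop H) :
  (forall i, P i -> is_adjoint ip (F i) (G i)) ->
  is_adjoint ip (\sum_(i <- s | P i) F i) (\sum_(i <- s | P i) G i).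
Proof.
move=> FG; elim/big_rec2: _ => [|i u v Pi h]; first exact: adjoint0.
by apply: adjointD => //; exact: FG.
Qed.

Lemma ip_inj x y : (forall z, ip x z = ip y z) -> x = y.
Proof.
move=> h; apply/eqP; rewrite -subr_eq0 -rnorm_eq0 -sqrf_eq0.
by rewrite -(inj_eq (@complexI R)) -ip_self ipBl h subrr.
Qed.

Lemma adjoint_uniq A B C : is_adjoint ip A B -> is_adjoint ip A C -> B = C.
Proof.
move=> /adjoint_sym hB /adjoint_sym hC; apply: bop_ext => x.
by apply: ip_inj => z; rewrite hB hC.
Qed.

Lemma opnorm_adjoint_le A B : is_adjoint ip A B -> opnorm B <= opnorm A.
Proof.
move=> h; apply: opnorm_least_real; first exact: opnorm_ge0.
move=> x; have [->|Bx] := eqVneq (B x) 0; first by rewrite rnorm0 mulr_ge0 ?opnorm_ge0 ?rnorm_ge0.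
have Bx0 : 0 < rnorm (B x) by rewrite rnorm_gt0.
rewrite -(ler_pM2l Bx0) -expr2 -[_ ^+ 2]ger0_norm ?exprn_ge0 ?rnorm_ge0//.
rewrite -cabsR -ip_self -h (le_trans (cauchy_schwarz _ _))//.
by rewrite mulrA ler_wpM2r ?rnorm_ge0// mulrC rnorm_bop.
Qed.

Lemma opnorm_adjoint A B : is_adjoint ip A B -> opnorm A = opnorm B.
Proof.
move=> h; apply: le_anti; rewrite (opnorm_adjoint_le h) andbT.
exact: opnorm_adjoint_le (adjoint_sym h).
Qed.

Lemma rnorm2_adjoint A B x : is_adjoint ip A B ->
  (rnorm (A x) ^+ 2)%:C = ip (B (A x)) x.
Proof. by move=> h; rewrite (adjoint_sym h) ip_self. Qed.

Lemma opnorm_cstar A B : is_adjoint ip A B -> opnorm (B * A) = opnorm A ^+ 2.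
Proof.
move=> h; apply: le_anti; apply/andP; split.
  by rewrite (le_trans (opnormM _ _))// -(opnorm_adjoint h) expr2.
rewrite -[leRHS]sqr_sqrtr ?opnorm_ge0// ler_sqr ?nnegrE ?sqrtr_ge0 ?opnorm_ge0//.
apply: opnorm_least_real => [|x]; first exact: sqrtr_ge0.
rewrite -ler_sqr ?nnegrE ?mulr_ge0 ?rnorm_ge0 ?sqrtr_ge0//.
rewrite exprMn sqr_sqrtr ?opnorm_ge0// -[_ ^+ 2]ger0_norm ?exprn_ge0 ?rnorm_ge0//.
rewrite -cabsR (rnorm2_adjoint x h) (le_trans (cauchy_schwarz _ _))//.
by rewrite expr2 mulrA ler_wpM2r ?rnorm_ge0// (rnorm_bop (B * A)).
Qed.

(** The C*-identity, applied to [A], to [A^* A] and to [A ^ 2]. *)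
Lemma opnorm_normal2 A B : is_adjoint ip A B -> A * B = B * A ->
  opnorm (A ^+ 2) = opnorm A ^+ 2.
Proof.
move=> h AB; have hX : is_adjoint ip (A ^+ 2) (B ^+ 2) by rewrite !expr2; exact: adjointM.
apply/eqP; rewrite -(eqrXn2 (n := 2))// ?exprn_ge0 ?opnorm_ge0//; apply/eqP.
rewrite -(opnorm_cstar hX) -(opnorm_cstar h).
have hBA : is_adjoint ip (B * A) (B * A) by apply: adjointM => //; exact: adjoint_sym.
rewrite -(opnorm_cstar hBA); congr opnorm.
by rewrite !expr2 !mulrA -[B * B * A]mulrA -[in LHS]AB mulrA.
Qed.

End InnerProduct.

(** * Averages over roots of unity *)

Section RootsOfUnity.
Context {R : realType}.

Lemma primitive_root_exists n : (0 < n)%N ->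
  exists w : R[i], n.-primitive_root w.
Proof.
move=> n0; have [s] := closed_field_poly_normal ('X^n - 1 : {poly R[i]}).
rewrite (monicP _) ?monicXnsubC// scale1r => sE.
have s_uniq : uniq s.
  by rewrite -separable_prod_XsubC -sE separable_Xn_sub_1// pnatr_eq0 -lt0n.
have s_unity : all n.-unity_root s.
  by apply/allP => z; rewrite -root_prod_XsubC -sE.
have s_size : (n <= size s)%N.
  by rewrite -ltnS -(size_prod_XsubC s id) -sE size_XnsubC.
by have /hasP[w _ pw] := has_prim_root n0 s_unity s_uniq s_size; exists w.
Qed.

Lemma cabs_root_of_unity n (w : R[i]) : (0 < n)%N -> w ^+ n = 1 -> cabs w = 1.
Proof.
move=> n0 wn; apply/eqP; rewrite -(@pexpr_eq1 _ _ n) ?cabs_ge0//.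
by rewrite -cabsX wn cabs1.
Qed.

Lemma sum_roots_of_unity n (w : R[i]) m : n.-primitive_root w ->
  \sum_(j < n) (w ^+ j) ^+ m = if (n %| m)%N then n%:R else 0.
Proof.
move=> pw; have wn := prim_expr_order pw.
under eq_bigr do rewrite exprAC.
rewrite (prim_order_dvd pw); case: eqVneq => [->|wm1].
  by under eq_bigr do rewrite expr1n; rewrite sumr_const card_ord.
apply: (mulfI (x := w ^+ m - 1)); first by rewrite subr_eq0.
by rewrite mulr0 -subrX1 exprAC wn expr1n subrr.
Qed.

(** Averaging over roots of unity extracts the coefficient of [z ^+ k]. *)
Lemma cauchy_estimate (V : normedModType R[i]) n (C : nat -> V) (r K : R) k :
  0 < r -> (k < n)%N ->
  (forall z : R[i], cabs z = r -> rnorm (\sum_(i < n) z ^+ i *: C i) <= K) ->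
  rnorm (C k) * r ^+ k <= K.
Proof.
move=> r0 kn hK; have n0 : (0 < n)%N by exact: leq_ltn_trans kn.
have [w pw] := primitive_root_exists n0; have wn := prim_expr_order pw.
have w1 : cabs w = 1 by exact: cabs_root_of_unity wn.
have E : (n%:R * r%:C ^+ k) *: C k = \sum_(j < n)
    (w ^+ j) ^+ (n - k) *: \sum_(i < n) (r%:C * w ^+ j) ^+ i *: C i.
  under eq_bigr do rewrite scaler_sumr.
  rewrite exchange_big /=.
  transitivity (\sum_(i < n) (r%:C ^+ i * \sum_(j < n) (w ^+ j) ^+ (n - k + i)) *: C i).
    rewrite (bigD1 (Ordinal kn))//= [X in _ + X]big1 ?addr0 => [|i ik].
      by rewrite sum_roots_of_unity// subnK ?(ltnW kn)// dvdnn mulrC.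
    rewrite sum_roots_of_unity// ifN ?mulr0 ?scale0r//.
    apply: contra ik => /dvdnP[q qE]; rewrite -val_eqE /=.
    have [qn|qn|q1] := ltngtP q 1.
    - move: qn qE; rewrite ltnS leqn0 => /eqP ->; rewrite mul0n => /eqP.
      by rewrite addn_eq0 subn_eq0 leqNgt kn.
    - suff : (n - k + i < n * 2)%N by rewrite qE mulnC ltn_pmul2l// ltnNge qn.
      by rewrite muln2 -addnn -ltn_subRL (leq_trans (ltn_ord i))// -addnBA ?leq_addr// leq_subr.
    - move: qE; rewrite q1 mul1n => qE.
      by rewrite -(eqn_add2l (n - k)) qE subnK// ltnW.
  apply: eq_bigr => i _; rewrite mulr_sumr scaler_suml; apply: eq_bigr => j _.
  by rewrite scalerA exprMn exprD; congr (_ *: _); ring.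
have : rnorm ((n%:R * r%:C ^+ k) *: C k) <= n%:R * K.
  rewrite E (le_trans (rnorm_sum _ _ _))// mulr_natl -[in leRHS](card_ord n) -sumr_const.
  apply: ler_sum => j _; rewrite rnormZ !cabsX w1 !expr1n mul1r; apply: hK.
  by rewrite cabsM cabsX w1 expr1n mulr1 cabsR gtr0_norm.
rewrite rnormZ cabsM cabs_nat cabsX cabsR gtr0_norm// -mulrA ler_pM2l ?ltr0n//.
by rewrite mulrC.
Qed.

(** The Caratheodory inequality: [c_k] is twice the mean of [Re P(z) * z^-k]. *)
Lemma caratheodory_poly n (c : nat -> R[i]) k : (0 < k <= n)%N ->
  (forall z : R[i], cabs z = 1 -> 0 <= complex.Re (\sum_(i < n.+1) c i * z ^+ i)) ->
  cabs (c k) <= 2 * complex.Re (c 0%N).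
Proof.
move=> /andP[k0 kn] hP; pose Q := n.*2.+1; have Q0 : (0 < Q)%N by [].
have [w pw] := primitive_root_exists Q0; have wQ := prim_expr_order pw.
have w1 : cabs w = 1 by exact: cabs_root_of_unity wQ.
pose u j := \sum_(i < n.+1) c i * (w ^+ j) ^+ i.
have nQ i : (i < n.+1)%N -> (i <= Q)%N by rewrite ltnS /Q => h; lia.
have M1 : \sum_(j < Q) u j = Q%:R * c 0%N.
  rewrite exchange_big /= big_ord_recl /= [X in _ + X]big1 ?addr0 => [|i _].
    by rewrite -mulr_sumr sum_roots_of_unity// dvdn0 mulrC.
  rewrite -mulr_sumr sum_roots_of_unity// ifN ?mulr0// /bump /= add1n.
  by apply/negP => /dvdn_leq; rewrite /Q; have := ltn_ord i; lia.
have M2 : \sum_(j < Q) u j * (w ^+ j) ^+ (Q - k) = Q%:R * c k.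
  under eq_bigr do rewrite mulr_suml.
  rewrite exchange_big /= (bigD1 (Ordinal (kn : (k < n.+1)%N)))//= [X in _ + X]big1 ?addr0 => [|i ik].
    under eq_bigr do rewrite -mulrA -exprD subnKC ?nQ//.
    by rewrite -mulr_sumr sum_roots_of_unity// dvdnn mulrC.
  under eq_bigr do rewrite -mulrA -exprD.
  rewrite -mulr_sumr sum_roots_of_unity// ifN ?mulr0//.
  apply: contra ik => /dvdnP[q qE]; rewrite -val_eqE /=.
  have := ltn_ord i; move: qE; rewrite /Q => qE hi.
  have : q = 1%N by nia.
  by move=> q1; move: qE; rewrite q1; lia.
have M3 : \sum_(j < Q) (u j)^*%R * (w ^+ j) ^+ (Q - k) = 0.
  have wc j : ((w ^+ j)^*)%R = (w ^+ j) ^+ Q.-1.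
    have wj : w ^+ j != 0 by rewrite expf_neq0// -cabs_eq0 w1 oner_eq0.
    apply: (mulfI wj); rewrite -exprS prednK// exprAC wQ expr1n -normCK -cabsC.
    by rewrite cabsX w1 !expr1n.
  under eq_bigr do rewrite rmorph_sum mulr_suml.
  rewrite exchange_big /= big1// => i _.
  under eq_bigr do rewrite rmorphM rmorphXn /= wc -mulrA -[_ ^+ _ ^+ i]exprM -exprD.
  rewrite -mulr_sumr sum_roots_of_unity// ifN ?mulr0//.
  apply/negP => /dvdnP[q]; have := ltn_ord i; rewrite /Q /= => hi qE.
  have h : (((q + 1) * n.*2.+1 = i * n.*2.+1 + n.*2.+1 + n.*2.+1 - (i + k)))%N by nia.
  have : (i + k = ((i + 1) - q) * n.*2.+1)%N by nia.
  by move=> E; have [e|e] := posnP ((i + 1) - q)%N; nia.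
have uR j : u j + (u j)^*%R = (2 * complex.Re (u j))%:C.
  by rewrite realCM (rmorph_nat (real_complex R)) -addcJ.
have uj0 (j : 'I_Q) : 0 <= complex.Re (u j).
  by apply: hP; rewrite cabsX w1 expr1n.
have E : Q%:R * c k = \sum_(j < Q) (2 * complex.Re (u j))%:C * (w ^+ j) ^+ (Q - k).
  rewrite -[LHS]addr0 -[X in _ + X = _]M3 -M2 -big_split /=.
  apply: eq_bigr => j _.
  by rewrite -mulrDl uR.
have Qp : 0 < Q%:R :> R by rewrite ltr0n.
rewrite -(ler_pM2l Qp) -{1}cabs_nat -cabsM E (le_trans (cabs_sum _ _ _))//.
rewrite [leRHS](_ : _ = \sum_(j < Q) 2 * complex.Re (u j)).
  apply: ler_sum => j _; rewrite cabsM !cabsX w1 !expr1n mulr1 cabsR ger0_norm//.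
  by rewrite mulr_ge0.
rewrite -mulr_sumr -Re_sum M1 mulrCA; congr (_ * _).
by rewrite -[in RHS](rmorph_nat (real_complex R)) Re_scale.
Qed.

End RootsOfUnity.

(** * Commutation of operators with commuting adjoints *)

(** If [s < t], dividing by [t ^ (2 ^ j - 1)] gives [t <= K (s / t) ^ (2 ^ j - 1)]
    with right-hand sides tending to [0]. *)
Lemma le_of_geometric {R : realType} (s t K : R) : 0 <= s -> 0 <= t -> 0 <= K ->
  (forall j, t ^+ (2 ^ j) <= K * s ^+ (2 ^ j).-1) -> t <= s.
Proof.
move=> s0 t0 K0 h; rewrite leNgt; apply/negP => st.
have t0' : 0 < t by exact: le_lt_trans st.
pose x := s / t; have x0 : 0 <= x by rewrite divr_ge0.
have x1 : x < 1 by rewrite ltr_pdivrMr// mul1r.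
have tK j : t <= K * x ^+ j.
  have tp : 0 < t ^+ (2 ^ j).-1 by rewrite exprn_gt0.
  rewrite -(ler_pM2r tp) -exprS prednK ?expn_gt0// (le_trans (h j))//.
  rewrite -mulrA ler_wpM2l// (@le_trans _ _ (x ^+ (2 ^ j).-1 * t ^+ (2 ^ j).-1))//.
    by rewrite -exprMn /x divfK ?gt_eqF.
  rewrite ler_wpM2r ?(ltW tp)// ler_wiXn2l ?(ltW x1)//.
  by rewrite -ltnS prednK ?expn_gt0// ltn_expl.
have : (fun j => K * x ^+ j) @ \oo --> K * 0.
  by apply: cvgMr; apply: cvg_expr; rewrite ger0_norm.
rewrite mulr0 => /cvgr_lt /(_ t t0') [N _ /(_ N)] /=.
by rewrite leqnn => /(_ isT); rewrite ltNge tK.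
Qed.

Section Commutation.
Context {R : realType} {H : normedModType R[i]} (ip : {dot H for conjC}).
Hypothesis hip : is_inner_product ip.
Variables (A A' B B' : bop H).
Hypotheses (hA : is_adjoint ip A A') (hB : is_adjoint ip B B').
Hypotheses (AA' : GRing.comm A A') (AB' : GRing.comm A B')
  (BA' : GRing.comm B A') (BB' : GRing.comm B B').

(** The two conditions make every member commute with its adjoint; the second one
    is a bicommutant condition, so that the class is closed under products before
    [A] and [B] are known to commute. *)
Definition normal_class (T : bop H) : Prop :=
  (exists T', [/\ is_adjoint ip T T', GRing.comm A T' & GRing.comm B T']) /\
  (forall X, GRing.comm A X -> GRing.comm B X -> GRing.comm T X).

Lemma normal_classM S T : normal_class S -> normal_class T -> normal_class (S * T).
Proof.
move=> [[S' [hS AS BS]] cS] [[T' [hT AT BT]] cT]; split.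
  exists (T' * S'); split; [exact: adjointM| exact: commrM|exact: commrM].
move=> X AX BX; apply: commr_sym; apply: commrM; apply: commr_sym.
- exact: cS.
- exact: cT.
Qed.

Lemma normal_class1 : normal_class 1.
Proof. by split; [exists 1; split => //; exact: commr1|move=> X _ _; apply: commr_sym; exact: commr1]. Qed.

Lemma normal_class_affine c T : normal_class T -> normal_class (1 + c *: T).
Proof.
move=> [[T' [hT AT BT]] cT].
have comm_affine (X Y : bop H) b : GRing.comm X Y -> GRing.comm X (1 + b *: Y).
  move=> XY; apply: commrD; first exact: commr1.
  by rewrite /GRing.comm -scalebopAr XY scalebopAl.
split.
  exists (1 + c^*%R *: T'); split; [|exact: comm_affine|exact: comm_affine].
  by apply: adjointD; [exact: adjoint1|exact: adjointZ].
by move=> X AX BX; apply: commr_sym; apply: comm_affine; apply: commr_sym; exact: cT.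
Qed.

Lemma normal_classX T n : normal_class T -> normal_class (T ^+ n).
Proof.
move=> hT; elim: n => [|n IH]; first exact: normal_class1.
by rewrite exprS; exact: normal_classM.
Qed.

Lemma normal_classA : normal_class A.
Proof. by split => //; exists A'; split => //; exact: commr_sym. Qed.

Lemma normal_classB : normal_class B.
Proof. by split => //; exists B'; split => //; exact: commr_sym. Qed.

Lemma opnorm_pow2 T j : normal_class T -> opnorm (T ^+ (2 ^ j)) = opnorm T ^+ (2 ^ j).
Proof.
move=> nT; elim: j => [|j IH]; first by rewrite !expr1.
rewrite expnS mulnC !exprM -IH.
have [[T' [hT' AT BT]] cT] := normal_classX (2 ^ j) nT.
by apply: opnorm_normal2 => //; exact: cT.
Qed.

(** Both sides are spectral radii, hence equal: compare the norms of
    [(X Y) ^ m = X (Y X) ^ (m - 1) Y]. *)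
Lemma opnorm_mulC X Y : normal_class X -> normal_class Y ->
  opnorm (X * Y) <= opnorm (Y * X).
Proof.
move=> nX nY; apply: (@le_of_geometric _ _ _ (opnorm X * opnorm Y)); rewrite ?mulr_ge0 ?opnorm_ge0//.
move=> j; rewrite -opnorm_pow2; last exact: normal_classM.
have E m : (X * Y) ^+ m.+1 = X * (Y * X) ^+ m * Y.
  elim: m => [|m IH]; first by rewrite expr1 mulr1.
  by rewrite exprS IH exprS !mulrA.
rewrite -[in leLHS](prednK (n := 2 ^ j)) ?expn_gt0// E.
rewrite (le_trans (opnormM _ _))// [leRHS]mulrAC ler_wpM2r ?opnorm_ge0//.
by rewrite (le_trans (opnormM _ _))// ler_wpM2l ?opnorm_ge0// opnormX_le.
Qed.

(** Only the two lowest coefficients [c0] and [c1] matter below: the second one will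
    be the commutator of [A] and [B]. *)
Definition operator_polynomial (F : R[i] -> bop H) (c0 c1 : bop H) : Prop :=
  exists n (C : nat -> bop H), [/\ (1 < n)%N, forall z, F z = \sum_(i < n) z ^+ i *: C i,
    C 0%N = c0 & C 1%N = c1].

Lemma operator_polynomial_cst T : operator_polynomial (fun=> T) T 0.
Proof.
exists 2%N, (fun i => if i is 0%N then T else 0); split => // z.
by rewrite big_ord_recl big_ord1/= expr0 scale1r scaler0 addr0.
Qed.

Lemma operator_polynomialMl F c0 c1 (X : bop H) : operator_polynomial F c0 c1 ->
  operator_polynomial (fun z => (1 + z *: X) * F z) c0 (c1 + X * c0).
Proof.
move=> [n [C [n1 FE <- <-]]].
pose C1 i := if (i < n)%N then C i else 0.
exists n.+1, (fun i => C1 i + if i is i'.+1 then X * C i' else 0).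
split; rewrite /C1 ?(ltnW n1) ?n1 ?addr0//; first by rewrite ltnS ltnW.
move=> z; under eq_bigr do rewrite scalerDr.
rewrite big_split/= mulrDl mul1r FE; congr (_ + _).
  by rewrite big_ord_recr/= ltnn scaler0 addr0; apply: eq_bigr => i _; rewrite ltn_ord.
rewrite big_ord_recl scaler0 add0r mulr_sumr; apply: eq_bigr => i _.
by rewrite -scalebopAl -scalebopAr scalerA -exprS.
Qed.

Lemma operator_polynomialMr F c0 c1 (X : bop H) : operator_polynomial F c0 c1 ->
  operator_polynomial (fun z => F z * (1 + z *: X)) c0 (c1 + c0 * X).
Proof.
move=> [n [C [n1 FE <- <-]]].
pose C1 i := if (i < n)%N then C i else 0.
exists n.+1, (fun i => C1 i + if i is i'.+1 then C i' * X else 0).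
split; rewrite /C1 ?(ltnW n1) ?n1 ?addr0//; first by rewrite ltnS ltnW.
move=> z; under eq_bigr do rewrite scalerDr.
rewrite big_split/= mulrDr mulr1 FE; congr (_ + _).
  by rewrite big_ord_recr/= ltnn scaler0 addr0; apply: eq_bigr => i _; rewrite ltn_ord.
rewrite big_ord_recl scaler0 add0r mulr_suml; apply: eq_bigr => i _.
by rewrite -scalebopAr -!scalebopAl scalerA -exprS.
Qed.

Lemma operator_polynomial_conj (X Y : bop H) n :
  operator_polynomial (fun z => (1 + z *: X) ^+ n * B * (1 + z *: Y) ^+ n)
    B (n%:R *: (X * B + B * Y)).
Proof.
elim: n => [|n IH].
  rewrite scale0r; have := operator_polynomial_cst B; congr operator_polynomial.
  by apply/funext => z; rewrite !expr0 mul1r mulr1.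
have := operator_polynomialMr Y (operator_polynomialMl X IH).
rewrite -addrA -{2}[X * B + B * Y]scale1r -scalerDl -natr1 => h.
move: h; congr operator_polynomial; apply/funext => z.
by rewrite exprS exprSr !mulrA.
Qed.

(** A discrete form of the proof of Fuglede's theorem by Liouville's.  For [N] large,
    [(1 + z A / N) ^ N B (1 - z A / N) ^ N] approximates
    [exp (z A) B exp (- z A)]; by [opnorm_mulC] it is bounded by a constant on
    the circle [|z| ^ 2 = N], whereas its coefficient of [z] is [A B - B A]. *)
Theorem commuting_adjoints_commute : A * B = B * A.
Proof.
apply/eqP; rewrite -subr_eq0 -opnorm_eq0 eq_le opnorm_ge0 andbT.
pose a := opnorm A; have a0 : 0 <= a := opnorm_ge0 A.
pose K := opnorm B * expR (a ^+ 2).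
have K0 : 0 <= K by rewrite mulr_ge0 ?opnorm_ge0 ?expR_ge0.
have key N : opnorm (A * B - B * A) * Num.sqrt N.+1%:R <= K.
  set n := N.+1; have n0 : 0 < n%:R :> R by rewrite ltr0n.
  have nC0 : n%:R != 0 :> R[i] by rewrite pnatr_eq0.
  pose X := n%:R^-1 *: A; pose Y := - X.
  have [m [C [m1 FE C0 C1]]] := operator_polynomial_conj X Y n.
  have -> : A * B - B * A = C 1%N.
    rewrite C1 /Y /X mulrN -scalebopAl -scalebopAr -scalerBr scalerA mulfV//.
    by rewrite scale1r.
  rewrite opnormE -[X in _ * X]expr1.
  apply: (cauchy_estimate (n := m)) => //; first by rewrite sqrtr_gt0.
  move=> z zn; rewrite -FE -opnormE.
  set P := (1 + z *: X) ^+ n; set Q := (1 + z *: Y) ^+ n.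
  have nP : normal_class P.
    apply: normal_classX; rewrite scalerA; apply: normal_class_affine.
    exact: normal_classA.
  have nQ : normal_class Q.
    apply: normal_classX; rewrite /Y scalerN scalerA -scaleNr.
    by apply: normal_class_affine; exact: normal_classA.
  rewrite -mulrA (le_trans (opnorm_mulC nP _))//.
    by apply: normal_classM => //; exact: normal_classB.
  rewrite -mulrA (le_trans (opnormM _ _))// /K ler_wpM2l ?opnorm_ge0//.
  have XY : GRing.comm (1 + z *: Y) (1 + z *: X).
    rewrite /Y scalerN; apply: commrD; first exact: commr1.
    apply: commr_sym; apply: commrD; first exact: commr1.
    by apply: commrN.
  rewrite -exprMn_comm// (le_trans (opnormX_le _ _))//.
  have -> : (1 + z *: Y) * (1 + z *: X) = 1 - (z / n%:R) ^+ 2 *: A ^+ 2.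
    rewrite /Y scalerN mulrDl mul1r mulrDr mulr1 mulNr addrA addrK.
    by rewrite /X scalerA -scalebopAl -scalebopAr scalerA -!expr2.
  have : opnorm (1 - (z / n%:R) ^+ 2 *: A ^+ 2) <= 1 + a ^+ 2 / n%:R.
    have zE : cabs ((z / n%:R) ^+ 2) = n%:R^-1.
      rewrite cabsX cabsM cabsV cabs_nat zn expr_div_n sqr_sqrtr ?ler0n//.
      by rewrite expr2 invfM mulrA mulfV ?gt_eqF// mul1r.
    rewrite (le_trans (opnormD _ _))// lerD ?opnorm1_le// opnormN opnormZ zE.
    rewrite mulrC ler_wpM2r ?invr_ge0 ?ler0n//.
    exact: opnormX_le.
  move=> h; rewrite (le_trans (lerXn2r n _ _ h))// ?nnegrE ?opnorm_ge0//.
    by rewrite addr_ge0// divr_ge0 ?exprn_ge0// ltW.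
  rewrite -[X in expR X](@divfK _ n%:R) ?gt_eqF// -mulr_natr in h *.
  rewrite expRM_natr lerXn2r ?nnegrE ?expR_ge0 ?expR_ge1Dx//.
  by rewrite addr_ge0// divr_ge0 ?exprn_ge0// ltW.
rewrite leNgt; apply/negP => c0; set c := opnorm _ in c0 key.
pose N := Num.truncn ((K / c) ^+ 2); have := key N.
apply/negP; rewrite -ltNge mulrC -ltr_pdivrMr//.
have Kc : 0 <= K / c by rewrite divr_ge0// ltW.
rewrite -[ltLHS](ger0_norm Kc) -sqrtr_sqr ltr_sqrt ?ltr0n//.
by rewrite truncnS_gt.
Qed.

End Commutation.

(** * Logarithms of zero-free polynomials *)

Section LogarithmExpansion.
Context {R : realType}.

Lemma mean_value_bound (f df : R -> R) (K : R) :
  (forall t : R, 0 <= t <= 1 -> is_derive t 1 f (df t)) ->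
  (forall t : R, 0 <= t <= 1 -> `|df t| <= K) -> `|f 1 - f 0| <= K.
Proof.
move=> fdf dfK.
have [||t /itvP t01 ->] := @MVT R f df 0 1 ltr01.
- by move=> t /itvP t01; apply: fdf; rewrite !t01.
- apply: derivable_within_continuous => t /itvP t01.
  by have [] := fdf t; rewrite ?t01.
- by rewrite subr0 mulr1; apply: dfK; rewrite !t01.
Qed.

(** Taylor expansion of [ln |1 - v|] with remainder: differentiate along the
    segment [t v], [0 <= t <= 1], where the derivative is a geometric series. *)
Lemma ln_cabs_1sub (v : R[i]) K : cabs v < 1 ->
  `|ln (cabs (1 - v)) + complex.Re (\sum_(k < K) v ^+ k.+1 / k.+1%:R)|
    <= cabs v ^+ K.+1 / (1 - cabs v).
Proof.
move=> v1; have [/= d0 _] := andP (cabs_1sub_gt0 v1).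
pose D : {poly R} := 1 - (2 * complex.Re v) *: 'X + (cabs v ^+ 2) *: 'X^2.
pose p : {poly R} := \sum_(k < K) (complex.Re (v ^+ k.+1) / k.+1%:R) *: 'X^(k.+1).
have DE t : D.[t] = cabs (1 - t%:C * v) ^+ 2.
  rewrite !cabs_sqr !hornerE/= cabs_sqr; case: (v) => a b /=; ring.
have tv (t : R) : 0 <= t <= 1 -> cabs (t%:C * v) <= cabs v.
  move=> /andP[t0 t1]; rewrite cabsM cabsR ger0_norm//.
  by rewrite ler_piMl ?cabs_ge0.
have tv1 (t : R) : 0 <= t <= 1 -> cabs (t%:C * v) < 1.
  by move=> /tv h; exact: le_lt_trans v1.
have D0 (t : R) : 0 <= t <= 1 -> 0 < D.[t].
  move=> /tv1 h; have /andP[h0 h1] := cabs_1sub_gt0 h.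
  by rewrite DE exprn_gt0// (lt_le_trans h0).
pose f t := 2^-1 * ln D.[t] + p.[t].
pose df t := 2^-1 * (D.[t]^-1 * D^`().[t]) + p^`().[t].
have fdf (t : R) : 0 <= t <= 1 -> is_derive t 1 f (df t).
  move=> t01; have h := is_derive1_ln (D0 t t01).
  have h2 := is_derive1_comp h (is_derive_poly D t).
  exact: (is_deriveD (is_deriveZ 2^-1 h2) (is_derive_poly p t)).
have dfE (t : R) : 0 <= t <= 1 ->
    df t = - complex.Re (v * ((t%:C * v) ^+ K / (1 - t%:C * v))).
  move=> t01; have tvn1 : t%:C * v != 1.
    by apply/eqP => h; have := tv1 t t01; rewrite h cabs1 ltxx.
  have -> : v * ((t%:C * v) ^+ K / (1 - t%:C * v)) =
      v / (1 - t%:C * v) - \sum_(k < K) v * (t%:C * v) ^+ k.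
    by rewrite [X in _ = v * X - _](geometric_tail K tvn1) [in RHS]mulrDr -mulr_sumr addrAC subrr add0r.
  rewrite Re_sub Re_sum opprB addrC /df; congr (_ + _).
    rewrite Re_div -DE; have D0' : D.[t] != 0 by rewrite gt_eqF// D0.
    rewrite /D derivD derivB !derivZ -polyC1 derivC derivX derivXn !hornerE/= in D0' *.
    move: D0'; rewrite cabs_sqr; case: (v) => a b /= D0'; field.
    by apply/negP => /eqP h; move/eqP: D0'; apply; rewrite -h; ring.
  rewrite /p raddf_sum horner_sum /=; apply: eq_bigr => k _.
  rewrite derivZ derivXn hornerZ hornerMn hornerXn /=.
  rewrite exprMn -realCX mulrCA -exprS Re_scale.
  by rewrite -[t ^+ k *+ _]mulr_natr mulrCA divfK ?pnatr_eq0.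
have dfK (t : R) : 0 <= t <= 1 -> `|df t| <= cabs v ^+ K.+1 / (1 - cabs v).
  move=> t01; rewrite dfE// normrN (le_trans (ler_cabs_Re _))//.
  rewrite !cabsM cabsV cabsX exprS -mulrA ler_wpM2l ?cabs_ge0//.
  have /andP[h0 h1] := cabs_1sub_gt0 (tv1 t t01).
  apply: ler_pM; rewrite ?exprn_ge0 ?invr_ge0 ?cabs_ge0//.
    by rewrite lerXn2r ?nnegrE ?cabs_ge0// tv.
  rewrite lef_pV2 ?posrE ?(lt_le_trans h0 h1)// (le_trans _ h1)//.
  by rewrite lerD2l lerN2 tv.
have := mean_value_bound fdf dfK.
have h0 : 0 < cabs (1 - v) by have /andP[h h1] := cabs_1sub_gt0 v1; exact: lt_le_trans h1.
rewrite /f !DE mul1r mul0r subr0 cabs1 expr1n ln1 mulr0 add0r.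
rewrite lnXn// -[ln _ *+ 2]mulr_natr mulrCA mulVf ?mulr1 ?pnatr_eq0//.
have -> : p.[0] = 0.
  by rewrite horner_sum big1// => k _; rewrite hornerZ hornerXn expr0n mulr0.
have -> : p.[1] = complex.Re (\sum_(k < K) v ^+ k.+1 / k.+1%:R).
  rewrite horner_sum Re_sum; apply: eq_bigr => k _.
  by rewrite hornerZ hornerXn expr1n mulr1 -natrC -realCV [in RHS]mulrC Re_scale mulrC.
by rewrite subr0.
Qed.

End LogarithmExpansion.

Section ZeroFreePolynomials.
Context {R : realType}.
Implicit Types (w : seq R[i]) (z : R[i]).

(** Each [v] is the inverse of a root, so that the constant term is [1]. *)
Definition split_poly w : {poly R[i]} := \prod_(v <- w) (1 - v *: 'X).

Definition neg_power_sum w k : R[i] := - \sum_(v <- w) v ^+ k.+1.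

Lemma split_poly0 w : (split_poly w)`_0 = 1.
Proof.
rewrite -horner_coef0 horner_prod big1// => v _.
by rewrite !hornerE ?mulr0 ?subr0.
Qed.

(** The logarithmic derivative of [split_poly w] is the generating series of the
    [neg_power_sum w]; here truncated at order [N] to stay with polynomials. *)
Lemma log_derivative_split_poly w N : exists U,
  (split_poly w)^`() = (\poly_(k < N) neg_power_sum w k) * split_poly w + 'X^N * U.
Proof.
elim: w => [|v w [U IH]].
  exists 0; rewrite mulr0 addr0 /split_poly big_nil -polyC1 derivC mulr1.
  apply/polyP => i; rewrite coef0 coef_poly /neg_power_sum big_nil oppr0.
  by case: ifP.
pose S := \poly_(k < N) neg_power_sum w k.
pose T : {poly R[i]} := v *: \sum_(k < N) (v *: 'X) ^+ k.
have TE : (1 - v *: 'X) * T = v%:P - v *: (v *: 'X) ^+ N.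
  rewrite /T -scalerAr -opprB mulNr -subrX1 opprB scalerBr; congr (_ - _).
  by rewrite -mul_polyC mulr1.
have SE : \poly_(k < N) neg_power_sum (v :: w) k = S - T.
  apply/polyP => i; rewrite coefB !coef_poly coefZ coef_sum.
  rewrite (eq_bigr (fun k : 'I_N => if i == k then v ^+ i else 0)) => [|k _].
    rewrite -big_mkcond /=; case: ifPn => iN.
      rewrite (big_pred1 (Ordinal iN)) => [|k]; last by rewrite eq_sym.
      by rewrite /neg_power_sum big_cons opprD addrC exprS.
    rewrite big1 => [|k /eqP ik]; first by rewrite mulr0 subr0.
    by rewrite ik ltn_ord in iN.
  by rewrite exprZn coefZ coefXn; case: eqP => [->|_]; rewrite ?mulr1 ?mulr0.
exists ((1 - v *: 'X) * U - v *: (v ^+ N *: split_poly w)).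
rewrite /split_poly big_cons -!/(split_poly _) SE derivM derivB derivZ derivX.
rewrite -polyC1 derivC sub0r IH -/S.
have -> : - (v *: 1%:P) = - ((1%:P - v *: 'X) * T) - v *: (v ^+ N *: 'X^N) :> {poly R[i]}.
  rewrite polyC1 TE exprZn opprB addrAC subrr add0r -mul_polyC mulr1//.
rewrite polyC1 -!mul_polyC; ring.
Qed.

(** Newton's identities, read off from the coefficient of ['X^n] in the previous
    lemma. *)
Lemma newton_identity w n : n.+1%:R * (split_poly w)`_n.+1 =
  \sum_(k < n.+1) neg_power_sum w k * (split_poly w)`_(n - k).
Proof.
have [U] := log_derivative_split_poly w n.+1.
move/(congr1 (fun p : {poly _} => p`_n)); rewrite coef_deriv coefD coefXnM ltnSn addr0.
rewrite mulr_natl => ->; rewrite coefM; apply: eq_bigr => k _.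
by rewrite coef_poly ltn_ord.
Qed.

(** The roots of [F] lie outside the closed disc, hence their inverses inside. *)
Lemma zero_free_split (F : {poly R[i]}) (c : R) : 0 < c ->
  (forall z, cabs z <= 1 -> c <= cabs F.[z]) ->
  exists2 w, F = F`_0 *: split_poly w & {in w, forall v, cabs v < 1}.
Proof.
move=> c0 hF; have [s FE] := closed_field_poly_normal F.
have F0 : F != 0.
  apply/eqP => F0; have := hF 0; rewrite F0 horner0 cabs0.
  by move=> /(_ ler01); rewrite leNgt c0.
have l0 : lead_coef F != 0 by rewrite lead_coef_eq0.
have s1 x : x \in s -> 1 < cabs x.
  move=> xs; rewrite ltNge; apply/negP => /hF; rewrite leNgt => /negP; apply.
  have : root F x by rewrite FE rootZ// root_prod_XsubC.
  by move=> /rootP ->; rewrite cabs0.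
have s0 x : x \in s -> x != 0.
  by move=> /s1; apply: contraTneq => ->; rewrite cabs0 ltNge ler01.
have FE' : F = (lead_coef F * \prod_(x <- s) (- x)) *: split_poly [seq x^-1 | x <- s].
  rewrite [LHS]FE -scalerA /split_poly big_map; congr (_ *: _).
  elim: s s0 {FE s1} => [|x s IH] s0; first by rewrite !big_nil scale1r.
  rewrite !big_cons IH => [|y ys]; last by apply: s0; rewrite inE ys orbT.
  have x0 : x != 0 by apply: s0; rewrite inE eqxx.
  rewrite [- x * _]mulrC -scalerA -scalerAr; congr (_ *: _).
  rewrite scalerAl; congr (_ * _).
  rewrite scalerBr scalerA.
  by rewrite mulNr mulfV// scaleN1r opprK addrC -alg_polyC scaleNr.
have : F`_0 = lead_coef F * \prod_(x <- s) (- x).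
  by rewrite {1}FE' coefZ split_poly0 mulr1.
move=> E; exists [seq x^-1 | x <- s]; first by rewrite E -FE'.
move=> v /mapP[x /s1 x1 ->]; rewrite cabsV invf_lt1//.
exact: lt_trans x1.
Qed.

Lemma power_tail_small w (eps : R) k : {in w, forall v, cabs v < 1} -> 0 < eps ->
  exists2 K, (k < K)%N & \sum_(v <- w) cabs v ^+ K.+1 / (1 - cabs v) <= eps.
Proof.
move=> w1 e0.
have h : (fun K => \sum_(v <- w) cabs v ^+ K.+1 / (1 - cabs v)) @ \oo --> (0 : R).
  rewrite [X in _ --> X](_ : _ = \sum_(v <- w) 0); last by rewrite big1.
  elim: w w1 => [_|v w IH w1].
    under eq_fun do rewrite big_nil; rewrite big_nil; exact: cvg_cst.
  under eq_fun do rewrite big_cons; rewrite big_cons; apply: cvgD; last first.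
    by apply: IH => u uw; apply: w1; rewrite inE uw orbT.
  have v1 : cabs v < 1 by apply: w1; rewrite inE eqxx.
  rewrite -[X in _ --> X](mul0r (1 - cabs v)^-1); apply: cvgMl.
  rewrite (cvg_shiftS (fun n => cabs v ^+ n)).
  by apply: cvg_expr; rewrite ger0_norm ?cabs_ge0.
move/cvgr_le: h => /(_ _ e0)[N _ hN]; exists (maxn N k.+1); first by rewrite leq_max ltnSn orbT.
by apply: hN; rewrite /= leq_max leqnn.
Qed.

(** If [F = F_0 exp g] has no zero in the closed disc and [|F| >= c] there, then
    [Re g] is bounded below, and the Caratheodory inequality bounds the Taylor
    coefficients [q k / k.+1] of [g]; the recursion is [F' = g' F]. *)
Theorem zero_free_coefficients (F : {poly R[i]}) (c : R) : 0 < c ->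
  (forall z, cabs z <= 1 -> c <= cabs F.[z]) ->
  exists q : nat -> R[i],
    (forall n, n.+1%:R * F`_n.+1 = \sum_(k < n.+1) q k * F`_(n - k)) /\
    (forall k, cabs (q k) <= 2 * k.+1%:R * (ln (cabs F`_0) - ln c)).
Proof.
move=> c0 hF; have [w FE w1] := zero_free_split c0 hF.
exists (neg_power_sum w); split.
  move=> n; rewrite FE !coefZ mulrCA newton_identity mulr_sumr.
  by apply: eq_bigr => k _; rewrite coefZ mulrCA.
have F0 : 0 < cabs F`_0.
  by rewrite -horner_coef0 (lt_le_trans c0)// hF// cabs0.
move=> k; apply/ler_addgt0Pr => e e0.
have k0 : 0 < 2 * k.+1%:R :> R by rewrite mulr_gt0// ltr0n.
have [K kK hK] := power_tail_small k w1 (divr_gt0 e0 k0).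
set d := \sum_(v <- w) _ in hK.
pose a : nat -> R[i] := fun i => if i is j.+1 then neg_power_sum w j / j.+1%:R
  else (ln (cabs F`_0) - ln c + d)%:C.
have pos z : cabs z = 1 -> 0 <= complex.Re (\sum_(i < K.+1) a i * z ^+ i).
  move=> z1; have hz : c <= cabs F.[z] by apply: hF; rewrite z1.
  have zv v : v \in w -> cabs (v * z) < 1 by move=> /w1; rewrite cabsM z1 mulr1.
  have v0 v : v \in w -> 0 < cabs (1 - v * z).
    by move=> /zv h; have /andP[h0 h1] := cabs_1sub_gt0 h; exact: lt_le_trans h1.
  have lnF : ln (cabs F.[z]) = ln (cabs F`_0) + \sum_(v <- w) ln (cabs (1 - v * z)).
    rewrite {1}FE hornerZ cabsM horner_prod.
    under eq_bigr do rewrite !hornerE.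
    have [h0 ->] : 0 < cabs (\prod_(v <- w) (1 - v * z)) /\
        \sum_(v <- w) ln (cabs (1 - v * z)) = ln (cabs (\prod_(v <- w) (1 - v * z))).
      elim: (w) v0 => [|v s IH] v0; first by rewrite !big_nil cabs1 ln1.
      rewrite !big_cons cabsM; have [|h0 ->] := IH.
        by move=> u us; apply: v0; rewrite inE us orbT.
      have vp : 0 < cabs (1 - v * z) by apply: v0; rewrite inE eqxx.
      by rewrite mulr_gt0// lnM.
    by rewrite lnM.
  have : 0 <= ln (cabs F.[z]) - ln c by rewrite subr_ge0 ler_ln ?posrE// (lt_le_trans c0).
  move=> /le_trans; apply; rewrite big_ord_recl mulr1 Re_add /= lnF.
  set T := \sum_(i < K) _.
  have TE : complex.Re T = - \sum_(v <- w)
      complex.Re (\sum_(k < K) (v * z) ^+ k.+1 / k.+1%:R).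
    rewrite -Re_sum -Re_opp exchange_big /= -sumrN; congr complex.Re.
    apply: eq_bigr => i _; rewrite /bump /= add1n /neg_power_sum !mulNr mulr_suml mulr_suml.
    congr (- _); apply: eq_bigr => v _.
    by rewrite exprMn mulrAC.
  suff : \sum_(v <- w) ln (cabs (1 - v * z)) - complex.Re T <= d by lra.
  rewrite TE opprK -big_split/= /d big_seq [leRHS]big_seq; apply: ler_sum => v vw.
  rewrite (le_trans (ler_norm _))// (le_trans (ln_cabs_1sub K (zv v vw)))//.
  by rewrite cabsM z1 mulr1.
rewrite -[leLHS](@divfK _ k.+1%:R) ?pnatr_eq0//.
have := caratheodory_poly (n := K) (k := k.+1) kK pos.
rewrite /= cabsM cabsV cabs_nat => h.
rewrite -(ler_pM2r (_ : 0 < k.+1%:R)) ?ltr0n// in h; rewrite (le_trans h)//.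
rewrite mulrAC mulrDr lerD2l -ler_pdivlMl//.
by rewrite mulrC.
Qed.

End ZeroFreePolynomials.

(** * Approximate joint eigenvectors *)

Section JointApproximateEigenvectors.
Context {R : realType} {H : normedModType R[i]} (ip : {dot H for conjC}).
Hypothesis hip : is_inner_product ip.
Implicit Types (S T : bop H) (x y : H) (l : seq (bop H * R[i])).

Definition approx_eigvec l (d : R) x : Prop :=
  rnorm x = 1 /\ forall p, p \in l -> rnorm (p.1 x - p.2 *: x) <= d.

(** The points of the joint approximate point spectrum of a list of operators. *)
Definition approx_spectrum l : Prop :=
  forall d, 0 < d -> exists x, approx_eigvec l d x.

Lemma approx_eigvec_le l d e x : d <= e -> approx_eigvec l d x -> approx_eigvec l e x.
Proof. by move=> de [x1 h]; split => // p /h /le_trans; apply. Qed.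

Definition quad S x : R := complex.Re (ip (S x) x).

Lemma quad_le S x : quad S x <= rnorm (S x) * rnorm x.
Proof.
by rewrite (le_trans (ler_norm _))// (le_trans (ler_cabs_Re _))// cauchy_schwarz.
Qed.

Lemma rnorm_unit x : x != 0 -> rnorm ((rnorm x)^-1%:C *: x) = 1.
Proof.
rewrite -rnorm_gt0 => x0.
by rewrite rnormZ cabsR ger0_norm ?invr_ge0 ?rnorm_ge0// mulVf ?gt_eqF.
Qed.

Lemma quadZ S (t : R) x : quad S (t%:C *: x) = t ^+ 2 * quad S x.
Proof.
by rewrite /quad bopZ ipZl ipZr conjCR mulrA -realCM Re_scale expr2.
Qed.

(** For real parts only; in general the two numbers are conjugate. *)
Lemma adjoint_swap S x y : is_adjoint ip S S ->
  complex.Re (ip (S x) y) = complex.Re (ip (S y) x).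
Proof. by move=> hS; rewrite hS [RHS](congr1 _ (ipC _ _ _)); case: (ip x (S y)). Qed.

(** The new eigenvalue is the limit of the suprema of [<S x, x>] over the
    [d]-approximate eigenvectors [x] of [l], as [d] tends to [0].  As [S]
    commutes with [l], [S x] is again such a vector, which bounds
    [<S^3 x, x> / <S^2 x, x>]; for a maximizing [x] this forces
    [|S x - lambda x|] to be small. *)
Lemma approx_spectrum_extend_ge1 l S : is_adjoint ip S S ->
  (forall x, rnorm x = 1 -> 1 <= quad S x) ->
  (forall p, p \in l -> GRing.comm p.1 S) ->
  approx_spectrum l -> exists lam : R, approx_spectrum ((S, lam%:C) :: l).
Proof.
move=> hS S1 Sl Hl.
pose E d : set R := [set quad S x | x in approx_eigvec l d].
have quad_bound x : rnorm x = 1 -> quad S x <= opnorm S.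
  by move=> x1; rewrite (le_trans (quad_le _ _))// x1 mulr1 (le_trans (rnorm_bop _ _))// x1 mulr1.
have E_sup d : 0 < d -> has_sup (E d).
  move=> d0; split; first by have [x hx] := Hl d d0; exists (quad S x), x.
  by exists (opnorm S) => _ [x [x1 _] <-]; exact: quad_bound.
pose s d := sup (E d).
have s_ub d x : 0 < d -> approx_eigvec l d x -> quad S x <= s d.
  by move=> d0 hx; apply: sup_upper_bound; [exact: E_sup|exists x].
have s_ge1 d : 0 < d -> 1 <= s d.
  move=> d0; have [x hx] := Hl d d0.
  by rewrite (le_trans _ (s_ub _ _ d0 hx))// S1//; case: hx.
pose L : set R := [set s d | d in [set d | 0 < d]].
have L_inf : has_inf L.
  by split; [exists (s 1), 1 => //=|exists 1 => _ [d /= d0 <-]; exact: s_ge1].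
pose lam := inf L.
have lam1 : 1 <= lam.
  by apply: lb_le_inf; [case: L_inf|move=> _ [d /= d0 <-]; exact: s_ge1].
have lam_le d : 0 < d -> lam <= s d.
  by move=> d0; apply: ge_inf; [case: L_inf|exists d].
have lam0 : 0 < lam by exact: lt_le_trans lam1.
exists lam => e e0.
(* The final estimate is [|S x - lam x| ^ 2 <= 2 lam eta]. *)
pose eta := Num.min 1 (e ^+ 2 / (2 * lam)).
have eta0 : 0 < eta by rewrite lt_min ltr01 divr_gt0 ?exprn_gt0 ?mulr_gt0.
have eta1 : eta <= 1 by rewrite ge_min lexx.
have eta_e : 2 * lam * eta <= e ^+ 2.
  by rewrite mulrC -ler_pdivlMr ?mulr_gt0// ge_min lexx orbT.
have [_ [d0 /= d0_gt0 <-] sd0] := inf_adherent eta0 L_inf; rewrite -/lam in sd0.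
pose c := opnorm S + 1.
have c0 : 0 < c by rewrite ltr_wpDl ?opnorm_ge0.
have c1 : 1 <= c by rewrite lerDr opnorm_ge0.
pose d := Num.min e (d0 / c).
have d_gt0 : 0 < d by rewrite lt_min e0 divr_gt0.
have de : d <= e by rewrite ge_min lexx.
have dc : d * c <= d0 by rewrite -ler_pdivlMr// ge_min lexx orbT.
have dd0 : d <= d0 by rewrite (le_trans _ dc)// ler_peMr// ltW.
have [_ [x hx <-] xmax] := sup_adherent eta0 (E_sup d d_gt0).
have [x1 hxl] := hx.
have m1_ge : lam - eta <= quad S x by rewrite (le_trans _ (ltW xmax))// lerD2r lam_le.
have m1_le : quad S x <= lam + eta.
  by rewrite (le_trans (s_ub _ _ d0_gt0 (approx_eigvec_le dd0 hx)))// ltW.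
set m1 := quad S x in m1_ge m1_le.
pose y := S x; have y1 : 1 <= rnorm y.
  by rewrite (le_trans (S1 x x1))// (le_trans (quad_le _ _))// x1 mulr1.
have y0 : y != 0 by rewrite -rnorm_gt0 (lt_le_trans ltr01).
pose m2 := rnorm y ^+ 2; pose m3 := quad S y.
(* [y] is, up to a factor [c], again an approximate eigenvector for [l]. *)
have m3_le : m3 <= (lam + eta) * m2.
  have hy : approx_eigvec l d0 ((rnorm y)^-1%:C *: y).
    split=> [|p pl]; first exact: rnorm_unit.
    rewrite bopZ scalerA mulrC -scalerA -scalerBr rnormZ cabsR ger0_norm ?invr_ge0 ?rnorm_ge0//.
    rewrite ler_pdivrMl ?rnorm_gt0//.
    have -> : p.1 y - p.2 *: y = S (p.1 x - p.2 *: x).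
      by rewrite bopB bopZ /y -!bop_mulE Sl.
    rewrite (le_trans (rnorm_bop _ _))// (@le_trans _ _ d0)//; last first.
      by rewrite ler_peMl// ltW.
    rewrite (le_trans _ dc)// mulrC ler_pM ?rnorm_ge0 ?opnorm_ge0// ?hxl//.
    by rewrite lerDl.
  have := s_ub _ _ d0_gt0 hy; rewrite quadZ -/m3 exprVn mulrC ler_pdivrMr ?exprn_gt0 ?rnorm_gt0//.
  by move=> /le_trans; apply; rewrite ler_wpM2r ?exprn_ge0 ?rnorm_ge0// ltW.
have m2E : complex.Re (ip (S x) y) = m2 by rewrite /y ip_self.
have quad_ge0 z : 0 <= quad S z.
  have [->|z0] := eqVneq z 0; first by rewrite /quad ip0r.
  have := S1 _ (rnorm_unit z0); rewrite quadZ => h.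
  rewrite -(@pmulr_rge0 _ ((rnorm z)^-1 ^+ 2)) ?(le_trans ler01)//.
  by rewrite exprn_gt0// invr_gt0 rnorm_gt0.
pose t := lam + eta; have t0 : 0 < t by rewrite addr_gt0.
(* Positivity of [S] at [t x - y]. *)
have m2_le : m2 <= t * m1.
  have := quad_ge0 (t%:C *: x - y).
  rewrite {1}/quad bopB bopZ !ipBl !ipBr !ipZl !ipZr conjCR !Re_sub !Re_scale.
  rewrite -!/(quad _ _) -/m1 -/m3 (adjoint_swap y x hS) m2E.
  move=> h; rewrite -(ler_pM2l t0); move: h m3_le; rewrite -/t; lra.
exists x; split=> // p; rewrite inE => /predU1P[->/=|/hxl /le_trans]; last by apply.
rewrite -ler_sqr ?nnegrE ?rnorm_ge0 ?(ltW e0)//.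
have -> : rnorm (S x - lam%:C *: x) ^+ 2 = m2 - 2 * lam * m1 + lam ^+ 2.
  have -> u : rnorm u ^+ 2 = complex.Re (ip u u) by rewrite ip_self.
  rewrite !ipBl !ipBr !ipZl !ipZr conjCR !Re_sub !Re_scale m2E -!/(quad _ _) -/m1.
  rewrite ip_self//= x1 expr1n mulr1 [complex.Re (ip x (S x))](_ : _ = m1).
    ring.
  by rewrite -hS.
rewrite (le_trans _ eta_e)//.
have : (lam - eta) * (lam - eta) <= (lam - eta) * m1.
  by rewrite ler_wpM2l// subr_ge0 (le_trans eta1).
move: m2_le; rewrite /t; nra.
Qed.

(** Reduction to the previous lemma by adding a multiple of the identity. *)
Lemma approx_spectrum_extend_sa l S : is_adjoint ip S S ->
  (forall p, p \in l -> GRing.comm p.1 S) ->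
  approx_spectrum l -> exists lam : R[i], approx_spectrum ((S, lam) :: l).
Proof.
move=> hS Sl Hl; pose c := opnorm S + 1; pose I : bop H := 1.
have [|||lam hlam] := @approx_spectrum_extend_ge1 l (S + c%:C *: I) _ _ _ Hl.
- by apply: adjointD => //; have := @adjointZ _ _ ip c%:C I I (@adjoint1 _ _ ip); rewrite conjCR.
- move=> x x1; rewrite /quad bop_addE bop_scaleE ipDl ipZl Re_add Re_scale ip_self// x1 expr1n mulr1.
  rewrite /c addrA lerDr -lerBlDr sub0r.
  have := quad_le (- S) x; rewrite /quad bop_oppE linearNl Re_opp rnormN x1 mulr1.
  move=> h; rewrite lerNl (le_trans h)// (le_trans (rnorm_bop _ _))// x1 mulr1//.
- move=> p pl; apply: commrD; first exact: Sl.
  by rewrite /GRing.comm -scalebopAr -scalebopAl mulr1 mul1r.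
exists (lam - c)%:C => d d0; have [x [x1 hx]] := hlam d d0; exists x; split=> // p.
rewrite inE => /predU1P[->/=|pl]; last by apply: hx; rewrite inE pl orbT.
have : rnorm ((S + c%:C *: I) x - lam%:C *: x) <= d.
  by apply: (hx (S + c%:C *: I, lam%:C)); rewrite inE eqxx.
rewrite bop_addE bop_scaleE bop_oneE; congr (rnorm _ <= _).
by rewrite realCB scalerBl opprB addrA addrAC.
Qed.

(** Apply the self-adjoint case to the real and imaginary parts of [T] in turn. *)
Lemma approx_spectrum_extend l T T' : is_adjoint ip T T' -> GRing.comm T T' ->
  (forall p, p \in l -> GRing.comm p.1 T /\ GRing.comm p.1 T') ->
  approx_spectrum l -> exists b, approx_spectrum ((T, b) :: l).
Proof.
move=> hT TT' Tl Hl.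
pose S1 := T + T'; pose S2 := 'i%C *: (T' - T).
have hS1 : is_adjoint ip S1 S1.
  by rewrite /S1 {2}addrC; apply: adjointD => //; exact: adjoint_sym.
have hS2 : is_adjoint ip S2 S2.
  have E : conjC 'i%C *: (T - T') = S2 by rewrite conjC_i scaleNr -scalerN opprB.
  by rewrite -{2}E; apply: adjointZ; apply: adjointB => //; exact: adjoint_sym.
have comm_scale (X Y : bop H) c : GRing.comm X Y -> GRing.comm X (c *: Y).
  by move=> XY; rewrite /GRing.comm -scalebopAr XY scalebopAl.
have [|b1 hb1] := approx_spectrum_extend_sa hS1 _ Hl.
  by move=> p /Tl[pT pT']; exact: commrD.
have S12 : GRing.comm S1 S2.
  have TS1 : GRing.comm T S1 by exact: commrD.
  have T'S1 : GRing.comm T' S1 by apply: commrD => //; exact: commr_sym.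
  apply: comm_scale; apply: commrD; first exact: commr_sym.
  by apply: commrN; exact: commr_sym.
have [|b2 hb2] := approx_spectrum_extend_sa hS2 _ hb1.
  move=> p; rewrite inE => /predU1P[->//|/Tl[pT pT']].
  by apply: comm_scale; apply: commrD => //; exact: commrN.
exists (2^-1 * (b1 + 'i%C * b2)) => d d0; have [x [x1 hx]] := hb2 d d0; exists x; split=> // p.
rewrite inE => /predU1P[->/=|pl]; last by apply: hx; rewrite !inE pl !orbT.
have h1 := hx (S1, b1); have h2 := hx (S2, b2); rewrite !inE !eqxx ?orbT in h1 h2.
have {}h1 := h1 isT; have {}h2 := h2 isT; rewrite /= in h1 h2.
have -> : T x - (2^-1 * (b1 + 'i%C * b2)) *: x =
    2^-1 *: ((S1 x - b1 *: x) + 'i%C *: (S2 x - b2 *: x)).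
  have TE : T = 2^-1 *: (S1 + 'i%C *: S2).
    rewrite /S2 scalerA -expr2 sqr_i scaleN1r opprB /S1 addrACA [T' + _]addrC addNr addr0.
    by rewrite -mulr2n -[T *+ 2]scaler_nat scalerA mulVf ?pnatr_eq0// scale1r.
  rewrite {1}TE bop_scaleE bop_addE bop_scaleE -scalerA -scalerBr scalerDl -scalerA.
  by rewrite opprD addrACA -scalerBr.
rewrite rnormZ cabsV cabs_nat ler_pdivrMl// (le_trans (rnormD _ _))// rnormZ.
have -> : cabs ('i%C : R[i]) = 1 by rewrite /cabs normc_def /= expr0n expr1n add0r sqrtr1.
by rewrite mul1r; lra.
Qed.

End JointApproximateEigenvectors.

Section JointEigenvectors.
Context {R : realType} {H : normedModType R[i]} (ip : {dot H for conjC}).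
Hypothesis hip : is_inner_product ip.
Variable (x0 : H).
Hypothesis x0_neq0 : x0 != 0.

Lemma near_opnorm (A : bop H) (e : R) : 0 < e ->
  exists2 x : H, rnorm x = 1 & opnorm A - e <= rnorm (A x).
Proof.
move=> e0; apply: contrapT => h.
have lt x : rnorm x = 1 -> rnorm (A x) < opnorm A - e.
  by move=> x1; rewrite ltNge; apply/negP => Ax; apply: h; exists x.
have M0 : 0 <= opnorm A - e.
  have u1 := rnorm_unit x0_neq0; set u := _ *: x0 in u1.
  by rewrite (le_trans (rnorm_ge0 (A u)))// ltW// lt.
suff : opnorm A <= opnorm A - e by rewrite leNgt ltrBlDr ltrDl e0.
apply: opnorm_least_real => // x.
have [->|xn0] := eqVneq x 0; first by rewrite bop0 rnorm0 mulr0.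
have := lt _ (rnorm_unit xn0); rewrite bopZ rnormZ cabsR ger0_norm ?invr_ge0 ?rnorm_ge0//.
by rewrite mulrC ltr_pdivrMr ?rnorm_gt0// => /ltW.
Qed.

(** This makes [|A| ^ 2] the first joint eigenvalue, from which the norm of [A] is
    recovered at the end. *)
Lemma approx_spectrum_norm2 (A A' : bop H) : is_adjoint ip A A' ->
  approx_spectrum [:: (A' * A, (opnorm A ^+ 2)%:C)].
Proof.
move=> hA d d0; set a := opnorm A; have a0 : 0 <= a := opnorm_ge0 A.
pose e := d ^+ 2 / (2 * a ^+ 3 + 1).
have c0 : 0 < 2 * a ^+ 3 + 1 by rewrite ltr_wpDl// mulr_ge0// exprn_ge0.
have e0 : 0 < e by rewrite divr_gt0// exprn_gt0.
have [x x1 hx] := near_opnorm A e0; exists x; split=> // p.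
rewrite inE => /eqP ->; rewrite -[X in rnorm X]/(A' (A x) - (a ^+ 2)%:C *: x).
rewrite -ler_sqr ?nnegrE ?rnorm_ge0 ?(ltW d0)//.
set t := rnorm (A x); have ta : t <= a by rewrite (le_trans (rnorm_bop _ _))// x1 mulr1.
have t0 : 0 <= t by exact: rnorm_ge0.
have -> : rnorm (A' (A x) - (a ^+ 2)%:C *: x) ^+ 2 =
    rnorm (A' (A x)) ^+ 2 - 2 * a ^+ 2 * t ^+ 2 + a ^+ 4.
  have E u : rnorm u ^+ 2 = complex.Re (ip u u) by rewrite ip_self.
  rewrite E !ipBl !ipBr !ipZl !ipZr conjCR !Re_sub !Re_scale -E.
  rewrite (adjoint_sym hA) ip_self//= -hA ip_self//= ip_self//= x1 -/t; ring.
have h1 : rnorm (A' (A x)) ^+ 2 <= a ^+ 2 * t ^+ 2.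
  rewrite -exprMn lerXn2r ?nnegrE ?rnorm_ge0 ?mulr_ge0//.
  by rewrite (le_trans (rnorm_bop _ _))// -(opnorm_adjoint hip hA).
have h2 : (a - t) * (2 * a ^+ 3) <= d ^+ 2.
  have at_e : a - t <= e by move: hx; rewrite -/t -/a; lra.
  rewrite (@le_trans _ _ (e * (2 * a ^+ 3 + 1)))//; last by rewrite /e divfK// gt_eqF.
  apply: ler_pM; rewrite ?subr_ge0// ?mulr_ge0 ?exprn_ge0//.
  by rewrite lerDl.
have h3 : a ^+ 2 * (a ^+ 2 - t ^+ 2) <= (a - t) * (2 * a ^+ 3).
  have -> : a ^+ 2 * (a ^+ 2 - t ^+ 2) = a ^+ 2 * (a - t) * (a + t) by ring.
  have -> : (a - t) * (2 * a ^+ 3) = a ^+ 2 * (a - t) * (2 * a) by ring.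
  by rewrite ler_wpM2l ?mulr_ge0 ?exprn_ge0 ?subr_ge0// mulr_natl mulr2n lerD2l.
move: h1 h2 h3; lra.
Qed.

Variables (A A' : nat -> bop H).
Hypotheses (hA : forall n, is_adjoint ip (A n) (A' n))
  (AA : forall m n, GRing.comm (A m) (A n)) (AA' : forall m n, GRing.comm (A m) (A' n)).

(** These vectors stand in for a character of the commutative C*-algebra
    generated by the [A m] at which the Gelfand transform of [A n] attains its
    norm. *)
Theorem joint_approx_eigvec n N (d : R) : 0 < d -> exists x : H,
  [/\ rnorm x = 1,
      forall m, (m < N)%N -> rnorm (A m x - ip (A m x) x *: x) <= d &
      opnorm (A n) - d <= cabs (ip (A n x) x)].
Proof.
move=> d0.
have A'A' m k : GRing.comm (A' m) (A' k).
  by apply: (adjoint_uniq hip (A := A k * A m)); [|rewrite AA]; exact: adjointM.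
have [l [hl lA] lN] : exists2 l : seq (bop H * R[i]), approx_spectrum l /\
      (forall p, p \in l -> forall k, GRing.comm p.1 (A k) /\ GRing.comm p.1 (A' k)) &
    (A' n * A n, (opnorm (A n) ^+ 2)%:C) \in l /\
    forall m, (m < maxn N n.+1)%N -> exists b, (A m, b) \in l.
  elim: (maxn N n.+1) => [|M [l [hl lA] [l0 lM]]].
    exists [:: (A' n * A n, (opnorm (A n) ^+ 2)%:C)]; last by rewrite inE eqxx.
    split; first exact: approx_spectrum_norm2.
    move=> p; rewrite inE => /eqP -> k /=.
    split; apply: commr_sym; apply: commrM => //.
    by apply: commr_sym.
  have [b hb] := approx_spectrum_extend hip (hA M) (AA' M M) (fun p pl => lA p pl M) hl.
  exists ((A M, b) :: l).
    by split=> // p; rewrite inE => /predU1P[->/=|/lA].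
  split; first by rewrite inE l0 orbT.
  move=> m; rewrite ltnS leq_eqVlt => /predU1P[->|/lM[c hc]].
    by exists b; rewrite inE eqxx.
  by exists c; rewrite inE hc orbT.
have [ln lm] := lN.
pose e := Num.min (d / 4) ((d / 2) ^+ 2).
have e0 : 0 < e by rewrite lt_min ?exprn_gt0 divr_gt0.
have ed : e <= d / 4 by rewrite ge_min lexx.
have ed2 : e <= (d / 2) ^+ 2 by rewrite ge_min lexx orbT.
have [x [x1 hx]] := hl e e0; exists x.
have key m : (m < maxn N n.+1)%N -> rnorm (A m x - ip (A m x) x *: x) <= 2 * e.
  move=> /lm[b /hx /= hb].
  have -> : A m x - ip (A m x) x *: x = (A m x - b *: x) - ip (A m x - b *: x) x *: x.
    rewrite ipBl ipZl ip_self// x1 expr1n mulr1 scalerBl opprB addrA.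
    by rewrite subrK.
  rewrite (le_trans (rnormD _ _))// rnormN rnormZ x1 mulr1.
  have := cauchy_schwarz hip (A m x - b *: x) x; rewrite x1 mulr1; lra.
split=> // [m mN|]; first by rewrite (le_trans (key m _)) ?leq_max ?mN//; lra.
set a := opnorm (A n); set t := rnorm (A n x).
have ta : t <= a by rewrite (le_trans (rnorm_bop _ _))// x1 mulr1.
have t0 : 0 <= t by exact: rnorm_ge0.
have h1 : a ^+ 2 - t ^+ 2 <= e.
  have := hx _ ln; rewrite -[X in rnorm X]/(A' n (A n x) - (a ^+ 2)%:C *: x) => h.
  have := cauchy_schwarz hip (A' n (A n x) - (a ^+ 2)%:C *: x) x.
  rewrite ipBl ipZl (adjoint_sym (hA n)) !ip_self// x1 expr1n -realCM !mulr1 -realCB cabsR.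
  by move=> /le_trans /(_ h); rewrite distrC => /(le_trans (ler_norm _)).
have h2 : a - t <= d / 2.
  rewrite -ler_sqr ?nnegrE ?subr_ge0 ?divr_ge0 ?(ltW d0)// (le_trans _ ed2)// (le_trans _ h1)//.
  have -> : a ^+ 2 - t ^+ 2 = (a - t) * (a + t) by ring.
  rewrite expr2 ler_wpM2l ?subr_ge0//; lra.
have h3 : t - cabs (ip (A n x) x) <= 2 * e.
  apply: le_trans (key n _); last by rewrite leq_max ltnSn orbT.
  by have := rnormB (A n x) (ip (A n x) x *: x); rewrite rnormZ x1 mulr1.
move: h2 h3 ed; lra.
Qed.

End JointEigenvectors.

(** * Power series with normal values *)

Section Convergence.
Context {R : realType} {V : normedModType R[i]}.

Lemma cvg_rnorm (u : nat -> V) (l : V) :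
  (u @ \oo --> l) <-> (forall e : R, 0 < e -> exists N, forall n, (N <= n)%N -> rnorm (l - u n) <= e).
Proof.
split.
  move=> /cvgrPdist_le h e e0; have [|N _ hN] := h e%:C; first by rewrite ltcR.
  by exists N => n Nn; rewrite -lecR rnormC; exact: hN.
move=> h; apply/cvgrPdist_le => e e0.
have eE : e = (complex.Re e)%:C by rewrite RRe_real// gtr0_real.
have [|N hN] := h (complex.Re e); first by rewrite -ltcR -eE.
by exists N => // n Nn; rewrite eE -rnormC lecR; exact: hN.
Qed.

End Convergence.

Lemma cauchy_rnorm {R : realType} {H : completeNormedModType R[i]} (u : nat -> H) :
  (forall e : R, 0 < e -> exists N, forall m n, (N <= m)%N -> (N <= n)%N -> rnorm (u m - u n) <= e) ->
  exists l : H, u @ \oo --> l.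
Proof.
move=> h; apply/cvg_ex; apply/cauchy_cvgP; apply: cauchy_exP => e e0.
have eE : e = (complex.Re e)%:C by rewrite RRe_real// gtr0_real.
have e0' : 0 < complex.Re e by rewrite -ltcR -eE.
have [N hN] := h _ (divr_gt0 e0' (ltr0n _ 2)).
exists (u N); exists N => // n Nn; rewrite /= -ball_normE /=.
rewrite -rnormC eE ltcR (le_lt_trans (hN _ _ _ Nn))//.
by rewrite gtr_pMr// invf_lt1// ltr1n.
Qed.

Section AdjointLimit.
Context {R : realType} {H : completeNormedModType R[i]} (ip : {dot H for conjC}).
Hypothesis hip : is_inner_product ip.

(** Uniqueness of the representing vectors makes their choice linear. *)
Lemma adjoint_of_representation (T : bop H) :
  (forall x, exists y, forall z, ip (T z) x = ip z y) -> exists T', is_adjoint ip T T'.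
Proof.
move=> /choice[g hg].
have lg : linear g.
  move=> a u v; apply: (ip_inj hip) => z.
  rewrite ipC -hg [RHS]ipC ipDr ipZr ipDr ipZr !hg; by [].
have bg x : rnorm (g x) <= opnorm T * rnorm x.
  have [->|gx] := eqVneq (g x) 0; first by rewrite rnorm0 mulr_ge0 ?opnorm_ge0 ?rnorm_ge0.
  have gx0 : 0 < rnorm (g x) by rewrite rnorm_gt0.
  rewrite -(ler_pM2l gx0) -expr2 -[_ ^+ 2]ger0_norm ?exprn_ge0 ?rnorm_ge0//.
  rewrite -cabsR -(ip_self hip) -hg (le_trans (cauchy_schwarz hip _ _))//.
  by rewrite mulrA ler_wpM2r ?rnorm_ge0// mulrC rnorm_bop.
by exists (mkbop lg bg) => x y; rewrite hg.
Qed.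

(** Operator-norm limits of adjointable operators are adjointable, as
    [opnorm_adjoint] makes the adjoints a Cauchy sequence. *)
Lemma adjoint_limit (T : bop H) :
  (forall e : R, 0 < e -> exists2 S, opnorm (S - T) <= e & exists S', is_adjoint ip S S') ->
  exists T', is_adjoint ip T T'.
Proof.
move=> h.
have hn n : exists S : bop H * bop H, opnorm (S.1 - T) <= n.+1%:R^-1 /\ is_adjoint ip S.1 S.2.
  by have [|S hS [S' SS']] := h (n.+1%:R^-1); [rewrite invr_gt0 ltr0n|exists (S, S')].
have [S {}hn] := choice hn.
have small (e : R) : 0 < e -> exists N, forall n, (N <= n)%N -> opnorm ((S n).1 - T) <= e.
  move=> e0; exists (truncn e^-1) => n Nn; have [h1 _] := hn n; rewrite (le_trans h1)//.
  rewrite invf_ple ?posrE ?ltr0n// ltW// (lt_le_trans (truncnS_gt _))// ler_nat ltnS//.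
apply: adjoint_of_representation => x.
have [y hy] : exists y : H, (fun n : nat => (S n).2 x) @ \oo --> y.
  apply: cauchy_rnorm => e e0.
  have c0 : 0 < e / (2 * (rnorm x + 1)).
    by rewrite divr_gt0// mulr_gt0// ltr_wpDl ?rnorm_ge0.
  have [N hN] := small _ c0; exists N => m n Nm Nn.
  have -> : (S m).2 x - (S n).2 x = ((S m).2 - (S n).2) x by [].
  rewrite (le_trans (rnorm_bop _ _))//.
  have hS : is_adjoint ip ((S m).1 - (S n).1) ((S m).2 - (S n).2).
    by apply: adjointB; [case: (hn m)|case: (hn n)].
  rewrite -(opnorm_adjoint hip hS).
  have : opnorm ((S m).1 - (S n).1) <= e / (rnorm x + 1).
    rewrite -(subrKA T) -[T - _]opprB (le_trans (opnormD _ _))// opnormN.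
    have E : e / (2 * (rnorm x + 1)) = e / (rnorm x + 1) / 2.
      by field; rewrite gt_eqF// ltr_wpDl ?rnorm_ge0.
    by rewrite [leRHS]splitr -E lerD// hN.
  move=> h1; rewrite (@le_trans _ _ (e / (rnorm x + 1) * (rnorm x + 1)))//.
    by rewrite ler_pM ?opnorm_ge0 ?rnorm_ge0// lerDl.
  by rewrite divfK// gt_eqF// ltr_wpDl ?rnorm_ge0.
exists y => z; apply/eqP; rewrite -subr_eq0 -cabs_eq0 eq_le cabs_ge0 andbT.
apply/ler_addgt0Pr => e e0; rewrite add0r.
have c0 : 0 < e / (2 * (rnorm z * rnorm x + rnorm z + 1)).
  rewrite divr_gt0// mulr_gt0// ltr_wpDl// addr_ge0 ?mulr_ge0 ?rnorm_ge0//.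
have [N1 hN1] := small _ c0.
have /cvg_rnorm/(_ _ c0)[N2 hN2] := hy.
pose n := maxn N1 N2; have [_ hadj] := hn n.
have {}hN1 := hN1 n (leq_maxl _ _); have {}hN2 := hN2 n (leq_maxr _ _).
have -> : ip (T z) x - ip z y = - ip (((S n).1 - T) z) x - ip z (y - (S n).2 x).
  by rewrite ipBr bop_addE bop_oppE ipBl hadj; ring.
rewrite (le_trans (cabsD _ _))// !cabsN.
rewrite (le_trans (lerD (cauchy_schwarz hip _ _) (cauchy_schwarz hip _ _)))//.
set c := e / _ in c0 hN1 hN2.
have h1 : rnorm (((S n).1 - T) z) * rnorm x <= c * (rnorm z * rnorm x).
  rewrite mulrA ler_wpM2r ?rnorm_ge0// (le_trans (rnorm_bop _ _))// ler_wpM2r ?rnorm_ge0//.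
have h2 : rnorm z * rnorm (y - (S n).2 x) <= c * rnorm z.
  by rewrite mulrC ler_wpM2r ?rnorm_ge0.
rewrite (le_trans (lerD h1 h2))// -mulrDr.
have d0 : 0 < rnorm z * rnorm x + rnorm z + 1.
  by rewrite ltr_wpDl// addr_ge0 ?mulr_ge0 ?rnorm_ge0.
rewrite /c; set d := _ + 1 in d0 *.
rewrite (_ : rnorm z * rnorm x + rnorm z = d - 1); last by rewrite /d addrK.
rewrite mulrAC ler_pdivrMr ?mulr_gt0// ler_wpM2l ?(ltW e0)//; lra.
Qed.

End AdjointLimit.

Section PowerSeries.
Context {R : realType} {H : normedModType R[i]}.
Variables (f : R[i]^o -> bop H) (A : nat -> bop H).
Hypothesis f_expansion : forall z : R[i]^o, `|z| < 1 ->
  series (fun n => z ^+ n *: A n) @ \oo --> f z.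

Definition partial_sum N (z : R[i]) : bop H := \sum_(k < N) z ^+ k *: A k.

Lemma expansion_real z (e : R) : cabs z < 1 -> 0 < e ->
  exists N, forall n, (N <= n)%N -> opnorm (f z - partial_sum n z) <= e.
Proof.
move=> z1 e0; have := f_expansion (z := z); rewrite -cabsC (ltcR _ 1) => /(_ z1).
move=> /cvg_rnorm/(_ _ e0)[N hN]; exists N => n Nn.
by have := hN n Nn; rewrite /series /= big_mkord.
Qed.

(** The terms of a convergent series are bounded: those beyond some rank are
    differences of two partial sums close to the limit. *)
Lemma coefficient_growth (rho : R) : 0 < rho < 1 ->
  exists2 K, 0 <= K & forall k, opnorm (A k) * rho ^+ k <= K.
Proof.
move=> /andP[r0 r1]; have rE : cabs rho%:C = rho by rewrite cabsR gtr0_norm.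
have [|N hN] := @expansion_real rho%:C 1 _ ltr01; first by rewrite rE.
exists (2 + \sum_(k < N) opnorm (A k) * rho ^+ k).
  by rewrite addr_ge0// sumr_ge0// => k _; rewrite mulr_ge0 ?opnorm_ge0 ?exprn_ge0 ?ltW.
have pos (k : nat) : 0 <= opnorm (A k) * rho ^+ k.
  by rewrite mulr_ge0 ?opnorm_ge0 ?exprn_ge0 ?ltW.
move=> k; have [kN|Nk] := ltnP k N.
  rewrite (bigD1 (Ordinal kN))//= addrCA lerDl addr_ge0// sumr_ge0// => j _; exact: pos.
rewrite (@le_trans _ _ 2)//; last by rewrite lerDl sumr_ge0// => j _; exact: pos.
have -> : opnorm (A k) * rho ^+ k = opnorm (partial_sum k.+1 rho%:C - partial_sum k rho%:C).
  by rewrite /partial_sum big_ord_recr /= addrAC subrr add0r opnormZ cabsX rE mulrC.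
rewrite -[X in opnorm X](subrKA (f rho%:C)) (le_trans (opnormD _ _))//.
rewrite -opprB opnormN (_ : 2 = 1 + 1)// lerD// hN//.
by rewrite (leq_trans Nk).
Qed.

(** Cauchy's estimate for the remainder of the expansion. *)
Lemma expansion_tail (rho : R) : 0 < rho < 1 ->
  exists2 K, 0 <= K & forall N z, cabs z < rho ->
    opnorm (f z - partial_sum N z) <= K * (cabs z / rho) ^+ N / (1 - cabs z / rho).
Proof.
move=> hr; have [K K0 hK] := coefficient_growth hr; exists K => // N z zr.
have /andP[r0 r1] := hr.
set x := cabs z / rho; have x0 : 0 <= x by rewrite divr_ge0 ?cabs_ge0 ?ltW.
have x1 : x < 1 by rewrite ltr_pdivrMr// mul1r.
apply/ler_addgt0Pr => e e0.
have [|M hM] := @expansion_real z e _ e0; first exact: lt_trans zr r1.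
have NM : (N <= maxn N M)%N := leq_maxl _ _.
rewrite -[X in opnorm X](subrKA (partial_sum (maxn N M) z)) (le_trans (opnormD _ _))//.
rewrite addrC lerD//; last exact/hM/leq_maxr.
rewrite -(subnKC NM); move: (maxn N M - N)%N => m.
have -> : partial_sum (N + m) z - partial_sum N z = \sum_(j < m) z ^+ (N + j) *: A (N + j)%N.
  by rewrite /partial_sum big_split_ord /= addrAC subrr add0r.
rewrite (@le_trans _ _ (\sum_(j < m) K * x ^+ N * x ^+ j))//.
  rewrite opnormE (le_trans (rnorm_sum _ _ _))//; apply: ler_sum => j _.
  rewrite rnormZ cabsX -mulrA -exprD /x expr_div_n mulrCA ler_wpM2l ?exprn_ge0 ?cabs_ge0//.
  by rewrite ler_pdivlMr ?exprn_gt0//; exact: hK.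
by rewrite -mulr_sumr ler_wpM2l ?mulr_ge0 ?exprn_ge0// geometric_sum_le// x0.
Qed.

End PowerSeries.

Section NormalCoefficients.
Context {R : realType} {H : completeNormedModType R[i]} (ip : {dot H for conjC}).
Hypothesis hip : is_inner_product ip.
Variables (f : R[i]^o -> bop H) (A : nat -> bop H).
Hypothesis f_expansion : forall z : R[i]^o, `|z| < 1 ->
  series (fun n => z ^+ n *: A n) @ \oo --> f z.
Hypothesis f_normal : forall z : R[i]^o, `|z| < 1 -> normal_operator ip (f z).

Lemma normal_values z : cabs z < 1 ->
  exists2 B, is_adjoint ip (f z) B & f z * B = B * f z.
Proof.
move=> z1; have [|B hB BB] := f_normal (z := z).
  by rewrite -cabsC (ltcR _ 1).
by exists B => //; apply: bop_ext => x; exact: (congr1 (@^~ x) BB).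
Qed.

(** The tail estimate at [rho = 1 / 2]; it serves for comparing coefficients near
    [0], where only the order of the remainder matters. *)
Lemma expansion_near0 : exists2 K, 0 <= K & forall N z, cabs z <= 4^-1 ->
  opnorm (f z - partial_sum A N z) <= K * 2 ^+ N * cabs z ^+ N.
Proof.
have [|K K0 hK] := expansion_tail f_expansion (rho := 2^-1).
  by rewrite invr_gt0 ltr0n invf_lt1// ltr1n.
exists (K * 2); first by rewrite mulr_ge0.
move=> N z z4; have zh : cabs z < 2^-1 by lra.
rewrite (le_trans (hK N z zh))// invrK exprMn.
have h : (1 - cabs z * 2)^-1 <= 2.
  by rewrite invf_ple ?posrE//; lra.
have p0 : 0 <= K * (cabs z ^+ N * 2 ^+ N).
  by rewrite !mulr_ge0 ?exprn_ge0 ?cabs_ge0.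
rewrite (le_trans (ler_wpM2l p0 h))//; by rewrite le_eqVlt; apply/orP; left; apply/eqP; ring.
Qed.

(** [A n] is the limit of [z ^ -n (f(z) - sum_(k < n) A_k z ^ k)] as [z] tends to
    [0]. *)
Lemma coefficient_adjoint n : exists A', is_adjoint ip (A n) A'.
Proof.
elim/ltn_ind: n => n IH; apply: (adjoint_limit hip) => e e0.
have [K K0 hK] := expansion_near0.
pose t := Num.min 4^-1 (e / (K * 2 ^+ n.+1 + 1)).
have c0 : 0 < K * 2 ^+ n.+1 + 1 by rewrite ltr_wpDl// mulr_ge0// exprn_ge0.
have t0 : 0 < t by rewrite lt_min invr_gt0 ltr0n divr_gt0.
have t4 : t <= 4^-1 by rewrite ge_min lexx.
have te : t * (K * 2 ^+ n.+1 + 1) <= e by rewrite -ler_pdivlMr// ge_min lexx orbT.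
pose z : R[i] := t%:C; have zt : cabs z = t by rewrite cabsR gtr0_norm.
have z0 : z != 0 by rewrite -cabs_gt0 zt.
have zn0 : z ^+ n != 0 by rewrite expf_neq0.
exists (z ^- n *: (f z - partial_sum A n z)).
  have -> : z ^- n *: (f z - partial_sum A n z) - A n =
      z ^- n *: (f z - partial_sum A n.+1 z).
    rewrite /partial_sum big_ord_recr /= opprD addrA [in RHS]scalerBr scalerA.
    by rewrite mulVf// scale1r.
  rewrite opnormZ cabsV cabsX zt ler_pdivrMl ?exprn_gt0//.
  rewrite (le_trans (hK _ _ _)) ?zt//.
  have -> : K * 2 ^+ n.+1 * t ^+ n.+1 = t ^+ n * (t * (K * 2 ^+ n.+1)).
    by rewrite [t ^+ n.+1]exprSr; ring.
  rewrite ler_wpM2l ?exprn_ge0 ?(ltW t0)//.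
  by rewrite (le_trans _ te)// ler_wpM2l ?(ltW t0)// lerDl.
have [|B hB _] := normal_values (z := z); first by rewrite zt; lra.
have /choice[A' hA'] : forall k : 'I_n, exists A', is_adjoint ip (A k) A'.
  by move=> k; exact: IH.
exists (conjC (z ^- n) *: (B - \sum_(k < n) conjC (z ^+ k) *: A' k)).
apply: adjointZ; apply: adjointB => //; apply: adjoint_sum => k _; exact: adjointZ.
Qed.

(** Comparing the terms of lowest order in [z] and in the conjugate of [z] in
    [f(z)^* f(z) = f(z) f(z)^*]. *)
Lemma coefficients_doubly_commute (A' : nat -> bop H) :
  (forall n, is_adjoint ip (A n) (A' n)) -> forall n m, A' n * A m = A m * A' n.
Proof.
move=> hA; pose D n m := A' n * A m - A m * A' n.
suff D0 d : forall n m, (n + m = d)%N -> D n m = 0.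
  by move=> n m; apply/eqP; rewrite -subr_eq0 -/(D n m) (D0 (n + m)%N).
elim/ltn_ind: d => d IH.
have [K K0 hK] := expansion_near0.
pose Kd := K * 2 ^+ d.+1; have Kd0 : 0 <= Kd by rewrite mulr_ge0// exprn_ge0.
pose C1 := 2 * Kd * (K + (K + Kd)) + \sum_(p : 'I_d.+1 * 'I_d.+1) opnorm (D p.1 p.2).
have C10 : 0 <= C1.
  rewrite addr_ge0 ?mulr_ge0 ?addr_ge0// sumr_ge0// => p _; exact: opnorm_ge0.
have key (v : R[i]) (s : R) : cabs v = 1 -> 0 < s <= 4^-1 ->
    opnorm (\sum_(m < d.+1) v ^+ m *: D (d - m)%N m) <= C1 * s.
  move=> v1 /andP[s0 s4]; have s1 : s <= 1 by lra.
  (* For [z = s u], the monomial [conj z ^ (d - m) z ^ m] is a constant factor of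
     modulus [s ^ d] times [(u ^ 2) ^ m]. *)
  pose u := sqrtC v; have u2 : u ^+ 2 = v by rewrite sqrtCK.
  have u1 : cabs u = 1.
    by apply/eqP; rewrite -(@pexpr_eq1 _ _ 2) ?cabs_ge0// -cabsX u2 v1.
  have uu : conjC u * u = 1 by rewrite mulrC -normCK -cabsC u1 expr1n.
  pose z := s%:C * u; have zs : cabs z = s by rewrite cabsM u1 mulr1 cabsR gtr0_norm.
  have [|B hB BB] := normal_values (z := z); first by rewrite zs; lra.
  pose g := partial_sum A d.+1 z; pose g' := \sum_(k < d.+1) conjC (z ^+ k) *: A' k.
  have hg : is_adjoint ip g g' by apply: adjoint_sum => k _; exact: adjointZ.
  have fg : opnorm (f z - g) <= Kd * s ^+ d.+1 by rewrite -zs; apply: hK; rewrite zs.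
  have fg' : opnorm (B - g') <= Kd * s ^+ d.+1.
    by rewrite -(opnorm_adjoint hip (adjointB hB hg)).
  have nf : opnorm (f z) <= K.
    have := hK 0%N z; rewrite zs expr0 !mulr1 /partial_sum big_ord0 subr0; exact.
  have ng : opnorm g <= K + Kd.
    rewrite -(subrK (f z) g) addrC (le_trans (opnormD _ _))// lerD//.
    rewrite -opprB opnormN (le_trans fg)// ler_piMr// exprn_ile1// ltW//.
  have eta0 : 0 <= Kd * s ^+ d.+1 by rewrite mulr_ge0// exprn_ge0// ltW.
  have comm_g : opnorm (g' * g - g * g') <= 2 * Kd * (K + (K + Kd)) * s ^+ d.+1.
    have -> : g' * g - g * g' =
        ((f z - g) * B + g * (B - g')) - (B * (f z - g) + (B - g') * g).
      by rewrite !mulrBl !mulrBr !subrKA BB opprB [RHS]addrC subrKA.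
    rewrite (le_trans (opnormD _ _))// opnormN.
    have nB : opnorm B <= K by rewrite -(opnorm_adjoint hip hB).
    have ng' : opnorm g' <= K + Kd by rewrite -(opnorm_adjoint hip hg).
    have bnd (X Y : bop H) a b : opnorm X <= a -> opnorm Y <= b -> opnorm (X * Y) <= a * b.
      by move=> Xa Yb; rewrite (le_trans (opnormM _ _))// ler_pM ?opnorm_ge0.
    have e1 := bnd _ _ _ _ fg nB. have e2 := bnd _ _ _ _ ng fg'.
    have e3 := bnd _ _ _ _ nB fg. have e4 := bnd _ _ _ _ fg' ng.
    rewrite (le_trans (lerD (opnormD _ _) (opnormD _ _)))//.
    by rewrite (le_trans (lerD (lerD e1 e2) (lerD e3 e4)))// le_eqVlt; apply/orP; left; apply/eqP; ring.
  have ggE : g' * g - g * g' =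
      \sum_(p : 'I_d.+1 * 'I_d.+1) (conjC (z ^+ p.1) * z ^+ p.2) *: D p.1 p.2.
    rewrite -(pair_bigA _ (fun n m : 'I_d.+1 => (conjC (z ^+ n) * z ^+ m) *: D n m)) /=.
    rewrite /g /g' /partial_sum mulr_suml [X in _ - X]mulr_sumr -sumrB.
    apply: eq_bigr => n _; rewrite mulr_sumr mulr_suml -sumrB; apply: eq_bigr => m _.
    rewrite /D scalerBr -scalebopAl -scalebopAr scalerA; congr (_ - _).
    by rewrite -scalebopAl -scalebopAr scalerA mulrC.
  have zE (p : 'I_d.+1 * 'I_d.+1) : cabs (conjC (z ^+ p.1) * z ^+ p.2) = s ^+ (p.1 + p.2).
    by rewrite cabsM rmorphXn /= !cabsX /cabs norm_conjC -/(cabs z) zs exprD.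
  have sd0 : 0 < s ^+ d by rewrite exprn_gt0.
  rewrite -(ler_pM2l sd0) mulrCA -exprSr.
  have -> : s ^+ d * opnorm (\sum_(m < d.+1) v ^+ m *: D (d - m)%N m) =
      opnorm (\sum_(p : 'I_d.+1 * 'I_d.+1 | (p.1 + p.2 == d)%N)
        (conjC (z ^+ p.1) * z ^+ p.2) *: D p.1 p.2).
    rewrite (reindex (fun m : 'I_d.+1 => (rev_ord m, m))) /=; last first.
      exists snd => [m _ //|[n m]]; rewrite inE /= => /eqP nm.
      congr (_, _); apply: val_inj; rewrite /= subSS.
      exact: (canLR (addnK m) (esym nm)).
    rewrite [in RHS](eq_bigl predT) => [|m]; last first.
      by rewrite /= subSS subnK ?eqxx// -ltnS.
    rewrite -[s in s ^+ d](_ : cabs (s%:C * conjC u) = _); last first.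
      by rewrite cabsM cabsR gtr0_norm// /cabs norm_conjC -/(cabs u) u1 mulr1.
    rewrite -cabsX -opnormZ scaler_sumr; congr opnorm.
    apply: eq_bigr => m _.
    rewrite scalerA subSS; congr (_ *: _).
    have md : (m <= d)%N by rewrite -ltnS.
    have -> : (s%:C * conjC u) ^+ d = (s%:C * conjC u) ^+ (d - m) * (s%:C * conjC u) ^+ m.
      by rewrite -exprD subnK.
    rewrite -u2 /z !exprMn rmorphM /= !rmorphXn /= conjCR.
    have um : conjC u ^+ m * u ^+ m = 1 by rewrite -exprMn uu expr1n.
    transitivity (s%:C ^+ (d - m) * s%:C ^+ m * conjC u ^+ (d - m) * u ^+ m * (conjC u ^+ m * u ^+ m)).
      ring.
    by rewrite um; ring.
  have E := ggE; rewrite (bigID (fun p : 'I_d.+1 * 'I_d.+1 => p.1 + p.2 == d)%N) /= in E.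
  move/eqP: E; rewrite -subr_eq => /eqP <-.
  rewrite (le_trans (opnormD _ _))// opnormN mulrDl lerD//.
  rewrite opnormE (le_trans (rnorm_sum _ _ _))// mulr_suml.
  rewrite [leLHS]big_mkcond /=; apply: ler_sum => p _.
  have q0 : 0 <= opnorm (D p.1 p.2) * s ^+ d.+1.
    by rewrite mulr_ge0 ?opnorm_ge0 ?exprn_ge0// ltW.
  case: ifPn => // pd; have [lt|gt|E] := ltngtP (p.1 + p.2)%N d.
  - by rewrite (IH _ lt _ _ erefl) scaler0 rnorm0 opnorm0 mul0r.
  - rewrite rnormZ zE mulrC ler_wpM2l ?rnorm_ge0// ler_wiXn2l// ltW//.
  - by rewrite E eqxx in pd.
move=> n m nm; apply/eqP; rewrite -rnorm_eq0 eq_le rnorm_ge0 andbT.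
have md : (m < d.+1)%N by rewrite -nm ltnS leq_addl.
have := @cauchy_estimate _ (bop H) d.+1 (fun m => D (d - m)%N m) 1 0 m ltr01 md.
have -> : (d - m)%N = n by exact: (canLR (addnK m) (esym nm)).
rewrite expr1n mulr1; apply => v v1.
apply/ler_addgt0Pr => e e0; rewrite add0r.
pose s := Num.min 4^-1 (e / (C1 + 1)).
have c0 : 0 < C1 + 1 by rewrite ltr_wpDl.
have s0 : 0 < s by rewrite lt_min invr_gt0 ltr0n divr_gt0.
have := key v s v1; rewrite s0 ge_min lexx => /(_ isT) /le_trans; apply.
rewrite (@le_trans _ _ ((C1 + 1) * s))//; first by rewrite ler_wpM2r ?lerDl// ltW.
by rewrite mulrC -ler_pdivlMr// ge_min lexx orbT.
Qed.

End NormalCoefficients.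

(** * Norms of the coefficients *)

Section CoefficientNorms.
Context {R : realType} {H : completeNormedModType R[i]} (ip : {dot H for conjC}).
Hypothesis hip : is_inner_product ip.
Variables (f : R[i]^o -> bop H) (A : nat -> bop H).
Hypothesis f_expansion : forall z : R[i]^o, `|z| < 1 ->
  series (fun n => z ^+ n *: A n) @ \oo --> f z.
Hypothesis f_normal : forall z : R[i]^o, `|z| < 1 -> normal_operator ip (f z).
Hypothesis f_expanding : forall z, cabs z < 1 -> forall x, rnorm x <= rnorm (f z x).
Variable (x0 : H).
Hypothesis x0_neq0 : x0 != 0.

(** At an approximate joint eigenvector [x], [f(s z) x] is close to [F(z) x]
    for the scalar polynomial [F] with coefficients [<A_m x, x> s ^ m], so that
    [F] is bounded below on the disc. *)
Lemma coefficient_norm_approx n (d : R) : 0 < d < 1 ->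
  n.+1%:R * ((opnorm (A n.+1) - d) * (1 - d) ^+ n.+1) <=
  2 * (ln (opnorm (A 0%N)) - ln (1 - d)) *
    \sum_(k < n.+1) k.+1%:R * opnorm (A (n - k)%N).
Proof.
move=> /andP[d0 d1].
have /choice[A' hA] := coefficient_adjoint hip f_expansion f_normal.
have A'A := coefficients_doubly_commute hip f_expansion f_normal hA.
have AA m k : GRing.comm (A m) (A k).
  by apply: (commuting_adjoints_commute hip (hA m) (hA k)); exact: esym (A'A _ _).
pose s := 1 - d; have s0 : 0 < s by rewrite subr_gt0.
have s1 : s <= 1 by rewrite gerBl ltW.
(* [rho] separates the radius [s] of the disc where [F] is studied from [1]. *)
pose rho := 1 - d / 2; have srho : s < rho by rewrite /s /rho; lra.
have [|K K0 hK] := expansion_tail f_expansion (rho := rho); first by rewrite /rho; lra.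
have rho0 : 0 < rho by rewrite /rho; lra.
pose x := s / rho; have xp : 0 <= x by rewrite divr_ge0 ?ltW.
have x1 : x < 1 by rewrite ltr_pdivrMr// mul1r.
have [N nN hN] : exists2 N, (n.+1 < N)%N & K * x ^+ N / (1 - x) <= d / 2.
  have : (fun N => K * x ^+ N / (1 - x)) @ \oo --> K * 0 / (1 - x).
    by apply: cvgMl; apply: cvgMr; apply: cvg_expr; rewrite ger0_norm.
  rewrite mulr0 mul0r => /cvgr_le /(_ (d / 2)) [|M _ hM]; first by rewrite divr_gt0.
  exists (maxn M n.+2); first by rewrite leq_max ltnSn orbT.
  by apply: hM; rewrite /= leq_maxl.
have NR : 0 < N%:R :> R by rewrite ltr0n (leq_ltn_trans _ nN).
pose e := d / (2 * N%:R); have e0 : 0 < e by rewrite divr_gt0// mulr_gt0.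
have ed : e <= d.
  rewrite ler_pdivrMr ?mulr_gt0// ler_peMr ?(ltW d0)// -[leLHS]mulr1.
  by rewrite ler_pM ?ler1n// (leq_trans _ nN).
have [v [v1 hv hvn]] := joint_approx_eigvec hip x0_neq0 hA AA (fun m k => esym (A'A k m)) n.+1 N e0.
pose a m := ip (A m v) v.
have aA m : cabs (a m) <= opnorm (A m).
  rewrite (le_trans (cauchy_schwarz hip _ _))// v1 mulr1.
  by rewrite (le_trans (rnorm_bop _ _))// v1 mulr1.
pose F := \poly_(m < N) (a m * s%:C ^+ m).
have coefF m : (m < N)%N -> F`_m = a m * s%:C ^+ m by rewrite coef_poly => ->.
have sC : cabs s%:C = s by rewrite cabsR gtr0_norm.
have lower z : cabs z <= 1 -> s <= cabs F.[z].
  move=> z1; pose w := s%:C * z.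
  have ws : cabs w <= s by rewrite cabsM sC ler_piMr// ltW.
  have w1 : cabs w < 1 by rewrite (le_lt_trans ws)// /s; lra.
  have FE : F.[z] *: v = \sum_(m < N) w ^+ m *: (a m *: v).
    rewrite horner_poly scaler_suml; apply: eq_bigr => m _.
    by rewrite scalerA exprMn; congr (_ *: _); ring.
  have h1 : rnorm (f w v - partial_sum A N w v) <= d / 2.
    have -> : f w v - partial_sum A N w v = (f w - partial_sum A N w) v by [].
    rewrite (le_trans (rnorm_bop _ _))// v1 mulr1 (le_trans (hK _ _ (le_lt_trans ws srho)))//.
    rewrite (le_trans _ hN)// -!mulrA ler_wpM2l//.
    have wx : cabs w / rho <= x by rewrite ler_pM2r ?invr_gt0.
    apply: ler_pM.
    - by rewrite exprn_ge0// divr_ge0 ?cabs_ge0 ?ltW.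
    - by rewrite invr_ge0 subr_ge0 (le_trans wx)// ltW.
    - by rewrite lerXn2r// nnegrE divr_ge0 ?cabs_ge0 ?ltW.
    - by rewrite lef_pV2 ?posrE ?subr_gt0 ?(le_lt_trans wx)// lerD2l lerN2.
  have h2 : rnorm (partial_sum A N w v - F.[z] *: v) <= d / 2.
    rewrite FE /partial_sum bop_sumE -sumrB (le_trans (rnorm_sum _ _ _))//.
    rewrite (@le_trans _ _ (\sum_(m < N) e))//.
      apply: ler_sum => m _; rewrite bop_scaleE -scalerBr rnormZ.
      rewrite (le_trans _ (hv m (ltn_ord m)))// ler_piMl ?rnorm_ge0//.
      by rewrite cabsX exprn_ile1 ?cabs_ge0// ltW.
    rewrite sumr_const card_ord -[e *+ N]mulr_natr /e invfM mulrA divfK//.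
    by rewrite gt_eqF.
  have h3 := f_expanding w1 v; rewrite v1 in h3.
  have h4 : rnorm (F.[z] *: v) = cabs F.[z] by rewrite rnormZ v1 mulr1.
  have := rnormB (f w v) (F.[z] *: v); rewrite h4.
  have := rnormD (f w v - partial_sum A N w v) (partial_sum A N w v - F.[z] *: v).
  rewrite subrKA /s; lra.
have [q [qF hq]] := zero_free_coefficients s0 lower.
have F0 : 0 < cabs F`_0 by rewrite -horner_coef0 (lt_le_trans s0)// lower// cabs0.
have F0A : cabs F`_0 <= opnorm (A 0%N).
  by rewrite coefF ?(leq_ltn_trans _ nN)// expr0 mulr1 aA.
have lnF : ln (cabs F`_0) <= ln (opnorm (A 0%N)).
  by rewrite ler_ln ?posrE// (lt_le_trans F0).
rewrite -/s (@le_trans _ _ (cabs (n.+1%:R * F`_n.+1)))//.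
  rewrite cabsM cabs_nat coefF// cabsM cabsX sC ler_wpM2l// ler_wpM2r ?exprn_ge0 ?(ltW s0)//.
  by rewrite (le_trans _ hvn)// lerD2l lerN2.
rewrite qF (le_trans (cabs_sum _ _ _))// mulr_sumr; apply: ler_sum => k _.
rewrite cabsM coefF; last by rewrite (leq_ltn_trans (leq_subr _ _))// ltnW.
rewrite [leRHS]mulrA ler_pM ?cabs_ge0//.
  rewrite (le_trans (hq k))// mulrAC ler_wpM2r// ler_wpM2l//.
  by rewrite lerD2r.
rewrite cabsM cabsX sC (le_trans _ (aA _))// ler_piMr ?cabs_ge0//.
by rewrite exprn_ile1// ltW.
Qed.

(** Let [d] tend to [0] in the previous estimate. *)
Lemma coefficient_norm_recursion n :
  n.+1%:R * opnorm (A n.+1) <=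
  2 * ln (opnorm (A 0%N)) * \sum_(k < n.+1) k.+1%:R * opnorm (A (n - k)%N).
Proof.
set W := \sum_(k < n.+1) _; set a := opnorm (A n.+1); set L := ln _.
have id0 : (fun d : R => d) @ 0^'+ --> (0 : R) by exact: cvg_at_right_filter.
have h1 : (fun d : R => n.+1%:R * ((a - d) * (1 - d) ^+ n.+1)) @ 0^'+ -->
    n.+1%:R * ((a - 0) * (1 - 0) ^+ n.+1).
  apply: cvgMr; apply: cvgM; first by apply: cvgB => //; exact: cvg_cst.
  apply: (@cvg_comp _ _ _ (fun d : R => 1 - d) (fun y => y ^+ n.+1) _ (nbhs (1 - 0 : R))).
    by apply: cvgB => //; exact: cvg_cst.
  exact: exprn_continuous.
have h2 : (fun d : R => 2 * (L - ln (1 - d)) * W) @ 0^'+ --> 2 * (L - ln (1 - 0)) * W.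
  apply: cvgMl; apply: cvgMr; apply: cvgB; first exact: cvg_cst.
  apply: (@cvg_comp _ _ _ (fun d : R => 1 - d) (@ln R) _ (nbhs (1 - 0 : R))).
    by apply: cvgB => //; exact: cvg_cst.
  by apply: continuous_ln; rewrite subr0.
rewrite !subr0 expr1n mulr1 ln1 subr0 in h1 h2.
apply: (ler_cvg_to h1 h2); near=> d; apply: coefficient_norm_approx.
apply/andP; split; near: d; [exact: nbhs_right_gt|exact: nbhs_right_lt].
Unshelve. all: by end_near. Qed.

End CoefficientNorms.

Section MajorantSum.
Context {R : realType}.

Lemma ler_horner (p q : {poly R}) t : 0 <= t -> (forall i, p`_i <= q`_i) -> p.[t] <= q.[t].
Proof.
move=> t0 pq; pose n := maxn (size p) (size q).
rewrite (@horner_coef_wide _ n p) ?leq_maxl// (@horner_coef_wide _ n q) ?leq_maxr//.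
by apply: ler_sum => i _; rewrite ler_wpM2r ?exprn_ge0.
Qed.

Lemma sum_natmul_expr_le N (t : R) : 0 <= t < 1 ->
  \sum_(k < N) k.+1%:R * t ^+ k <= (1 - t) ^- 2.
Proof.
move=> /andP[t0 t1].
have E : (1 - t) ^+ 2 * \sum_(k < N) k.+1%:R * t ^+ k =
    1 - N.+1%:R * t ^+ N + N%:R * t ^+ N.+1.
  elim: N => [|N IH]; first by rewrite big_ord0 expr0; ring.
  by rewrite big_ord_recr/= mulrDr IH !exprS -!natr1; ring.
rewrite -[leRHS]mul1r ler_pdivlMr ?exprn_gt0 ?subr_gt0// mulrC E.
rewrite -addrA gerDl addrC subr_le0 exprS mulrA ler_wpM2r ?exprn_ge0//.
rewrite (@le_trans _ _ N%:R)// ?ler_nat//.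
by rewrite ler_piMr// ltW.
Qed.

(** The recursion bounds the logarithmic derivative of the partial sums by that
    of [exp (2 L t / (1 - t))], which takes the value [exp L] at [t = 1 / 3]. *)
Lemma majorant_sum (a : nat -> R) (L : R) : (forall n, 0 <= a n) -> 0 <= L ->
  (forall n, n.+1%:R * a n.+1 <= 2 * L * \sum_(k < n.+1) k.+1%:R * a (n - k)%N) ->
  forall N, \sum_(n < N) a n * 3^-1 ^+ n <= a 0%N * expR L.
Proof.
move=> a0 L0 ha [|N]; first by rewrite big_ord0 mulr_ge0 ?expR_ge0.
pose p := \poly_(n < N.+1) a n; pose c : {poly R} := \poly_(k < N.+1) k.+1%:R.
have p0 i : 0 <= p`_i by rewrite coef_poly; case: ifP.
have dp i : p^`()`_i <= ((2 * L) *: (c * p))`_i.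
  have pos : 0 <= ((2 * L) *: (c * p))`_i.
    rewrite coefZ mulr_ge0 ?mulr_ge0// coefM sumr_ge0// => j _.
    by rewrite mulr_ge0// coef_poly; case: ifP.
  have [iN|Ni] := ltnP i.+1 N.+1; last first.
    by rewrite coef_deriv coef_poly ltnNge Ni /= mul0rn.
  rewrite coef_deriv coef_poly iN -[leLHS]mulr_natl (le_trans (ha i))//.
  rewrite coefZ coefM ler_wpM2l ?mulr_ge0//; apply: ler_sum => k _.
  rewrite !coef_poly (leq_ltn_trans (leq_subr _ _)) ?(ltnW iN)//.
  by rewrite (leq_trans (ltn_ord k))// ltnW.
have pt0 (t : R) : 0 <= t -> 0 <= p.[t].
  by move=> t0; rewrite -(horner0 t); apply: ler_horner => // i; rewrite coef0.
have hp (t : R) : 0 <= t < 1 -> p^`().[t] <= 2 * L * (1 - t) ^- 2 * p.[t].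
  move=> /andP[t0 t1]; rewrite (le_trans (ler_horner t0 dp))//.
  rewrite hornerZ hornerM -mulrA ler_wpM2l ?mulr_ge0// ler_wpM2r ?pt0//.
  by rewrite horner_poly sum_natmul_expr_le// t0.
(* [- g] is the logarithm [2 L t / (1 - t)] of the comparison function. *)
pose g (t : R) := 2 * L * (1 - (1 - t)^-1).
pose F (t : R) := p.[t] * expR (g t).
have dF (t : R) : t < 1 -> is_derive t 1 F
    ((p^`().[t] - 2 * L * (1 - t) ^- 2 * p.[t]) * expR (g t)).
  move=> t1; have t1' : 1 - t != 0 by rewrite subr_eq0 gt_eqF.
  have d1 : is_derive t 1 (fun t : R => 1 - t) (-1).
    by apply: (trigger_derive (is_deriveB (is_derive_cst _ _ _) (is_derive_id _ _))); rewrite sub0r.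
  have d2 := @is_deriveV R (fun t : R => 1 - t) t (-1) 1 t1' d1.
  have d3 : is_derive t 1 g (- (2 * L * (1 - t) ^- 2)).
    have d := is_deriveZ (2 * L) (is_deriveB (is_derive_cst (1 : R) t 1) d2).
    apply: (trigger_derive d); rewrite /= /GRing.scale /=; by field.
  have d4 := is_derive1_comp (is_derive_expR (g t)) d3.
  have d5 := is_deriveM (is_derive_poly p t) d4.
  apply: (trigger_derive d5); rewrite /= /GRing.scale /=; ring.
have F31 : F 3^-1 <= F 0.
  have lt31 : 3^-1 < 1 :> R by rewrite invf_lt1// ltr1n.
  apply: (@ler0_derive1_le_cc R F 0 3^-1).
  - move=> t /itvP t01; have [] := dF t _; last by [].
    by rewrite (lt_trans _ lt31)// t01.
  - move=> t /itvP t01.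
    have t1 : t < 1 by rewrite (lt_trans _ lt31)// t01.
    rewrite derive1E; have [_ ->] := dF t t1.
    rewrite mulr_le0_ge0 ?expR_ge0// subr_le0 hp// t1 t01//.
  - apply: derivable_within_continuous => t /itvP t01.
    by have [] := dF t _; rewrite // (le_lt_trans _ lt31)// t01.
  - by rewrite in_itv/= ?lexx ?andbT ?invr_ge0 ?ler0n.
  - by rewrite in_itv/= ?lexx ?andbT ?invr_ge0 ?ler0n.
  - by rewrite invr_ge0.
have -> : \sum_(n < N.+1) a n * 3^-1 ^+ n = p.[3^-1] by rewrite horner_poly.
have -> : a 0%N = p.[0] by rewrite horner_coef0 coef_poly.
have g3 : g 3^-1 = - L by rewrite /g; field.
have g0 : g 0 = 0 by rewrite /g subr0 invr1 subrr mulr0.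
move: F31; rewrite /F g3 g0 expR0 mulr1 expRN.
by rewrite ler_pdivrMr ?expR_gt0.
Qed.

End MajorantSum.

(** * Neumann series *)

Section NeumannSeries.
Context {R : realType} {H : completeNormedModType R[i]}.

(** The Neumann series is summed vector by vector, in the complete space [H]. *)
Lemma neumann_inverse (D : bop H) (mu : R[i]) : opnorm D < cabs mu ->
  exists B : bop H, [/\ (forall x, B (mu *: x - D x) = x),
    (forall x, mu *: B x - D (B x) = x) & opnorm B <= (cabs mu - opnorm D)^-1].
Proof.
move=> Dmu; have mu0 : 0 < cabs mu by rewrite (le_lt_trans _ Dmu) ?opnorm_ge0.
have mun0 : mu != 0 by rewrite -cabs_gt0.
have d0 : 0 < cabs mu - opnorm D by rewrite subr_gt0.
pose E : bop H := mu^-1 *: D; pose k := opnorm D / cabs mu.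
have Ek : opnorm E = k by rewrite opnormZ cabsV mulrC.
have k0 : 0 <= k by rewrite divr_ge0 ?opnorm_ge0// ltW.
have k1 : k < 1 by rewrite ltr_pdivrMr// mul1r.
have lower x : (cabs mu - opnorm D) * rnorm x <= rnorm (mu *: x - D x).
  rewrite mulrBl (le_trans _ (rnormB _ _))// rnormZ lerD2l lerN2.
  exact: rnorm_bop.
have surj y : exists x, mu *: x - D x = y.
  pose u n : H := (\sum_(i < n) E ^+ i) (mu^-1 *: y).
  pose w := mu^-1 *: y.
  have [x hx] : exists x : H, u @ \oo --> x.
    apply: cauchy_rnorm => e e0.
    have : (fun n => k ^+ n * ((1 - k)^-1 * rnorm w)) @ \oo --> 0 * ((1 - k)^-1 * rnorm w).
      by apply: cvgMl; apply: cvg_expr; rewrite ger0_norm.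
    rewrite mul0r => /cvgr_le /(_ e e0)[N _ hN]; exists N.
    have main m n : (N <= n)%N -> (n <= m)%N -> rnorm (u m - u n) <= e.
      move=> Nn nm; rewrite -(subnKC nm) /u -/w big_split_ord bop_addE addrAC subrr add0r.
      rewrite (le_trans _ (hN n Nn))// (le_trans (rnorm_bop _ _))// mulrA.
      rewrite ler_wpM2r ?rnorm_ge0// opnormE (le_trans (rnorm_sum _ _ _))//.
      have h1 := @geometric_sum_le _ k (m - n); rewrite k0 k1 in h1.
      apply: le_trans (ler_wpM2l (exprn_ge0 n k0) (h1 isT)); rewrite mulr_sumr.
      apply: ler_sum => i _; rewrite -exprD -Ek; exact: opnormX_le.
    move=> m n Nm Nn; have [nm|/ltnW mn] := leqP n m; first exact: main.
    by rewrite rnorm_distC main.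
  exists x; apply/eqP; rewrite -subr_eq0 -rnorm_eq0 eq_le rnorm_ge0 andbT.
  apply/ler_addgt0Pr => e e0; rewrite add0r.
  pose c := cabs mu + opnorm D + 1.
  have c0 : 0 < c by rewrite ltr_wpDl// addr_ge0 ?cabs_ge0 ?opnorm_ge0.
  have [N1 hN1] := (cvg_rnorm u x).1 hx _ (divr_gt0 e0 (mulr_gt0 (ltr0n _ 2) c0)).
  have : (fun n => k ^+ n * (cabs mu * rnorm w)) @ \oo --> 0 * (cabs mu * rnorm w).
    by apply: cvgMl; apply: cvg_expr; rewrite ger0_norm.
  rewrite mul0r => /cvgr_le /(_ _ (divr_gt0 e0 (ltr0n _ 2)))[N2 _ hN2].
  pose n := maxn N1 N2; have {}hN1 := hN1 n (leq_maxl _ _).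
  have {}hN2 := hN2 n (leq_maxr _ _); rewrite /= in hN2.
  have uE : mu *: u n - D (u n) - y = - (mu *: (E ^+ n) w).
    have -> : D (u n) = mu *: (E (u n)) by rewrite /E bop_scaleE scalerA mulfV// scale1r.
    have yE : y = mu *: w by rewrite scalerA mulfV// scale1r.
    rewrite [X in _ - X = _]yE.
    rewrite -!scalerBr -[RHS]scalerN; congr (_ *: _).
    rewrite /u -/w -[E _]/((E * \sum_(i < n) E ^+ i) w) -[X in X - _ - _]/((1 * \sum_(i < n) E ^+ i) w).
    rewrite -[_ w - _ w]/((1 * _ - E * _) w) -mulrBl.
    have -> : (1 - E) * \sum_(i < n) E ^+ i = 1 - E ^+ n.
      by rewrite -opprB mulNr -subrX1 opprB.
    by rewrite bop_addE bop_oneE bop_oppE addrAC subrr add0r.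
  have -> : mu *: x - D x - y =
      (mu *: (x - u n) - D (x - u n)) + (mu *: u n - D (u n) - y).
    rewrite bopB scalerBr [RHS]addrA [in RHS]addrACA subrK opprB.
    by rewrite addrAC [D _ - _ - D _]addrAC subrr sub0r addrAC.
  rewrite (le_trans (rnormD _ _))// uE rnormN rnormZ.
  have h1 : rnorm (mu *: (x - u n) - D (x - u n)) <= e / 2.
    rewrite (le_trans (rnormD _ _))// rnormN rnormZ.
    rewrite (le_trans (lerD (lexx _) (rnorm_bop _ _)))// -mulrDl.
    rewrite (@le_trans _ _ (c * (e / (2 * c))))//.
      by rewrite ler_pM ?rnorm_ge0 ?addr_ge0 ?cabs_ge0 ?opnorm_ge0// /c lerDl.
    by rewrite invfM mulrCA [c * _]mulrC mulfVK ?gt_eqF.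
  have h2 : cabs mu * rnorm ((E ^+ n) w) <= e / 2.
    rewrite (le_trans _ hN2)// mulrCA ler_wpM2l ?cabs_ge0//.
    rewrite (le_trans (rnorm_bop _ _))// ler_wpM2r ?rnorm_ge0// -Ek.
    exact: opnormX_le.
  lra.
have [g hg] := choice surj.
have inj x x' : mu *: x - D x = mu *: x' - D x' -> x = x'.
  move=> h; apply/eqP; rewrite -subr_eq0 -rnorm_eq0 eq_le rnorm_ge0 andbT.
  rewrite -(ler_pM2l d0) mulr0 (le_trans (lower _))// bopB scalerBr.
  by rewrite opprD opprK addrACA h -[X in _ + X]opprK opprD opprK subrr rnorm0.
have lg : linear g.
  move=> a x y; apply: inj; rewrite hg bopD bopZ scalerDr opprD addrACA hg.
  by rewrite scalerA mulrC -scalerA -scalerBr hg.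
have bg x : rnorm (g x) <= (cabs mu - opnorm D)^-1 * rnorm x.
  by rewrite ler_pdivlMl// -{2}(hg x) lower.
exists (mkbop lg bg); split => [x|x|]; [exact: inj (hg _)|exact: hg|].
by apply: opnorm_least_real => // ; rewrite invr_ge0 ltW.
Qed.

End NeumannSeries.

(** * Means over the unit interval and circle integrals *)

Section Mean.
Context {R : realType}.
Implicit Types (h g : R -> R) (u v : R -> R[i]).

Definition mean h : R := \int[lebesgue_measure]_(t in `[0%R, 1%R]) h t.

Lemma integrable_continuous h : continuous h ->
  lebesgue_measure.-integrable `[0%R, 1%R] (EFin \o h).
Proof.
move=> ch; apply: continuous_compact_integrable; first exact: segment_compact.
exact: continuous_subspaceT.
Qed.

Lemma meanD h g : continuous h -> continuous g ->
  mean (fun t => h t + g t) = mean h + mean g.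
Proof. by move=> ch cg; rewrite /mean RintegralD//; exact: integrable_continuous. Qed.

Lemma meanB h g : continuous h -> continuous g ->
  mean (fun t => h t - g t) = mean h - mean g.
Proof. by move=> ch cg; rewrite /mean RintegralB//; exact: integrable_continuous. Qed.

Lemma meanZ c h : continuous h -> mean (fun t => c * h t) = c * mean h.
Proof. by move=> ch; rewrite /mean RintegralZl//; exact: integrable_continuous. Qed.

Lemma mean_cst c : mean (fun=> c) = c.
Proof.
have m1 : lebesgue_measure (`[0%R, 1%R]%classic : set R) = 1%:E.
  by rewrite lebesgue_measure_itv/= lte_fin ltr01 sube0.
transitivity (c * fine (lebesgue_measure (`[0%R, 1%R]%classic : set R))).
  exact: Rintegral_cst.
by rewrite m1 mulr1.
Qed.

Lemma ler_mean h g : continuous h -> continuous g -> (forall t, h t <= g t) ->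
  mean h <= mean g.
Proof. by move=> ch cg hg; apply: le_Rintegral => //; exact: integrable_continuous. Qed.

Lemma mean_dist h g e : continuous h -> continuous g ->
  (forall t, `|h t - g t| <= e) -> `|mean h - mean g| <= e.
Proof.
move=> ch cg hg; rewrite -meanB//.
have cB : continuous (fun t => h t - g t).
  by move=> t; apply: cvgB; [exact: ch|exact: cg].
rewrite ler_norml; apply/andP; split.
  rewrite -[leLHS](mean_cst (- e)); apply: ler_mean => //.
    by move=> t; exact: cvg_cst.
  by move=> t; have := hg t; rewrite ler_norml => /andP[].
rewrite -[leRHS](mean_cst e); apply: ler_mean => //.
  by move=> t; exact: cvg_cst.
by move=> t; have := hg t; rewrite ler_norml => /andP[].
Qed.

Lemma mean_unif_limit h m :
  continuous h -> (forall e, 0 < e -> exists g, [/\ continuous g,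
    forall t, `|h t - g t| <= e & mean g = m]) -> mean h = m.
Proof.
move=> ch hl; apply/eqP; rewrite -subr_eq0 -normr_eq0 eq_le normr_ge0 andbT.
apply/ler_addgt0Pr => e e0; rewrite add0r.
by have [g [cg hg <-]] := hl e e0; exact: mean_dist.
Qed.

Lemma mean_derivative (F f : R -> R) : (forall t : R, is_derive t 1 F (f t)) ->
  continuous f -> mean f = F 1 - F 0.
Proof.
move=> Ff cf; rewrite /mean /Rintegral (@continuous_FTC2 _ f F)//.
- exact: continuous_subspaceT.
- have cF : continuous F.
    move=> t; apply: differentiable_continuous; apply/derivable1_diffP.
    by have [] := Ff t.
  split; first by move=> t _; have [] := Ff t.
  + exact/cvg_at_right_filter/cF.
  + exact/cvg_at_left_filter/cF.
- by move=> t _; rewrite derive1E; have [_ ->] := Ff t.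
Qed.

Lemma continuous_scale2 (f : R -> R) (c : R) : continuous f -> continuous (fun t => f (c * t)).
Proof.
move=> cf t; apply: (@cvg_comp _ _ _ (fun t => c * t) f _ (nbhs (c * t))); last exact: cf.
by apply: cvgM; [exact: cvg_cst|exact: cvg_id].
Qed.

Lemma is_derive_scale (f : R -> R) (c d t : R) : is_derive (c * t) 1 f d ->
  is_derive t 1 (fun t => f (c * t)) (c * d).
Proof.
move=> fd; have l : is_derive t 1 (fun t : R => c * t) c.
  by apply: (trigger_derive (is_deriveZ c (is_derive_id t 1))); rewrite /GRing.scale /= mulr1.
by apply: (trigger_derive (is_derive1_comp fd l)); rewrite mulrC.
Qed.

(** Stated by components, the form in which complex path integrals are defined. *)
Definition ccontinuous u : Prop :=
  continuous (fun t => complex.Re (u t)) /\ continuous (fun t => complex.Im (u t)).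

Lemma ccontinuousD u v : ccontinuous u -> ccontinuous v -> ccontinuous (fun t => u t + v t).
Proof.
move=> [ur ui] [vr vi]; split.
  rewrite (_ : (fun t => _) = (fun t => complex.Re (u t) + complex.Re (v t))).
    by move=> t; apply: cvgD; [exact: ur|exact: vr].
  by apply/funext => t; rewrite Re_add.
rewrite (_ : (fun t => _) = (fun t => complex.Im (u t) + complex.Im (v t))).
  by move=> t; apply: cvgD; [exact: ui|exact: vi].
by apply/funext => t; rewrite Im_add.
Qed.

Lemma ccontinuousM u v : ccontinuous u -> ccontinuous v -> ccontinuous (fun t => u t * v t).
Proof.
move=> [ur ui] [vr vi]; split.
  rewrite (_ : (fun t => _) = (fun t => complex.Re (u t) * complex.Re (v t) -
    complex.Im (u t) * complex.Im (v t))).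
    by move=> t; apply: cvgB; apply: cvgM; [exact: ur|exact: vr|exact: ui|exact: vi].
  by apply/funext => t; rewrite Re_mul.
rewrite (_ : (fun t => _) = (fun t => complex.Re (u t) * complex.Im (v t) +
  complex.Im (u t) * complex.Re (v t))).
  by move=> t; apply: cvgD; apply: cvgM; [exact: ur|exact: vi|exact: ui|exact: vr].
by apply/funext => t; rewrite Im_mul.
Qed.

Lemma ccontinuous_cst c : ccontinuous (fun=> c).
Proof. by split => t; exact: cvg_cst. Qed.

(** Inverses and resolvents along a path are Lipschitz functions of its points. *)
Lemma ccontinuous_lipschitz u v K : ccontinuous u ->
  (forall s t, cabs (v s - v t) <= K * cabs (u s - u t)) -> ccontinuous v.
Proof.
move=> [ur ui] uv.
have close t e : 0 < e -> \forall s \near t, cabs (v t - v s) <= e.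
  move=> e0; pose d := e / (2 * (`|K| + 1)).
  have k0 : 0 < 2 * (`|K| + 1) by rewrite mulr_gt0// ltr_wpDl.
  have d0 : 0 < d by rewrite divr_gt0.
  have d20 : 0 <= 2 * d by rewrite mulr_ge0// ltW.
  have /cvgrPdist_le /(_ _ d0) h1 := ur t; have /cvgrPdist_le /(_ _ d0) h2 := ui t.
  near=> s; rewrite (le_trans (uv t s))//.
  have hs : cabs (u t - u s) <= 2 * d.
    rewrite -ler_sqr ?nnegrE ?cabs_ge0 ?d20// cabs_sqr.
    have a1 : complex.Re (u t - u s) ^+ 2 <= d ^+ 2.
      rewrite -real_normK ?num_real// ler_sqr ?nnegrE ?(ltW d0)// Re_sub.
      by near: s.
    have a2 : complex.Im (u t - u s) ^+ 2 <= d ^+ 2.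
      rewrite -real_normK ?num_real// ler_sqr ?nnegrE ?(ltW d0)//.
      by rewrite Im_sub; near: s.
    have -> : (2 * d) ^+ 2 = d ^+ 2 + d ^+ 2 + (d ^+ 2 + d ^+ 2) by ring.
    by rewrite (le_trans (lerD a1 a2))// lerDl addr_ge0 ?sqr_ge0.
  rewrite (@le_trans _ _ ((`|K| + 1) * (2 * d)))//.
    rewrite (le_trans (ler_norm _))// normrM (ger0_norm (cabs_ge0 _)).
    by rewrite ler_pM ?cabs_ge0// lerDl.
  suff -> : (`|K| + 1) * (2 * d) = e by [].
  have K1 : `|K| + 1 != 0 by rewrite gt_eqF// ltr_wpDl.
  by rewrite /d; field.
split => t; apply/cvgrPdist_le => e e0.
  near=> s; rewrite -Re_sub (le_trans (ler_cabs_Re _))//; near: s; exact: close.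
near=> s; rewrite -Im_sub (le_trans (ler_cabs_Im _))//; near: s; exact: close.
Unshelve. all: by end_near. Qed.

Lemma ccontinuousX u n : ccontinuous u -> ccontinuous (fun t => u t ^+ n).
Proof.
move=> cu; elim: n => [|n IH]; first exact: ccontinuous_cst.
by under eq_fun do rewrite exprS; exact: ccontinuousM.
Qed.

Lemma ccontinuous_sum n (F : 'I_n -> R -> R[i]) : (forall k, ccontinuous (F k)) ->
  ccontinuous (fun t => \sum_(k < n) F k t).
Proof.
move=> cF; elim: n F cF => [|n IH] F cF.
  by under eq_fun do rewrite big_ord0; exact: ccontinuous_cst.
by under eq_fun do rewrite big_ord_recr /=; apply: ccontinuousD => //; exact: IH.
Qed.

Definition cmean u : R[i] :=
  mean (fun t => complex.Re (u t)) +i* mean (fun t => complex.Im (u t)).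

Lemma cmeanD u v : ccontinuous u -> ccontinuous v ->
  cmean (fun t => u t + v t) = cmean u + cmean v.
Proof.
move=> [ur ui] [vr vi]; rewrite -[RHS]/((_ + _) +i* (_ + _)) -!meanD//.
congr (mean _ +i* mean _); apply/funext => t; first by rewrite Re_add.
by rewrite Im_add.
Qed.

Lemma cmeanZ c u : ccontinuous u -> cmean (fun t => c * u t) = c * cmean u.
Proof.
have cZ (a : R) h : continuous h -> continuous (fun t => a * h t).
  by move=> ch t; apply: cvgM; [exact: cvg_cst|exact: ch].
move=> [ur ui]; rewrite /cmean; case: c => a b.
rewrite -[RHS]/((a * _ - b * _) +i* (a * _ + b * _)) -!meanZ//.
rewrite -meanB -?meanD; [|exact: cZ..].
congr (mean _ +i* mean _); apply/funext => t; first by rewrite Re_mul.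
by rewrite Im_mul.
Qed.

Lemma cmean_cst c : cmean (fun=> c) = c.
Proof. by rewrite /cmean !mean_cst; case: c. Qed.

Lemma cmean_sum n (F : 'I_n -> R -> R[i]) : (forall k, ccontinuous (F k)) ->
  cmean (fun t => \sum_(k < n) F k t) = \sum_(k < n) cmean (F k).
Proof.
move=> cF; elim: n F cF => [|n IH] F cF.
  by rewrite big_ord0; under eq_fun do rewrite big_ord0; exact: cmean_cst.
under eq_fun do rewrite big_ord_recr /=; rewrite cmeanD//; last exact: ccontinuous_sum.
by rewrite big_ord_recr /= IH.
Qed.

(** Path integrals below are computed on truncated power series. *)
Lemma cmean_unif_limit u m :
  ccontinuous u -> (forall e, 0 < e -> exists v, [/\ ccontinuous v,
    forall t, cabs (u t - v t) <= e & cmean v = m]) -> cmean u = m.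
Proof.
move=> [ur ui] hl; case: m hl => a b hl; congr (_ +i* _); apply: mean_unif_limit => // e e0.
  have [v [[vr vi] huv [va vb]]] := hl e e0.
  exists (fun t => complex.Re (v t)); split => // t.
  by rewrite -Re_sub (le_trans (ler_cabs_Re _)).
have [v [[vr vi] huv [va vb]]] := hl e e0.
exists (fun t => complex.Im (v t)); split => // t.
by rewrite -Im_sub (le_trans (ler_cabs_Im _)).
Qed.

(** The parametrization [exp (2 pi i t)] of the unit circle. *)
Definition circ (t : R) : R[i] := cos (2 * pi * t) +i* sin (2 * pi * t).

Lemma circX k t : circ t ^+ k = cos (2 * pi * k%:R * t) +i* sin (2 * pi * k%:R * t).
Proof.
elim: k => [|k IH]; first by rewrite expr0 mulr0 mul0r cos0 sin0.
rewrite exprSr IH /circ; set a := _ * t; set b := _ * t.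
have -> : 2 * pi * k.+1%:R * t = a + b by rewrite -natr1 /a /b; ring.
by rewrite cosD sinD [sin a * _ + _]addrC.
Qed.

Lemma cabs_circ t : cabs (circ t) = 1.
Proof.
apply/eqP; rewrite -(@pexpr_eq1 _ _ 2) ?cabs_ge0// cabs_sqr /=.
by rewrite cos2Dsin2.
Qed.

Lemma circ_neq0 (t : R) : circ t != 0.
Proof. by rewrite -cabs_gt0 cabs_circ. Qed.

Lemma conj_circ (t : R) : conjC (circ t) = (circ t)^-1.
Proof.
apply: (mulfI (circ_neq0 t)); rewrite mulfV ?circ_neq0// -normCK -cabsC cabs_circ.
by rewrite expr1n.
Qed.

Lemma cos_2pi_nat k : cos (2 * pi * k%:R) = 1 :> R /\ sin (2 * pi * k%:R) = 0 :> R.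
Proof.
have h : circ 1 = 1.
  by rewrite /circ mulr1 mulr_natl cos2pi sin2pi.
by have := circX k 1; rewrite h expr1n mulr1 => -[<- <-].
Qed.

Lemma ccontinuous_circ : ccontinuous circ.
Proof.
by split; apply: continuous_scale2; [exact: continuous_cos|exact: continuous_sin].
Qed.

Lemma ccontinuous_conj_circ : ccontinuous (fun t : R => conjC (circ t)).
Proof.
have [cr ci] := ccontinuous_circ; split; first exact: cr.
move=> t; apply: (@cvgN _ R^o _ _ _ (fun t => complex.Im (circ t))); exact: ci.
Qed.

Lemma cmean_circX k : cmean (fun t => circ t ^+ k.+1) = 0.
Proof.
have [c1 s1] := cos_2pi_nat k.+1.
pose c : R := 2 * pi * k.+1%:R.
have c0 : c != 0 by rewrite !mulf_neq0// ?pnatr_eq0// gt_eqF ?pi_gt0.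
have m1 : mean (fun t => cos (c * t)) = 0.
  have d (t : R) : is_derive t 1 (fun t => c^-1 * sin (c * t)) (cos (c * t)).
    apply: (trigger_derive (is_deriveZ c^-1 (is_derive_scale (is_derive_sin (c * t))))).
    by rewrite /GRing.scale /= mulrA mulVf// mul1r.
  rewrite (mean_derivative d); last by apply: continuous_scale2; exact: continuous_cos.
  by rewrite mulr1 mulr0 s1 sin0 subrr.
have m2 : mean (fun t => sin (c * t)) = 0.
  have d (t : R) : is_derive t 1 (fun t => - c^-1 * cos (c * t)) (sin (c * t)).
    apply: (trigger_derive (is_deriveZ (- c^-1) (is_derive_scale (is_derive_cos (c * t))))).
    by rewrite /GRing.scale /= mulrN mulNr mulrN opprK mulrA mulVf// mul1r.
  rewrite (mean_derivative d); last by apply: continuous_scale2; exact: continuous_sin.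
  by rewrite mulr1 mulr0 c1 cos0 subrr.
transitivity (mean (fun t => cos (c * t)) +i* mean (fun t => sin (c * t))); last first.
  by rewrite m1 m2.
by congr (mean _ +i* mean _); apply/funext => t; rewrite circX.
Qed.

End Mean.

Section CircleIntegrals.
Context {R : realType}.

Lemma cmean_conj (u : R -> R[i]) : ccontinuous u ->
  cmean (fun t => conjC (u t)) = conjC (cmean u).
Proof.
move=> [ur ui]; rewrite -[RHS]/(mean _ +i* - mean _) -mulN1r -meanZ//.
by congr (mean _ +i* mean _); apply/funext => t; rewrite ?mulN1r; case: (u t).
Qed.

Lemma ccontinuous_inv (u : R -> R[i]) (d : R) : 0 < d -> (forall t, d <= cabs (u t)) ->
  ccontinuous u -> ccontinuous (fun t => (u t)^-1).
Proof.
move=> d0 hd cu; apply: (@ccontinuous_lipschitz _ u _ (d ^- 2) cu) => s t.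
have us : 0 < cabs (u s) by exact: lt_le_trans (hd s).
have ut : 0 < cabs (u t) by exact: lt_le_trans (hd t).
have -> : (u s)^-1 - (u t)^-1 = (u s * u t)^-1 * (u t - u s).
  by field; rewrite -!cabs_gt0 us ut.
rewrite cabsM cabsV cabsM cabs_distC ler_wpM2r ?cabs_ge0//.
by rewrite lef_pV2 ?posrE ?mulr_gt0// expr2 ler_pM ?(ltW d0).
Qed.

Lemma ccontinuous_geometric (v : R[i]) (u : R -> R[i]) : cabs v < 1 ->
  ccontinuous u -> (forall t, cabs (u t) = 1) -> ccontinuous (fun t => (1 - v * u t)^-1).
Proof.
move=> v1 cu u1; have d0 : 0 < 1 - cabs v by rewrite subr_gt0.
apply: ccontinuous_inv d0 _ _ => [t|].
  by have := @cabs_1sub_gt0 R (v * u t); rewrite cabsM u1 mulr1 => /(_ v1) /andP[].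
under eq_fun do rewrite -mulNr; apply: ccontinuousD; first exact: ccontinuous_cst.
by apply: ccontinuousM => //; exact: ccontinuous_cst.
Qed.

(** Only the constant term of the geometric series has a nonzero mean. *)
Lemma cmean_geometric (v : R[i]) : cabs v < 1 ->
  cmean (fun t => (1 - v * circ t)^-1) = 1.
Proof.
move=> v1; have d0 : 0 < 1 - cabs v by rewrite subr_gt0.
have vc t : cabs (v * circ t) = cabs v by rewrite cabsM cabs_circ mulr1.
have low t : 1 - cabs v <= cabs (1 - v * circ t).
  have := @cabs_1sub_gt0 R (v * circ t); rewrite vc => /(_ v1).
  by case/andP.
have cvc : ccontinuous (fun t => v * circ t).
  by apply: ccontinuousM; [exact: ccontinuous_cst|exact: ccontinuous_circ].
apply: cmean_unif_limit.
  by apply: ccontinuous_geometric => //; [exact: ccontinuous_circ|exact: cabs_circ].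
move=> e e0.
have : (fun n => cabs v ^+ n * (1 - cabs v)^-1) @ \oo --> 0 * (1 - cabs v)^-1.
  by apply: cvgMl; apply: cvg_expr; rewrite ger0_norm ?cabs_ge0.
rewrite mul0r => /cvgr_le /(_ e e0)[N _ hN].
exists (fun t => \sum_(k < N.+1) (v * circ t) ^+ k); split.
- by apply: ccontinuous_sum => k; exact: ccontinuousX.
- move=> t; rewrite [X in X - _](geometric_tail N.+1); last first.
    by apply/eqP => h; move: v1; rewrite -(vc t) h cabs1 ltxx.
  rewrite addrAC subrr add0r cabsM cabsX cabsV vc.
  rewrite (le_trans _ (hN N.+1 _)) ?leqnSn//= ler_wpM2l ?exprn_ge0 ?cabs_ge0//.
  by rewrite lef_pV2 ?posrE// (lt_le_trans d0).
rewrite cmean_sum => [|k]; last exact: ccontinuousX.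
rewrite big_ord_recl /= big1 ?addr0 => [|k _]; first exact: cmean_cst.
under eq_fun do rewrite exprMn.
by rewrite cmeanZ ?cmean_circX ?mulr0//; apply: ccontinuousX; exact: ccontinuous_circ.
Qed.

Lemma cmean_geometric_conj (v : R[i]) : cabs v < 1 ->
  cmean (fun t => (1 - v * conjC (circ t))^-1) = 1.
Proof.
move=> v1; have v1' : cabs (conjC v) < 1 by rewrite /cabs norm_conjC -/(cabs v).
transitivity (conjC (cmean (fun t => (1 - conjC v * circ t)^-1))); last first.
  by rewrite cmean_geometric// rmorph1.
rewrite -cmean_conj.
  congr cmean; apply/funext => t.
  by rewrite fmorphV rmorphB rmorph1 rmorphM /= conjCK.
by apply: ccontinuous_geometric => //; [exact: ccontinuous_circ|exact: cabs_circ].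
Qed.

Lemma atan_ge0 (x : R) : 0 <= x -> 0 <= atan x.
Proof.
move=> x0; rewrite leNgt; apply/negP => h.
have h2 := atan_gtNpi2 x; have := pi_gt0 R => pi0.
have s : sin (atan x) < 0.
  by rewrite -oppr_gt0 -sinN sin_gt0_pi// oppr_gt0 h /=; lra.
have c : 0 < cos (atan x) by rewrite cos_gt0_pihalf// h2; lra.
by move: x0; rewrite -[x in 0 <= x]atanK /tan leNgt pmulr_llt0 ?invr_gt0// s.
Qed.

(** On the right half plane, where the circle used below lies, this replaces [acos]
    by a function that is continuous everywhere. *)
Lemma principal_arg_atan (z : R[i]) : 0 < complex.Re z ->
  principal_arg z = atan (complex.Im z / complex.Re z).
Proof.
case: z => x y /= x0; rewrite /principal_arg /=.
have c : cos (atan (y / x)) = x / cabs (x +i* y).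
  rewrite cos_atan -[LHS]mul1r; apply/eqP.
  have -> : 1 + (y / x) ^+ 2 = (cabs (x +i* y) / x) ^+ 2.
    by rewrite !expr_div_n cabs_sqr /=; field; rewrite gt_eqF.
  rewrite sqrtr_sqr ger0_norm ?divr_ge0 ?cabs_ge0 ?(ltW x0)//.
  by rewrite mul1r invf_div.
rewrite -c; have h1 := atan_gtNpi2 (y / x); have h2 := atan_ltpi2 (y / x).
have pi0 := pi_gt0 R.
case: ifPn => y0.
  rewrite cosK// in_itv /= atan_ge0 ?divr_ge0 ?(ltW x0)//=; lra.
rewrite cosKN ?opprK//; apply/andP; split; first lra.
rewrite -ltNge in y0.
by rewrite -oppr_ge0 -atanN atan_ge0// -mulNr divr_ge0 ?oppr_ge0 ?ltW.
Qed.

Variables (M rho : R).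
Hypotheses (rho0 : 0 < rho) (rhoM : rho < M).

Definition shifted_circle (t : R) : R[i] := M%:C + rho%:C * circ t.

Lemma ccontinuous_shifted_circle : ccontinuous shifted_circle.
Proof.
apply: ccontinuousD; first exact: ccontinuous_cst.
by apply: ccontinuousM; [exact: ccontinuous_cst|exact: ccontinuous_circ].
Qed.

Lemma Re_shifted_circle t : complex.Re (shifted_circle t) = M + rho * cos (2 * pi * t).
Proof. by rewrite /shifted_circle Re_add Re_scale. Qed.

Lemma Im_shifted_circle t : complex.Im (shifted_circle t) = rho * sin (2 * pi * t).
Proof. by rewrite /shifted_circle Im_add Im_mul /= mul0r addr0 add0r. Qed.

Lemma Re_shifted_circle_ge t : M - rho <= complex.Re (shifted_circle t).
Proof.
by rewrite Re_shifted_circle lerD2l lerNl -mulrN ler_piMr ?(ltW rho0)// lerNl cos_geN1.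
Qed.

Lemma shifted_circle_gt0 t : 0 < complex.Re (shifted_circle t).
Proof. by rewrite (lt_le_trans _ (Re_shifted_circle_ge t))// subr_gt0. Qed.

Lemma cabs_shifted_circle_ge t : M - rho <= cabs (shifted_circle t).
Proof.
rewrite (le_trans (Re_shifted_circle_ge t))// (le_trans (ler_norm _))//.
exact: ler_cabs_Re.
Qed.

Lemma cabs_shifted_circle_le t : cabs (shifted_circle t) <= M + rho.
Proof.
rewrite (le_trans (cabsD _ _))// cabsM cabs_circ mulr1 !cabsR !ger0_norm// ltW//.
exact: lt_trans rhoM.
Qed.

Lemma continuous_ln_cabs_shifted_circle :
  continuous (fun t => ln (cabs (shifted_circle t))).
Proof.
have [c _] : ccontinuous (fun t => (cabs (shifted_circle t))%:C).
  apply: (@ccontinuous_lipschitz _ _ _ 1 ccontinuous_shifted_circle) => s t.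
  rewrite mul1r -realCB cabsR; exact: ler_cabs_dist.
move=> t; apply: (@cvg_comp _ _ _ (fun t => cabs (shifted_circle t)) (@ln R) _
  (nbhs (cabs (shifted_circle t)))); first exact: c.
apply: continuous_ln; rewrite (lt_le_trans _ (cabs_shifted_circle_ge t))//.
by rewrite subr_gt0.
Qed.

Lemma ccontinuous_log_shifted_circle :
  ccontinuous (fun t => principal_log (shifted_circle t)).
Proof.
split; first exact: continuous_ln_cabs_shifted_circle.
rewrite (_ : (fun t => _) = (fun t => atan (complex.Im (shifted_circle t) /
    complex.Re (shifted_circle t)))); last first.
  by apply/funext => t; rewrite /= principal_arg_atan// shifted_circle_gt0.
have [cr ci] := ccontinuous_shifted_circle.
move=> t; apply: (@cvg_comp _ _ _ (fun t => complex.Im (shifted_circle t) /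
  complex.Re (shifted_circle t)) (@atan R) _ (nbhs (complex.Im (shifted_circle t) /
  complex.Re (shifted_circle t)))); last exact: continuous_atan.
apply: cvgM; first exact: ci.
by apply: cvgV; [rewrite gt_eqF// shifted_circle_gt0|exact: cr].
Qed.

(** By [ln_cabs_1sub], the integrand is a uniform limit of [ln M] plus trigonometric
    polynomials without constant term. *)
Lemma mean_ln_shifted_circle : mean (fun t => ln (cabs (shifted_circle t))) = ln M.
Proof.
have M0 : 0 < M by exact: lt_trans rhoM.
pose v : R[i] := (- (rho / M))%:C.
have v1 : cabs v < 1.
  by rewrite cabsR normrN ger0_norm ?divr_ge0 ?ltW// ltr_pdivrMr// mul1r.
have vc t : cabs (v * circ t) = cabs v by rewrite cabsM cabs_circ mulr1.
have cE t : shifted_circle t = M%:C * (1 - v * circ t).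
  rewrite /v realCN mulNr opprK mulrDr mulr1 mulrA -realCM /shifted_circle.
  by rewrite mulrCA mulfV ?mulr1// gt_eqF.
have d0 : 0 < 1 - cabs v by rewrite subr_gt0.
apply: mean_unif_limit; first exact: continuous_ln_cabs_shifted_circle.
move=> e e0.
have : (fun n => cabs v ^+ n * (1 - cabs v)^-1) @ \oo --> 0 * (1 - cabs v)^-1.
  by apply: cvgMl; apply: cvg_expr; rewrite ger0_norm ?cabs_ge0.
rewrite mul0r => /cvgr_le /(_ e e0)[N _ hN].
pose P t := \sum_(k < N) (v ^+ k.+1 / k.+1%:R) * circ t ^+ k.+1.
have cP : ccontinuous P.
  apply: ccontinuous_sum => k; apply: ccontinuousM; first exact: ccontinuous_cst.
  by apply: ccontinuousX; exact: ccontinuous_circ.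
have mP : cmean P = 0.
  rewrite cmean_sum => [|k]; last first.
    apply: ccontinuousM; first exact: ccontinuous_cst.
    by apply: ccontinuousX; exact: ccontinuous_circ.
  rewrite big1// => k _; rewrite cmeanZ ?cmean_circX ?mulr0//.
  by apply: ccontinuousX; exact: ccontinuous_circ.
exists (fun t => ln M - complex.Re (P t)); split.
- by move=> t; apply: cvgB; [exact: cvg_cst|case: cP => + _; exact].
- move=> t; have h : 0 < cabs (1 - v * circ t).
    by have := @cabs_1sub_gt0 R (v * circ t); rewrite vc => /(_ v1)/andP[h]; exact: lt_le_trans.
  rewrite cE cabsM cabsR (gtr0_norm M0) lnM ?posrE//.
  rewrite (le_trans _ (hN N.+1 _)) ?leqnSn//=.
  have := @ln_cabs_1sub R (v * circ t) N; rewrite vc => /(_ v1).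
  have -> : \sum_(k < N) (v * circ t) ^+ k.+1 / k.+1%:R = P t.
    by apply: eq_bigr => k _; rewrite exprMn mulrAC.
  have -> // : ln M + ln (cabs (1 - v * circ t)) - (ln M - complex.Re (P t)) =
    ln (cabs (1 - v * circ t)) + complex.Re (P t) by ring.
rewrite meanB; [|by move=> t; exact: cvg_cst|by case: cP].
by rewrite mean_cst -[mean (fun t => _ (P t))]/(complex.Re (cmean P)) mP subr0.
Qed.

End CircleIntegrals.

(** * A cycle in the slit plane *)

Section CircleLoop.
Context {R : realType}.
Variables (M rho : R).
Hypotheses (rho0 : 0 < rho) (rhoM : rho < M).
Notation p := (shifted_circle M rho).

Lemma is_derive_Re_shifted_circle (t : R) : is_derive t 1 (@complex.Re R \o p)
  (- (2 * pi * rho) * sin (2 * pi * t)).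
Proof.
rewrite (_ : _ \o _ = cst M + rho \*: (fun t => cos (2 * pi * t))); last first.
  by apply/funext => u; exact: Re_shifted_circle.
have h := is_derive_scale (is_derive_cos (2 * pi * t)).
apply: (trigger_derive (is_deriveD (is_derive_cst M t 1) (is_deriveZ rho h))).
rewrite add0r /GRing.scale /=; ring.
Qed.

Lemma is_derive_Im_shifted_circle (t : R) : is_derive t 1 (@complex.Im R \o p)
  ((2 * pi * rho) * cos (2 * pi * t)).
Proof.
rewrite (_ : _ \o _ = rho \*: (fun t => sin (2 * pi * t))); last first.
  by apply/funext => u; exact: Im_shifted_circle.
have h := is_derive_scale (is_derive_sin (2 * pi * t)).
apply: (trigger_derive (is_deriveZ rho h)); rewrite /GRing.scale /=; ring.
Qed.

Lemma path_derive_shifted_circle t : path_derive p t = two_pi_i * (rho%:C * circ t).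
Proof.
rewrite /path_derive !derive1E; have [_ ->] := is_derive_Re_shifted_circle t.
have [_ ->] := is_derive_Im_shifted_circle t.
apply/eqP; rewrite eq_complex /=; apply/andP; split; apply/eqP; ring.
Qed.

Lemma C1_loop_shifted_circle : C1_loop p.
Proof.
split.
  rewrite /shifted_circle /circ mulr0 cos0 sin0 mulr1 mulr_natl cos2pi sin2pi//.
have cc (c : R) (f : R -> R) : continuous f -> continuous (fun t => c * f (2 * pi * t)).
  by move=> cf t; apply: cvgM; [exact: cvg_cst|exact: continuous_scale2].
move=> q [->|->]; split.
- by move=> t; have [] := is_derive_Re_shifted_circle t.
- rewrite (_ : derive1 _ = (fun t => - (2 * pi * rho) * sin (2 * pi * t))).
    exact/cc/continuous_sin.
  by apply/funext => t; rewrite derive1E; have [_ ->] := is_derive_Re_shifted_circle t.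
- by move=> t; have [] := is_derive_Im_shifted_circle t.
- rewrite (_ : derive1 _ = (fun t => 2 * pi * rho * cos (2 * pi * t))).
    exact/cc/continuous_cos.
  by apply/funext => t; rewrite derive1E; have [_ ->] := is_derive_Im_shifted_circle t.
Qed.

Lemma two_pi_i_neq0 : two_pi_i != 0 :> R[i].
Proof.
by rewrite eq_complex /= eqxx /= mulf_neq0// ?pnatr_eq0// gt_eqF// pi_gt0.
Qed.

Lemma cycle_integral_shifted_circle (g : R[i] -> R[i]) :
  ccontinuous (fun t => g (p t) * (rho%:C * circ t)) ->
  two_pi_i^-1 * cycle_integral [:: p] g = cmean (fun t => g (p t) * (rho%:C * circ t)).
Proof.
move=> cg; rewrite /cycle_integral big_seq1.
rewrite -[path_integral p g]/(cmean (fun t => g (p t) * path_derive p t)).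
rewrite (_ : (fun t => _) = (fun t => two_pi_i * (g (p t) * (rho%:C * circ t)))).
  by rewrite cmeanZ// mulKf// two_pi_i_neq0.
by apply/funext => t; rewrite path_derive_shifted_circle mulrCA.
Qed.

Lemma rhoC : rho%:C != 0 :> R[i].
Proof. by rewrite (inj_eq (@complexI R)) gt_eqF. Qed.

(** A geometric series in [(w - M) / (z - M)]. *)
Lemma winding_inside w : cabs (w - M%:C) < rho -> winding_number [:: p] w = 1.
Proof.
move=> wr; rewrite /winding_number; pose v := (w - M%:C) / rho%:C.
have v1 : cabs v < 1 by rewrite cabsM cabsV cabsR gtr0_norm// ltr_pdivrMr// mul1r.
have E t : (p t - w)^-1 * (rho%:C * circ t) = (1 - v * conjC (circ t))^-1.
  have c0 := circ_neq0 t; have r0 := rhoC.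
  have -> : p t - w = (rho%:C * circ t) * (1 - v * conjC (circ t)).
    by rewrite conj_circ /v /shifted_circle; field; rewrite c0 r0.
  by rewrite invfM mulrAC mulVf ?mul1r// mulf_neq0.
rewrite cycle_integral_shifted_circle; under eq_fun do rewrite E.
  exact: cmean_geometric_conj.
apply: ccontinuous_geometric => //; first exact: ccontinuous_conj_circ.
by move=> t; rewrite /cabs norm_conjC -/(cabs _) cabs_circ.
Qed.

(** A geometric series in [(z - M) / (w - M)]. *)
Lemma winding_outside w : rho < cabs (w - M%:C) -> winding_number [:: p] w = 0.
Proof.
move=> wr; rewrite /winding_number; pose v := rho%:C / (w - M%:C).
have w0 : 0 < cabs (w - M%:C) by exact: lt_trans wr.
have wn0 : w - M%:C != 0 by rewrite -cabs_gt0.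
have v1 : cabs v < 1 by rewrite cabsM cabsV cabsR gtr0_norm// ltr_pdivrMr// mul1r.
have vt t : 1 - v * circ t != 0.
  rewrite -cabs_gt0; have := @cabs_1sub_gt0 R (v * circ t).
  by rewrite cabsM cabs_circ mulr1 => /(_ v1) /andP[]; exact: lt_le_trans.
have E t : (p t - w)^-1 * (rho%:C * circ t) = 1 - (1 - v * circ t)^-1.
  have -> : p t - w = - (w - M%:C) * (1 - v * circ t).
    by rewrite /v /shifted_circle; field.
  have -> : rho%:C = v * (w - M%:C) by rewrite /v divfK.
  by field; rewrite wn0 vt.
have cg : ccontinuous (fun t => (1 - v * circ t)^-1).
  apply: ccontinuous_geometric => //; first exact: ccontinuous_circ.
  exact: cabs_circ.
have cg' : ccontinuous (fun t => -1 * (1 - v * circ t)^-1).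
  by apply: ccontinuousM => //; exact: ccontinuous_cst.
rewrite cycle_integral_shifted_circle; under eq_fun do rewrite E -mulN1r.
  rewrite cmeanD//; last exact: ccontinuous_cst.
  by rewrite cmeanZ// cmean_geometric// cmean_cst mulr1 subrr.
by apply: ccontinuousD => //; exact: ccontinuous_cst.
Qed.

(** The slit is at distance [M > rho] from the centre. *)
Lemma surrounds_disc (K : set R[i]) :
  (forall w, K w -> cabs (w - M%:C) < rho) -> surrounds [:: p] K slit_plane.
Proof.
move=> hK; split.
- move=> p'; rewrite inE => /eqP ->; split; first exact: C1_loop_shifted_circle.
  move=> t _; split.
    by move=> [_]; rewrite leNgt shifted_circle_gt0.
  move=> /hK; rewrite /shifted_circle addrAC subrr add0r cabsM cabs_circ mulr1 cabsR.
  by rewrite gtr0_norm// ltxx.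
- by move=> w /hK; exact: winding_inside.
- move=> w /contrapT[w0 wle]; apply: winding_outside.
  rewrite (lt_le_trans rhoM)// cabs_distC (le_trans _ (ler_cabs_Re _))// Re_sub /=.
  by rewrite (le_trans _ (ler_norm _))// lerDl oppr_ge0.
Qed.

Lemma principal_log_bound t : cabs (principal_log (p t)) <=
  `|ln (M - rho)| + `|ln (M + rho)| + pi.
Proof.
have M0 : 0 < M by exact: lt_trans rhoM.
have d0 : 0 < M - rho by rewrite subr_gt0.
have h1 : M - rho <= cabs (p t) by exact: cabs_shifted_circle_ge.
have h2 : cabs (p t) <= M + rho by exact: cabs_shifted_circle_le.
have c0 : 0 < cabs (p t) by exact: lt_le_trans h1.
have cl (a b : R) : cabs (a +i* b) <= `|a| + `|b|.
  have -> : a +i* b = a%:C + 'i%C * b%:C by rewrite [LHS]complexE.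
  rewrite (le_trans (cabsD _ _))// cabsM !cabsR /cabs normc_def /= expr0n expr1n add0r sqrtr1.
  by rewrite mul1r.
rewrite (le_trans (cl _ _))// lerD//.
  have l1 : ln (M - rho) <= ln (cabs (p t)) by rewrite ler_ln ?posrE.
  have l2 : ln (cabs (p t)) <= ln (M + rho) by rewrite ler_ln ?posrE// (lt_le_trans c0).
  rewrite ler_norml; have := ler_norm (ln (M + rho)); have := ler_norm (- ln (M - rho)).
  have := normr_ge0 (ln (M + rho)); have := normr_ge0 (ln (M - rho)).
  rewrite normrN; lra.
have := pi_gt0 R; rewrite principal_arg_atan ?shifted_circle_gt0// ler_norml.
have := atan_gtNpi2 (complex.Im (p t) / complex.Re (p t)).
have := atan_ltpi2 (complex.Im (p t) / complex.Re (p t)); lra.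
Qed.

End CircleLoop.

(** * The norm of the logarithm *)

Section LogarithmNorm.
Context {R : realType} {H : completeNormedModType R[i]} (ip : {dot H for conjC}).
Hypothesis hip : is_inner_product ip.
Variables (T L : bop H) (x0 : H).
Hypotheses (x0_neq0 : x0 != 0) (T_sa : is_adjoint ip T T)
  (T_ge0 : forall x, 0 <= quad ip T x) (T_expanding : forall x, rnorm x <= rnorm (T x)).

Lemma opnorm_ge1 : 1 <= opnorm T.
Proof.
have u1 := rnorm_unit x0_neq0; set u := _ *: x0 in u1.
by have := T_expanding u; rewrite u1 => /le_trans; apply; rewrite (le_trans (rnorm_bop _ _))// u1 mulr1.
Qed.

Definition shift : bop H := T - (opnorm T)%:C *: (1 : bop H).

Lemma shiftE x : shift x = T x - (opnorm T)%:C *: x. Proof. by []. Qed.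

(** From [|T x|^2 <= |T| <T x, x>], the Cauchy-Schwarz inequality of the
    positive form [<T x, y>] at [y = T x]. *)
Lemma rnorm_shift x : rnorm (shift x) ^+ 2 <= opnorm T ^+ 2 * rnorm x ^+ 2 - rnorm (T x) ^+ 2.
Proof.
set M := opnorm T; have M0 : 0 < M by rewrite (lt_le_trans ltr01) ?opnorm_ge1.
pose m1 := quad ip T x; pose m2 := rnorm (T x) ^+ 2; pose m3 := quad ip T (T x).
have m2E : complex.Re (ip (T x) (T x)) = m2 by rewrite ip_self.
have m3_le : m3 <= M * m2.
  rewrite /m3 (le_trans (quad_le hip _ _))// /m2 expr2 mulrA.
  by rewrite ler_wpM2r ?rnorm_ge0// rnorm_bop.
have m2_le : m2 <= M * m1.
  have := T_ge0 (M%:C *: x - T x).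
  rewrite {1}/quad bopB bopZ !ipBl !ipBr !ipZl !ipZr conjCR !Re_sub !Re_scale.
  rewrite -!/(quad _ _ _) -/m1 -/m3 (adjoint_swap (T x) x T_sa) m2E.
  move=> h; rewrite -(ler_pM2l M0); move: h m3_le; lra.
have -> : rnorm (shift x) ^+ 2 = m2 - 2 * M * m1 + M ^+ 2 * rnorm x ^+ 2.
  have E u : rnorm u ^+ 2 = complex.Re (ip u u) by rewrite ip_self.
  rewrite E shiftE !ipBl !ipBr !ipZl !ipZr conjCR !Re_sub !Re_scale m2E -!/(quad _ _ _) -/m1.
  rewrite -E -T_sa -/(quad ip T x) -/m1 -/M; ring.
rewrite -/m2; lra.
Qed.

(* The spectrum lies in the disc of radius [q] around [M], and the slit at distance
   [M]; the circle is taken midway. *)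
Let M := opnorm T.
Let q := Num.sqrt (M ^+ 2 - 1).
Let rho := (q + M) / 2.

Let M2 : 0 <= M ^+ 2 - 1. Proof. by rewrite subr_ge0 expr_ge1 ?opnorm_ge1// opnorm_ge0. Qed.
Let q0 : 0 <= q. Proof. exact: sqrtr_ge0. Qed.
Let qM : q < M.
Proof.
rewrite -(ltr_pXn2r (n := 2)) ?nnegrE ?opnorm_ge0// sqr_sqrtr//.
by rewrite gtrDl ltrN10.
Qed.
Let qrho : q < rho. Proof. by rewrite ltr_pdivlMr// mulr_natr mulr2n ltrD2l. Qed.
Let rhoM : rho < M. Proof. by rewrite ltr_pdivrMr// mulr_natr mulr2n ltrD2r. Qed.
Let rho0 : 0 < rho. Proof. exact: le_lt_trans qrho. Qed.

Lemma opnorm_shift : opnorm shift <= q.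
Proof.
apply: opnorm_least_real => // x.
rewrite -ler_sqr ?nnegrE ?rnorm_ge0 ?mulr_ge0 ?rnorm_ge0// exprMn sqr_sqrtr//.
rewrite (le_trans (rnorm_shift x))// mulrBl mul1r lerD2l lerN2.
by rewrite ler_sqr ?nnegrE ?rnorm_ge0.
Qed.

Lemma resolvent_outside l : q < cabs (l - M%:C) ->
  exists2 B, is_resolvent T l B & opnorm B <= (cabs (l - M%:C) - q)^-1.
Proof.
move=> ql; have [|B [h1 h2 hB]] := @neumann_inverse _ _ shift (l - M%:C).
  exact: le_lt_trans opnorm_shift ql.
have E x : l *: x - T x = (l - M%:C) *: x - shift x.
  by rewrite shiftE scalerBl opprB addrA subrK.
exists B; first by split=> x; rewrite E.
rewrite (le_trans hB)// lef_pV2 ?posrE ?subr_gt0//.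
  by rewrite lerD2l lerN2 opnorm_shift.
exact: le_lt_trans opnorm_shift ql.
Qed.

Notation p := (shifted_circle M rho).

Lemma resolvent_circle t : is_resolvent T (p t) (resolvent T (p t)) /\
  opnorm (resolvent T (p t)) <= (rho - q)^-1.
Proof.
have pM : cabs (p t - M%:C) = rho.
  by rewrite /shifted_circle addrAC subrr add0r cabsM cabs_circ mulr1 cabsR gtr0_norm.
have [|B hB nB] := @resolvent_outside (p t); first by rewrite pM.
have hR : is_resolvent T (p t) (resolvent T (p t)) by apply: getPex; exists B.
split=> //; suff -> : resolvent T (p t) = B by rewrite -pM.
apply: bop_ext => y; have [_ h2] := hR; have [h1 _] := hB.
by rewrite -[LHS]h1 h2.
Qed.

(** By the resolvent identity, resolvents are Lipschitz along the circle. *)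
Lemma ccontinuous_resolvent x : ccontinuous (fun t => ip (resolvent T (p t) x) x).
Proof.
apply: (@ccontinuous_lipschitz _ _ _ ((rho - q)^-1 ^+ 2 * rnorm x ^+ 2)
  (ccontinuous_shifted_circle M rho)) => s t.
have [[hs _] ns] := resolvent_circle s; have [[_ ht] nt] := resolvent_circle t.
have d0 : 0 <= (rho - q)^-1 by rewrite invr_ge0 subr_ge0 ltW.
set d := (rho - q)^-1 in d0 ns nt *; set y := resolvent T (p t) x.
have hy : rnorm y <= d * rnorm x.
  by rewrite (le_trans (rnorm_bop _ _))// ler_wpM2r ?rnorm_ge0.
have xy : x = p t *: y - T y by rewrite ht.
clearbody y; rewrite -ipBl (le_trans (cauchy_schwarz hip _ _))//.
have -> : resolvent T (p s) x - y = - resolvent T (p s) ((p s - p t) *: y).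
  rewrite [in LHS]xy -[X in _ - X](hs y) -bopB -[RHS]bopN; congr (resolvent T (p s) _).
  by rewrite opprB addrA subrK -scalerBl -scaleNr opprB.
have h : rnorm (resolvent T (p s) ((p s - p t) *: y)) <= d * (cabs (p s - p t) * (d * rnorm x)).
  rewrite (le_trans (rnorm_bop _ _))// rnormZ ler_pM ?opnorm_ge0 ?mulr_ge0 ?cabs_ge0 ?rnorm_ge0//.
  by rewrite ler_wpM2l ?cabs_ge0.
rewrite rnormN (le_trans (ler_wpM2r (rnorm_ge0 x) h))//.
by rewrite le_eqVlt; apply/orP; left; apply/eqP; ring.
Qed.

Hypothesis hL : is_log ip T L.

(** The derivative of the path contributes [2 pi i rho circ t], whose first factor
    cancels the normalization of the functional calculus. *)
Lemma quad_log x : ip (L x) x = cmean (fun t => principal_log (p t) *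
  (ip (resolvent T (p t) x) x * (rho%:C * circ t))).
Proof.
have [_ /(_ [:: p])h] := hL; rewrite h.
  rewrite cycle_integral_shifted_circle.
    by congr cmean; apply/funext => t; rewrite [RHS]mulrA.
  apply: ccontinuousM; last first.
    by apply: ccontinuousM; [exact: ccontinuous_cst|exact: ccontinuous_circ].
  apply: ccontinuousM; last exact: ccontinuous_resolvent.
  exact: ccontinuous_log_shifted_circle.
apply: surrounds_disc => // w; apply: contra_notT; rewrite -leNgt => rw.
have [|B hB _] := @resolvent_outside w; first exact: lt_le_trans qrho rw.
by exists B.
Qed.

(** On an approximate eigenvector [x] of [T] for the eigenvalue [|T|], the
    resolvent acts like [(z - |T|)^-1], so that Cauchy's formula gives
    [<log T x, x>] close to [ln |T|]. *)
Theorem ln_opnorm_le_log : ln (opnorm T) <= opnorm L.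
Proof.
apply/ler_addgt0Pr => e e0.
have M0 : 0 < M by rewrite (lt_le_trans ltr01) ?opnorm_ge1.
pose b := `|ln (M - rho)| + `|ln (M + rho)| + pi.
have b0 : 0 < b by rewrite ltr_wpDl ?pi_gt0// addr_ge0.
have d0 : 0 < rho - q by rewrite subr_gt0.
pose d := e * (rho - q) / b; have dp : 0 < d by rewrite divr_gt0// mulr_gt0.
pose eta := d ^+ 2 / (2 * M).
have M20 : 0 < 2 * M by rewrite mulr_gt0.
have eta0 : 0 < eta by rewrite divr_gt0 ?exprn_gt0.
have [x x1 hx] := near_opnorm x0_neq0 T eta0.
have sx : rnorm (shift x) <= d.
  rewrite -ler_sqr ?nnegrE ?rnorm_ge0 ?(ltW dp)// (le_trans (rnorm_shift x))//.
  rewrite x1 expr1n mulr1 -/M; set t := rnorm (T x) in hx *.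
  have tM : t <= M by rewrite /t (le_trans (rnorm_bop _ _))// x1 mulr1.
  have -> : M ^+ 2 - t ^+ 2 = (M - t) * (M + t) by ring.
  rewrite (@le_trans _ _ (eta * (2 * M)))//; last by rewrite divfK// gt_eqF// mulr_gt0.
  apply: ler_pM; rewrite ?subr_ge0 ?addr_ge0 ?rnorm_ge0 ?(ltW M0)//.
    by move: hx; rewrite -/M lerBlDr lerBlDl.
  by rewrite mulr_natl mulr2n lerD2l.
pose G t := ip (resolvent T (p t) x) x * (rho%:C * circ t).
have G1 t : cabs (G t - 1) <= d / (rho - q).
  have [[h1 h2] nRes] := resolvent_circle t; set B := resolvent T (p t) in h1 h2 nRes *.
  have mu : rho%:C * circ t = p t - M%:C by rewrite /shifted_circle addrAC subrr add0r.
  have -> : G t - 1 = ip (B (shift x)) x.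
    rewrite /G -/B mu mulrC -ipZl.
    have -> : 1 = ip x x by rewrite ip_self// x1 expr1n.
    rewrite -ipBl; congr (ip _ x).
    rewrite -{2}(h1 x) -bopZ -bopB; congr (B _).
    by rewrite shiftE scalerBl opprB addrC subrKA.
  rewrite (le_trans (cauchy_schwarz hip _ _))// x1 mulr1 (le_trans (rnorm_bop _ _))//.
  by rewrite mulrC ler_pM ?opnorm_ge0 ?rnorm_ge0.
have cG : ccontinuous G.
  apply: ccontinuousM; first exact: ccontinuous_resolvent.
  by apply: ccontinuousM; [exact: ccontinuous_cst|exact: ccontinuous_circ].
have clog : ccontinuous (fun t => principal_log (p t)).
  exact: ccontinuous_log_shifted_circle.
have [cr _] := ccontinuousM clog cG.
have : `|mean (fun t => complex.Re (principal_log (p t) * G t)) -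
    mean (fun t => ln (cabs (p t)))| <= e.
  apply: mean_dist => //; first exact: continuous_ln_cabs_shifted_circle.
  move=> t; have -> : ln (cabs (p t)) = complex.Re (principal_log (p t)) by [].
  rewrite -Re_sub -[X in _ * _ - X]mulr1 -mulrBr (le_trans (ler_cabs_Re _))// cabsM.
  rewrite (le_trans (ler_pM (cabs_ge0 _) (cabs_ge0 _) (principal_log_bound rho0 rhoM t) (G1 t)))//.
  rewrite -/b /d; suff -> : b * (e * (rho - q) / b / (rho - q)) = e by [].
  by field; rewrite !gt_eqF.
rewrite mean_ln_shifted_circle// -[mean _]/(complex.Re (cmean (fun t => principal_log (p t) * G t))).
rewrite -quad_log => h.
have : complex.Re (ip (L x) x) <= opnorm L.
  by rewrite (le_trans (quad_le hip L x))// x1 mulr1 (le_trans (rnorm_bop _ _))// x1 mulr1.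
move: h; rewrite ler_norml -/M => /andP[h _]; lra.
Qed.

End LogarithmNorm.

(** * Spherical distances *)

Section SphericalComparison.
Context {R : realType}.

(** Since [s <= M ^ 2] gives [M (s - M) <= (M - 1) s], squaring reduces the claim to
    [2 s ^ 2 <= M ^ 2 (1 + s ^ 2)], which holds as [(M ^ 2 - 1) ^ 2 >= 0]. *)
Lemma spherical_distance_square (M s : R) : 1 <= M -> M <= s -> s <= M ^+ 2 ->
  spherical_distance (Some s%:C) (Some M%:C) <=
  spherical_distance (Some M%:C) (Some (1 : R[i])).
Proof.
move=> M1 Ms sM2; rewrite /spherical_distance -realCB.
rewrite (_ : M%:C - 1 = (M - 1)%:C); last by rewrite realCB.
rewrite cabs1 expr1n !cabsR !ger0_norm ?subr_ge0//; try lra.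
have p1 : 0 < Num.sqrt (1 + s ^+ 2) by rewrite sqrtr_gt0 ltr_pwDl ?sqr_ge0.
have p2 : 0 < Num.sqrt (1 + M ^+ 2) by rewrite sqrtr_gt0 ltr_pwDl ?sqr_ge0.
have p3 : 0 < Num.sqrt (1 + 1 : R) by rewrite sqrtr_gt0; lra.
rewrite [X in _ / X <= _]mulrC !invfM mulrCA [leRHS]mulrCA ler_pM2l ?invr_gt0//.
rewrite ler_pdivrMr// mulrAC ler_pdivlMr//.
have sM0 : 0 <= s - M by lra.
have M10 : 0 <= M - 1 by lra.
rewrite -ler_sqr ?nnegrE ?mulr_ge0 ?(ltW p1) ?(ltW p3)// !exprMn.
have s2 : 0 <= s ^+ 2 := sqr_ge0 s.
rewrite !sqr_sqrtr; [|by lra|by lra].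
have M0 : 0 < M by lra.
have h1 : M * (s - M) <= (M - 1) * s by nra.
have h1' : M ^+ 2 * (s - M) ^+ 2 <= (M - 1) ^+ 2 * s ^+ 2.
  by rewrite -!exprMn ler_sqr ?nnegrE ?mulr_ge0//; lra.
have h2 : 2 * s ^+ 2 <= M ^+ 2 * (1 + s ^+ 2).
  have [M2|M2] := leP 2 (M ^+ 2); first by have := sqr_ge0 M; nra.
  have s4 : s ^+ 2 <= (M ^+ 2) ^+ 2 by rewrite ler_sqr ?nnegrE//; nra.
  have h : 0 <= M ^+ 2 * (M ^+ 2 - 1) ^+ 2 by rewrite mulr_ge0 ?sqr_ge0.
  have := ler_wpM2r (_ : 0 <= 2 - M ^+ 2) s4; rewrite subr_ge0 (ltW M2) => /(_ isT) h3.
  move: h h3; nra.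
rewrite -(ler_pM2l (exprn_gt0 2 M0)).
have h3 := ler_wpM2l (sqr_ge0 (M - 1)) h2.
by move: h1' h3; lra.
Qed.

End SphericalComparison.

Theorem theorem2 (R : realType) (H : completeNormedModType R[i])
    (ip : {dot H for conjC}) (hip : is_inner_product ip)
    (f : R[i]^o -> bop H) (A : nat -> bop H)
    (f_holo : forall z : R[i]^o, `|z| < 1 -> derivable f z 1)
    (f_expansion : forall z : R[i]^o, `|z| < 1 ->
       series (fun n => z ^+ n *: A n) @ \oo --> f z)
    (f_modulus : forall z : R[i]^o, `|z| < 1 ->
       exists2 P : bop H, is_modulus ip (f z) P & operator_lt ip idfun P)
    (f_normal : forall z : R[i]^o, `|z| < 1 -> normal_operator ip (f z))
    (f0 : f 0 = A 0%N) (A0_gt0 : operator_lt ip (fun=> 0) (A 0%N))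
    (f_spectrum : forall z : R[i]^o, `|z| < 1 ->
       does_not_separate_0_oo (spectrum (f z)))
    (logA0 : bop H) (hlogA0 : is_log ip (A 0%N) logA0)
    (r : R) (r_ge0 : 0 <= r)
    (hr : r <= (2 * (ln (opnorm (A 0%N)) / opnorm logA0) - 1) /
               (2 * (ln (opnorm (A 0%N)) / opnorm logA0) + 1)) :
  spherical_distance
    (sphere_of_ereal (\sum_(0 <= n <oo) (opnorm (A n) * r ^+ n)%:E)%E)
    (Some (opnorm (A 0%N))%:C) <=
  spherical_distance (Some (opnorm (A 0%N))%:C) (Some 1).
Proof.
set M := opnorm (A 0%N) in hr *.
have [[x0 x0_neq0]|H0] := pselect (exists x0 : H, x0 != 0); last first.
  (* On the zero space the quotient is [0 / _], so the bound on [r] is [-1]. *)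
  have M0 : M = 0.
    apply/eqP; rewrite opnorm_eq0; apply/eqP/bop_ext => x; rewrite bop_zeroE.
    by apply/eqP; apply: contrapT => /negP Ax; apply: H0; exists (A 0%N x).
  move: hr; rewrite M0 ln0// mul0r mulr0 sub0r add0r divr1 => hr.
  by have := le_trans r_ge0 hr; rewrite lerNr oppr0 ler10.
(* [|f(z) x| = |P x|] for the modulus [P], and [<P x, x> >= <x, x>]. *)
have f_expanding z : cabs z < 1 -> forall x, rnorm x <= rnorm (f z x).
  move=> z1 x; have [->|xn0] := eqVneq x 0; first by rewrite bop0 rnorm0.
  have [|P [_ [B hB PB]] [_ P_sa Pgt]] := f_modulus z; first by rewrite -cabsC (ltcR _ 1).
  have fP : rnorm (f z x) = rnorm (P x).
    apply/eqP; rewrite -(eqrXn2 (n := 2)) ?rnorm_ge0// -(inj_eq (@complexI R)).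
    rewrite (rnorm2_adjoint hip x hB) -[B _](congr1 (@^~ x) PB) /=.
    by rewrite P_sa ip_self.
  have x_gt0 : 0 < rnorm x by rewrite rnorm_gt0.
  rewrite fP -(ler_pM2r x_gt0) (le_trans _ (quad_le hip P x))//.
  have := Pgt x xn0; rewrite ip_self// ltcE => /andP[_ /ltW] /=.
  by rewrite expr2.
have [_ A0_sa A0_pos] := A0_gt0.
have A0_ge0 x : 0 <= quad ip (A 0%N) x.
  have [->|xn0] := eqVneq x 0; first by rewrite /quad ip0r.
  by have := A0_pos x xn0; rewrite ip0l ltcE => /andP[_ /ltW].
have A0_expanding x : rnorm x <= rnorm (A 0%N x).
  by rewrite -f0 f_expanding// cabs0.
have M1 : 1 <= M by exact: opnorm_ge1 x0_neq0 A0_expanding.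
have M0 : 0 < M by exact: lt_le_trans M1.
have lnM0 : 0 <= ln M by rewrite ln_ge0.
have lnML := ln_opnorm_le_log hip x0_neq0 A0_sa A0_ge0 A0_expanding hlogA0.
have r3 : r <= 3^-1.
  rewrite (le_trans hr)//; set t := ln M / _.
  have t0 : 0 <= t by rewrite divr_ge0 ?opnorm_ge0.
  have t1 : t <= 1.
    (* A quotient by zero is zero. *)
    have [L0|L0] := eqVneq (opnorm logA0) 0; first by rewrite /t L0 invr0 mulr0.
    by rewrite ler_pdivrMr ?mul1r// lt_def L0 opnorm_ge0.
  by rewrite ler_pdivrMr; lra.
have rec := coefficient_norm_recursion hip f_expansion f_normal f_expanding x0_neq0.
have bound N : \sum_(n < N) opnorm (A n) * r ^+ n <= M ^+ 2.
  rewrite (@le_trans _ _ (\sum_(n < N) opnorm (A n) * 3^-1 ^+ n))//.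
    by apply: ler_sum => n _; rewrite ler_wpM2l ?opnorm_ge0// lerXn2r ?nnegrE ?invr_ge0.
  have := majorant_sum (fun n => opnorm_ge0 (A n)) lnM0 rec N.
  by rewrite lnK ?posrE// -/M expr2.
pose u n : \bar R := (opnorm (A n) * r ^+ n)%:E.
have u0 n : (0 <= u n)%E by rewrite lee_fin mulr_ge0 ?opnorm_ge0 ?exprn_ge0.
have uS n : (\sum_(0 <= k < n) u k)%E = (\sum_(k < n) opnorm (A k) * r ^+ k)%:E.
  by rewrite big_mkord sumEFin.
have S_le : (\sum_(0 <= n <oo) u n <= (M ^+ 2)%:E)%E.
  apply: lime_le; first by apply: is_cvg_nneseries => n _ _; exact: u0.
  by apply: nearW => n; rewrite uS lee_fin.
have S_ge : (M%:E <= \sum_(0 <= n <oo) u n)%E.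
  have := @nneseries_lim_ge R u xpredT 0%N 1%N (fun n _ _ => u0 n).
  by rewrite uS big_ord1 expr0 mulr1.
rewrite -[X in sphere_of_ereal X]/((\sum_(0 <= n <oo) u n)%E).
move: S_le S_ge; case: (\sum_(0 <= n <oo) u n)%E => [s| |] //=.
rewrite !lee_fin => sM2 Ms; exact: spherical_distance_square.
Qed.
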